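(* Any almost complex surface in the nearly Kähler $S^3\times S^3$ with parallel second fundamental form is locally congruent to one of the following two immersions: (1) $f\colon\mathbb R^2\to S^3\times S^3$, $(s,t)\mapsto(\cos s+i\sin s,\ \cos t+i\sin t)$; (2) $f\colon S^2\subset\operatorname{Im}\mathbb H\to S^3\times S^3$, $x\mapsto\frac12\bigl(1-\sqrt3\,x,\ 1+\sqrt3\,x\bigr)$, where $S^2$ is the unit sphere in the space $\operatorname{Im}\mathbb H$ of imaginary quaternions.
   Context: $S^3$ is the set of unit quaternions; tangent vectors at $(p,q)\in S^3\times S^3$ are written $Z=(U,V)$ with $U\in T_pS^3$, $V\in T_qS^3$. The nearly Kähler structure consists of $JZ=\frac{1}{\sqrt3}\bigl(2pq^{-1}V-U,\,-2qp^{-1}U+V\bigr)$ and $g(Z,Z')=\frac12\bigl(\langle Z,Z'\rangle+\langle JZ,JZ'\rangle\bigr)$, where $\langle\cdot,\cdot\rangle$ is the standard product metric. An almost complex surface is an (immersed) 2-dimensional submanifold $M$ with $J(TM)=TM$. Let $\nabla$ be its Levi-Civita connection, $\nabla^\perp$ the normal connection and $h$ the second fundamental form; the second fundamental form is parallel if $(\nabla h)(X,Y,Z)=\nabla^\perp_X h(Y,Z)-h(\nabla_XY,Z)-h(Y,\nabla_XZ)$ vanishes for all tangent $X,Y,Z$. For unit quaternions $a,b,c$ the map $(p,q)\mapsto(apc^{-1},bqc^{-1})$ is an isometry of $(S^3\times S^3,g)$ preserving $J$. $M$ is locally congruent to an immersion $f$ if every point of $M$ has a neighbourhood in $M$ that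 is mapped by such an isometry onto an open piece of the surface parametrized by $f$.
   Formalization: The surface M is assumed connected; a disjoint union of a piece of (1) and a piece of (2) satisfies all stated hypotheses but is not locally congruent to a single one of the two immersions. For a general surface the result applies to each connected component. *)

(* Defs.v *)
From HB Require Import structures.
From mathcomp Require Import all_boot all_order all_algebra.
From mathcomp Require Import all_classical all_reals all_analysis.

Set Implicit Arguments.
Unset Strict Implicit.
Unset Printing Implicit Defensive.

Import Order.TTheory GRing.Theory Num.Theory.
Import numFieldNormedType.Exports.

Local Open Scope classical_set_scope.
Local Open Scope ring_scope.

Section Smooth.
Context {R : realType} {V W : normedModType R}.

Fixpoint Ck (k : nat) (U : set V) (f : V -> W) : Prop :=
  match k with
  | 0%N => forall x, U x -> {for x, continuous f}
  | k'.+1 => (forall x, U x -> differentiable f x) /\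
             (forall v : V, Ck k' U ('D_v f))
  end.

(* Intended for an open set [U]. *)
Definition smooth (U : set V) (f : V -> W) : Prop := forall k, Ck k U f.

End Smooth.

Section LeviCivita.
Context {R : realType} {E : normedModType R}.
(* [N] is a submanifold of the vector space [E], [T x] is its tangent space
   at [x] and [g] is a Riemannian metric on [N].  A vector field on [N] is
   represented by an extension to a neighbourhood of [N] in [E]. *)
Variables (N : set E) (T : E -> set E) (g : E -> E -> E -> R).

Definition vector_field (X : E -> E) : Prop :=
  (exists O : set E, [/\ open O, N `<=` O & smooth O X]) /\
  (forall x, N x -> T x (X x)).

(* A connection on the tangent bundle of [N] differs from the flat derivative
   of the ambient space [E] by a tensor, here [Gamma].  When [N] is open in
   [E], [Gamma] is given by the Christoffel symbols. *)
Definition nabla (Gamma : E -> E -> E -> E) (X Y : E -> E) (x : E) : E :=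
  'D_(X x) Y x + Gamma x (X x) (Y x).

Definition lie_bracket (X Y : E -> E) (x : E) : E :=
  'D_(X x) Y x - 'D_(Y x) X x.

Definition is_connection (Gamma : E -> E -> E -> E) : Prop :=
  [/\ forall x (a : R) v v' w, N x -> T x v -> T x v' -> T x w ->
        Gamma x (a *: v + v') w = a *: Gamma x v w + Gamma x v' w,
      forall x (a : R) v w w', N x -> T x v -> T x w -> T x w' ->
        Gamma x v (a *: w + w') = a *: Gamma x v w + Gamma x v w'
    & forall X Y, vector_field X -> vector_field Y ->
        forall x, N x -> T x (nabla Gamma X Y x)].

Definition torsion_free (Gamma : E -> E -> E -> E) : Prop :=
  forall X Y, vector_field X -> vector_field Y -> forall x, N x ->
    nabla Gamma X Y x - nabla Gamma Y X x = lie_bracket X Y x.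

Definition metric_compatible (Gamma : E -> E -> E -> E) : Prop :=
  forall X Y Z, vector_field X -> vector_field Y -> vector_field Z ->
  forall x, N x ->
    'D_(X x) (fun y => g y (Y y) (Z y)) x =
    g x (nabla Gamma X Y x) (Z x) + g x (Y x) (nabla Gamma X Z x).

Definition is_levi_civita (Gamma : E -> E -> E -> E) : Prop :=
  [/\ is_connection Gamma, torsion_free Gamma & metric_compatible Gamma].

End LeviCivita.

Notation "''H[' R ]" := 'rV[R]_4 (at level 8, format "''H[' R ]").

Section Quaternions.
Context {R : realType}.
Implicit Types x y : 'H[R].

(* a + b i + c j + d k *)
Definition quat (a b c d : R) : 'H[R] := \row_(i < 4) nth 0 [:: a; b; c; d] i.

Definition qmul x y : 'H[R] :=
  quat (x 0 0 * y 0 0 - x 0 1 * y 0 1 - x 0 2 * y 0 2 - x 0 3 * y 0 3)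
       (x 0 0 * y 0 1 + x 0 1 * y 0 0 + x 0 2 * y 0 3 - x 0 3 * y 0 2)
       (x 0 0 * y 0 2 - x 0 1 * y 0 3 + x 0 2 * y 0 0 + x 0 3 * y 0 1)
       (x 0 0 * y 0 3 + x 0 1 * y 0 2 - x 0 2 * y 0 1 + x 0 3 * y 0 0).

Definition qdot x y : R := \sum_(i < 4) x 0 i * y 0 i.

Definition qconj x : 'H[R] := quat (x 0 0) (- x 0 1) (- x 0 2) (- x 0 3).

Definition qinv x : 'H[R] := (qdot x x)^-1 *: qconj x.

Definition unit_quat : set 'H[R] := [set x | qdot x x = 1].

Definition imaginary_sphere : set 'H[R] :=
  [set x : 'H[R] | x 0 0 = 0 /\ qdot x x = 1].

End Quaternions.

Notation "''HH[' R ]" := ('H[R] * 'H[R])%type (at level 8, format "''HH[' R ]").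

Section NearlyKaehler.
Context {R : realType}.

Definition S3xS3 : set 'HH[R] := unit_quat `*` unit_quat.

Definition tangent_S3xS3 (x : 'HH[R]) : set 'HH[R] :=
  [set Z | qdot x.1 Z.1 = 0 /\ qdot x.2 Z.2 = 0].

Definition nkJ (x Z : 'HH[R]) : 'HH[R] :=
  (Num.sqrt 3)^-1 *:
    (2 *: qmul (qmul x.1 (qinv x.2)) Z.2 - Z.1,
     - (2 *: qmul (qmul x.2 (qinv x.1)) Z.1) + Z.2).

Definition product_metric (Z Z' : 'HH[R]) : R :=
  qdot Z.1 Z'.1 + qdot Z.2 Z'.2.

Definition nkg (x Z Z' : 'HH[R]) : R :=
  2^-1 * (product_metric Z Z' + product_metric (nkJ x Z) (nkJ x Z')).

Definition nk_isometry (a b c : 'H[R]) (x : 'HH[R]) : 'HH[R] :=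
  (qmul (qmul a x.1) (qinv c), qmul (qmul b x.2) (qinv c)).

End NearlyKaehler.

Record surface_structure (R : realType) (M : topologicalType) := {
  surface_hausdorff : hausdorff_space M;
  surface_second_countable : @second_countable M;
  chart_index : Type;
  chart_dom : chart_index -> set M;
  chart_img : chart_index -> set 'rV[R]_2;
  chart : chart_index -> M -> 'rV[R]_2;
  param : chart_index -> 'rV[R]_2 -> M;
  chart_dom_open : forall i, open (chart_dom i);
  chart_img_open : forall i, open (chart_img i);
  chart_in : forall i m, chart_dom i m -> chart_img i (chart i m);
  param_in : forall i x, chart_img i x -> chart_dom i (param i x);
  chartK : forall i m, chart_dom i m -> param i (chart i m) = m;
  paramK : forall i x, chart_img i x -> chart i (param i x) = x;
  chart_continuous : forall i m, chart_dom i m -> {for m, continuous (chart i)};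
  param_continuous : forall i x, chart_img i x -> {for x, continuous (param i)};
  chart_cover : forall m, exists i, chart_dom i m;
  chart_transition : forall i j,
    smooth (chart_img i `&` param i @^-1` chart_dom j) (chart j \o param i)
}.

(* The geometry of an immersion [u] of an open subset of the plane into
   S^3 x S^3.  Vector fields in the plane are maps 'rV_2 -> 'rV_2; vector
   fields along [u] are maps 'rV_2 -> 'HH[R]. *)
Section Immersion.
Context {R : realType}.
Variable u : 'rV[R]_2 -> 'HH[R].

Definition tangent_plane (x : 'rV[R]_2) : set 'HH[R] :=
  range (fun v : 'rV[R]_2 => 'D_v u x).

Definition induced_metric (x v w : 'rV[R]_2) : R :=
  nkg (u x) ('D_v u x) ('D_w u x).

Definition gram (x : 'rV[R]_2) : 'M[R]_2 :=
  \matrix_(i, j) induced_metric x (delta_mx 0 i) (delta_mx 0 j).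

(* Coordinates of the g-orthogonal projection of [W] onto the tangent plane. *)
Definition tangent_coord (x : 'rV[R]_2) (W : 'HH[R]) : 'rV[R]_2 :=
  (\row_j nkg (u x) W ('D_(delta_mx 0 j) u x)) *m invmx (gram x).

Definition normal_part (x : 'rV[R]_2) (W : 'HH[R]) : 'HH[R] :=
  W - 'D_(tangent_coord x W) u x.

Definition pushforward (Y : 'rV[R]_2 -> 'rV[R]_2) (x : 'rV[R]_2) : 'HH[R] :=
  'D_(Y x) u x.

(* [GammaN] is the tensor of the connection of S^3 x S^3 (see [nabla]); this
   is the covariant derivative along [u] of a vector field [xi] along [u]. *)
Definition pullback_nabla (GammaN : 'HH[R] -> 'HH[R] -> 'HH[R] -> 'HH[R])
    (X : 'rV[R]_2 -> 'rV[R]_2) (xi : 'rV[R]_2 -> 'HH[R]) (x : 'rV[R]_2) :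
    'HH[R] :=
  'D_(X x) xi x + GammaN (u x) ('D_(X x) u x) (xi x).

Definition normal_connection GammaN (X : 'rV[R]_2 -> 'rV[R]_2)
    (xi : 'rV[R]_2 -> 'HH[R]) (x : 'rV[R]_2) : 'HH[R] :=
  normal_part x (pullback_nabla GammaN X xi x).

Definition second_fundamental_form GammaN (X Y : 'rV[R]_2 -> 'rV[R]_2)
    (x : 'rV[R]_2) : 'HH[R] :=
  normal_part x (pullback_nabla GammaN X (pushforward Y) x).

Definition nabla_h GammaN (GammaM : 'rV[R]_2 -> 'rV[R]_2 -> 'rV[R]_2 -> 'rV[R]_2)
    (X Y Z : 'rV[R]_2 -> 'rV[R]_2) (x : 'rV[R]_2) : 'HH[R] :=
  let h := second_fundamental_form GammaN in
  normal_connection GammaN X (h Y Z) x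
  - h (nabla GammaM X Y) Z x - h Y (nabla GammaM X Z) x.

End Immersion.

Section AlmostComplexSurface.
Context {R : realType} {M : topologicalType}.
Variables (A : surface_structure R M) (F : M -> 'HH[R]).

Definition local_rep (i : chart_index A) : 'rV[R]_2 -> 'HH[R] := F \o param i.

Definition is_immersion : Prop :=
  [/\ forall m, S3xS3 (F m),
      forall i, smooth (@chart_img _ _ A i) (local_rep i)
    & forall i x, chart_img i x -> forall v, 'D_v (local_rep i) x = 0 -> v = 0].

Definition almost_complex : Prop :=
  forall i x, chart_img i x ->
    nkJ (local_rep i x) @` tangent_plane (local_rep i) x =
    tangent_plane (local_rep i) x.

Definition is_levi_civita_S3xS3
    (GammaN : 'HH[R] -> 'HH[R] -> 'HH[R] -> 'HH[R]) : Prop :=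
  is_levi_civita S3xS3 tangent_S3xS3 nkg GammaN.

Definition is_levi_civita_surface
    (GammaM : chart_index A -> 'rV[R]_2 -> 'rV[R]_2 -> 'rV[R]_2 -> 'rV[R]_2) :
    Prop :=
  forall i, is_levi_civita (chart_img i) (fun=> setT)
              (induced_metric (local_rep i)) (GammaM i).

Definition parallel_second_fundamental_form GammaN
    (GammaM : chart_index A -> 'rV[R]_2 -> 'rV[R]_2 -> 'rV[R]_2 -> 'rV[R]_2) :
    Prop :=
  forall i (X Y Z : 'rV[R]_2 -> 'rV[R]_2),
    smooth (chart_img i) X -> smooth (chart_img i) Y -> smooth (chart_img i) Z ->
    forall x, chart_img i x ->
      nabla_h (local_rep i) GammaN (GammaM i) X Y Z x = 0.

End AlmostComplexSurface.

(* [f], restricted to [D], parametrizes the model surface. *)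
Definition locally_congruent (R : realType) (M T : topologicalType)
    (F : M -> 'HH[R]) (D : set T) (f : T -> 'HH[R]) : Prop :=
  forall m : M, exists O : set M, [/\ open O, O m &
    exists a b c : 'H[R], [/\ unit_quat a, unit_quat b, unit_quat c &
      exists W : set T, open W /\
        (nk_isometry a b c \o F) @` O = f @` (D `&` W)]].

Definition flat_torus (R : realType) (st : R * R) : 'HH[R] :=
  (quat (cos st.1) (sin st.1) 0 0, quat (cos st.2) (sin st.2) 0 0).

Definition round_sphere (R : realType) (x : 'H[R]) : 'HH[R] :=
  2^-1 *: (quat 1 0 0 0 - Num.sqrt 3 *: x, quat 1 0 0 0 + Num.sqrt 3 *: x).

(* Main.v *)
Require Import Defs.
From HB Require Import structures.
From mathcomp Require Import all_boot all_order all_algebra.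
From mathcomp Require Import all_classical all_reals all_analysis.
From mathcomp Require Import ring lra.

(** Left translation trivialises the tangent bundle of the group S^3 x S^3: the
    tangent vectors at x are the products of x with pairs (a, c) of imaginary
    quaternions.  In this frame J and g have constant coefficients [J0] and
    [g0], and the usual Koszul argument identifies the Levi-Civita connection
    with a constant bilinear map [Gamma0] ([levi_civita_left]).  An immersion u
    is then studied through its Maurer-Cartan form u^-1 du, here [om], which
    satisfies the structure equation [structure_eq].  The covariant derivative
    of [om] splits into a tangent part, the Christoffel symbols [chris] of the
    surface, and a normal part, the second fundamental form [sff].

    Let [sff] be parallel.  Antisymmetrising the second covariant derivatives
    of [om] shows that R(X,Y)Z is tangent for all tangent X, Y, Z
    ([curvature_tangent]), as in the Codazzi equation.  The tangent planes are
    J-invariant, so they are spanned by X = (A,C) and [hrot] X = (C,C-A), and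
      R(X, hrot X) X = 4/3 (<A,C>A - |A|^2 C, |C|^2 A - <A,C>C).
    This vector lies in the plane only if A x C = 0 (the flat case) or
    |A|^2 = |C|^2 = 2<A,C> (the equilateral case), see [dichotomy_alg].  Both
    conditions depend on the plane only, they are closed, and they exclude each
    other; hence on a connected surface one of them holds everywhere.

    In the flat case all values of [om] lie in (R a, R a) for an imaginary
    direction a, and the structure equation shows that a is constant up to a
    factor ([direction_constant]).  After an isometry a = i and u starts at
    (1,1), so both components of u run in the unit circle of R + R i, and u
    parametrizes a piece of the torus ([torus_piece]).

    In the equilateral case the vector y = 2/|A|^2 A x C has |y|^2 = 3, does
    not depend on X, and y x A = 2C - A.  The second fundamental form has
    values in (R y, R y) ([sff_yv]).  Feeding this back into parallelism gives
    linear relations between its two coefficients ([parallel_relation]) which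
    force it to vanish ([sff_eq0]).  Then dy = 2(C - A) ([pdv_yv]), which says
    that u and ((1 - y)/2, (1 + y)/2) have the same Maurer-Cartan form.  They
    differ by a left translation, and u parametrizes a piece of the sphere
    ([sphere_piece]).

    In both cases the image of a small ball has to be open in the model
    surface.  A model point near u x is compared with the nearest point u z of
    the image: their difference is orthogonal to the tangent plane of u at z,
    and on the model surfaces this forces the two points to coincide
    ([nearest_point], [open_piece]). *)

Set Implicit Arguments.
Unset Strict Implicit.
Unset Printing Implicit Defensive.

Import Order.TTheory GRing.Theory Num.Theory.
Import numFieldNormedType.Exports.

Local Open Scope classical_set_scope.
Local Open Scope ring_scope.

(* Unification must not compare iterated derivatives by unfolding them. *)
Local Opaque derive.

(** * Differential calculus in normed modules *)

Section Calculus.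
Context {R : realType}.

Definition clinear (V W : normedModType R) (f : V -> W) : Prop :=
  linear f /\ continuous f.

Definition cbilinear (U V W : normedModType R) (B : U -> V -> W) : Prop :=
  [/\ forall y, linear (B ^~ y), forall x, linear (B x)
    & continuous (fun p : U * V => B p.1 p.2)].

Lemma clinear_diff (V W : normedModType R) (f : V -> W) x :
  clinear f -> differentiable f x /\ forall v, 'D_v f x = f v.
Proof.
move=> [lf cf].
pose fM := GRing.isLinear.Build _ _ _ _ f lf.
pose fL : {linear _ -> _} := HB.pack f fM.
have df : differentiable f x by exact: (@linear_differentiable _ _ _ fL).
split=> // v; rewrite deriveE // -[f]/(fL : _ -> _) diff_lin //.
Qed.

Lemma comp_clinear (U V W : normedModType R) (f : V -> W) (g : U -> V) x :
  clinear f -> differentiable g x ->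
  differentiable (f \o g) x /\ forall v, 'D_v (f \o g) x = f ('D_v g x).
Proof.
move=> cf dg; have [df Df] := clinear_diff (g x) cf.
have dfg : differentiable (f \o g) x by exact: differentiable_comp.
split=> // v; rewrite deriveE // diff_comp //= -deriveE // Df.
by rewrite -deriveE.
Qed.

Lemma cbilinear_diff (T U V W : normedModType R) (B : U -> V -> W)
    (f : T -> U) (g : T -> V) x :
  cbilinear B -> differentiable f x -> differentiable g x ->
  differentiable (fun y => B (f y) (g y)) x /\
  forall v, 'D_v (fun y => B (f y) (g y)) x =
            B ('D_v f x) (g x) + B (f x) ('D_v g x).
Proof.
move=> [lB1 lB2 cB] df dg.
have BB : bilinear_for *:%R *:%R B by split=> [y|y]; [exact: lB1|exact: lB2].
pose BM := bilinear_isBilinear.Build _ _ _ _ _ _ _ BB.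
pose BL : {bilinear U -> V -> W} := HB.pack B BM.
have dB : differentiable (fun p : U * V => B p.1 p.2) (f x, g x).
  exact: (@differentiable_bilin _ _ _ _ BL).
have dp : differentiable (fun y => (f y, g y)) x by exact: differentiable_pair.
have dfg : differentiable (fun y => B (f y) (g y)) x.
  exact: (@differentiable_comp _ _ _ _ (fun y => (f y, g y))
                               (fun p => B p.1 p.2)).
split=> // v; rewrite deriveE //.
rewrite (_ : (fun y => _) = (fun p : U * V => B p.1 p.2) \o
   (fun y => (f y, g y))) // diff_comp //=.
rewrite (@diff_bilin _ _ _ _ BL) //= diff_pair //= addrC.
by rewrite !deriveE.
Qed.

Lemma scale_cbilinear (W : normedModType R) :
  cbilinear (fun (a : R) (w : W) => a *: w).
Proof.
split=> [y a b c|x a b c|p].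
- by rewrite scalerDl scalerA.
- by rewrite scalerDr !scalerA mulrC.
- exact: scale_continuous.
Qed.

Lemma smooth_diff (V W : normedModType R) (U : set V) (f : V -> W) x :
  smooth U f -> U x -> differentiable f x.
Proof. by move=> /(_ 1%N) [df _] /df. Qed.

Lemma smooth_derive (V W : normedModType R) (U : set V) (f : V -> W) v :
  smooth U f -> smooth U ('D_v f).
Proof. by move=> sf k; have [_] := sf k.+1; apply. Qed.

Lemma near_eq_diff (V W : normedModType R) (f g : V -> W) (x : V) :
  (\near x, f x = g x) -> differentiable f x -> differentiable g x.
Proof.
move=> fg /diff_locallyP [cf Hf].
have fgx := nbhs_singleton fg.
apply/diff_locallyP.
have E : g \o shift x = cst (g x) + 'd f x +o_ 0 id.
  apply/eqaddoP => e e0.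
  move/eqaddoP : (Hf) => /(_ _ e0) H.
  near=> h.
  rewrite -fgx.
  have fgh : f (h + x) = g (h + x).
    near: h.
    have : (fun h => h + x) @ nbhs 0 --> (x : V).
      rewrite -[X in _ --> X]add0r; apply: cvgD; [exact: cvg_id|exact: cvg_cst].
    by move=> /(_ _ fg).
  have : `|(f \o shift x - (cst (f x) + 'd f x)) h| <= e * `|h| by near: h.
  by rewrite /= -[X in _ -> `|X| <= _]/(g (h + x) - _) -fgh.
have -> : 'd g x = 'd f x :> (V -> W).
  by apply: diff_unique.
by split.
Unshelve. all: by end_near. Qed.

(** The derivatives in [Ck] are computed in the whole space, whereas formulas
    for them hold on an open set only; this lemma substitutes such a formula. *)
Lemma Ck_ext (V W : normedModType R) (U : set V) k (f g : V -> W) :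
  open U -> (forall x, U x -> f x = g x) -> Ck k U f -> Ck k U g.
Proof.
move=> oU; elim: k f g => [|k IH] f g fg /=.
  move=> cf x Ux; have nfg : \near x, f x = g x.
    by apply: filterS (open_nbhs_nbhs (conj oU Ux)).
  rewrite /prop_for /continuous_at -(fg x Ux).
  by apply: cvg_trans (cf x Ux); apply: near_eq_cvg.
move=> [df Cf]; split=> [x Ux|v].
  apply: near_eq_diff (df x Ux).
  by apply: filterS (open_nbhs_nbhs (conj oU Ux)).
apply: IH (Cf v) => x Ux; apply: near_eq_derive.
by apply: filterS (open_nbhs_nbhs (conj oU Ux)).
Qed.

Lemma Ck_le (V W : normedModType R) (U : set V) k (f : V -> W) :
  Ck k.+1 U f -> Ck k U f.
Proof.
elim: k f => [|k IH] f [df Cf].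
  by move=> x Ux; exact: differentiable_continuous (df x Ux).
by split=> // v; exact: IH.
Qed.

Lemma smooth_cst (V W : normedModType R) (U : set V) (c : W) :
  smooth U (fun _ : V => c).
Proof.
move=> k; elim: k c => [|k IH] c; first by move=> x _; exact: cst_continuous.
split=> [x _|v]; first exact: differentiable_cst.
rewrite (_ : 'D_v _ = fun _ => 0) //.
by apply/funext => x; exact: derive_cst.
Qed.

Lemma CkD (V W : normedModType R) (U : set V) k (f g : V -> W) :
  open U -> Ck k U f -> Ck k U g -> Ck k U (fun x => f x + g x).
Proof.
move=> oU; elim: k f g => [|k IH] f g.
  by move=> cf cg x Ux; apply: cvgD; [exact: cf|exact: cg].
move=> [df Cf] [dg Cg]; split=> [x Ux|v].
  by apply: differentiableD; [exact: df|exact: dg].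
apply: (@Ck_ext _ _ _ _ (fun x => 'D_v f x + 'D_v g x)) => //; last first.
  exact: IH (Cf v) (Cg v).
move=> x Ux; rewrite [RHS](_ : _ = 'D_v (f + g) x) // deriveD //.
  by apply: diff_derivable; exact: df.
by apply: diff_derivable; exact: dg.
Qed.

Lemma smooth_comp_clinear (T V W : normedModType R) (U : set T) (L : V -> W)
    (f : T -> V) :
  open U -> clinear L -> smooth U f -> smooth U (fun x => L (f x)).
Proof.
move=> oU cL sf k; elim: k f sf => [|k IH] f sf.
  move=> x Ux; apply: (@continuous_comp _ _ _ f L); first exact: (sf 0%N).
  by case: cL => _; exact.
split=> [x Ux|v]; first by have [] := comp_clinear cL (smooth_diff sf Ux).
apply: (@Ck_ext _ _ _ _ (fun x => L ('D_v f x))) => //; last first.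
  by apply: IH; exact: smooth_derive.
by move=> x Ux; have [_ ->] := comp_clinear cL (smooth_diff sf Ux).
Qed.

Lemma smooth_clinear (V W : normedModType R) (U : set V) (L : V -> W) :
  open U -> clinear L -> smooth U L.
Proof.
move=> oU cL [|k]; first by move=> x _; case: cL => _; exact.
split=> [x _|v]; first by have [] := clinear_diff x cL.
apply: (@Ck_ext _ _ _ _ (fun=> L v)) => //; last exact: smooth_cst.
by move=> x _; have [_ ->] := clinear_diff x cL.
Qed.

Lemma Ck_cbilinear (T U V W : normedModType R) (O : set T) k
    (B : U -> V -> W) (f : T -> U) (g : T -> V) :
  open O -> cbilinear B -> Ck k O f -> Ck k O g ->
  Ck k O (fun x => B (f x) (g x)).
Proof.
move=> oO cB; elim: k f g => [|k IH] f g.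
  move=> cf cg x Ux.
  apply: (@continuous_comp _ _ _ (fun y => (f y, g y)) (fun p => B p.1 p.2)).
    by apply: cvg_pair; [exact: cf|exact: cg].
  by case: cB => _ _; exact.
move=> sf sg; have [[df Cf] [dg Cg]] := (sf, sg); split=> [x Ux|v].
  by have [] := cbilinear_diff cB (df x Ux) (dg x Ux).
apply: (@Ck_ext _ _ _ _
  (fun x => B ('D_v f x) (g x) + B (f x) ('D_v g x))) => //.
  by move=> x Ux; have [_ ->] := cbilinear_diff cB (df x Ux) (dg x Ux).
apply: CkD => //.
  by apply: IH; [exact: Cf|exact: (Ck_le sg)].
by apply: IH; [exact: (Ck_le sf)|exact: Cg].
Qed.

Lemma smooth_cbilinear (T U V W : normedModType R) (O : set T)
    (B : U -> V -> W) (f : T -> U) (g : T -> V) :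
  open O -> cbilinear B -> smooth O f -> smooth O g ->
  smooth O (fun x => B (f x) (g x)).
Proof. by move=> oO cB sf sg k; exact: Ck_cbilinear. Qed.

Lemma is_derive_line (V W : normedModType R) (f : V -> W) (x v : V) (t : R) :
  differentiable f (x + t *: v) ->
  is_derive t 1 (fun t : R => f (x + t *: v)) ('D_v f (x + t *: v)).
Proof.
move=> df.
have lin : is_diff t (fun t : R => x + t *: v) (fun t : R => t *: v).
  have h := is_diffD (is_diff_cst x t) (is_diff_scalel t v).
  by apply: is_diff_eq; apply/funext => s /=; rewrite [LHS]add0r.
have dg := @ex_diff _ _ _ _ _ _ _ lin.
apply: DeriveDef.
  by apply: diff_derivable; exact: (differentiable_comp dg df).
rewrite deriveE; last exact: (differentiable_comp dg df).
rewrite (diff_comp dg df) /= diff_val scale1r deriveE //.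
Qed.

Lemma segment_cst (V : normedModType R) (U : set V) (f : V -> R) (x y : V) :
  (forall t : R, 0 <= t <= 1 -> U (x + t *: (y - x))) ->
  (forall z, U z -> differentiable f z) ->
  (forall z v, U z -> 'D_v f z = 0) -> f x = f y.
Proof.
move=> seg df Df.
pose g := fun t : R => f (x + t *: (y - x)).
have dg (t : R) : 0 <= t <= 1 -> is_derive t 1 g 0.
  move=> t01; rewrite -(Df _ (y - x) (seg t t01)).
  by apply: is_derive_line; apply: df; apply: seg.
have [t|t|c _] := @MVT R g (fun=> 0) 0 1 ltr01.
- by rewrite in_itv /= => /andP[t0 t1]; apply: dg; rewrite !ltW.
- apply: derivable_within_continuous => s; rewrite in_itv /= => s01.
  by have [] := dg s s01.
by rewrite mul0r /g scale1r scale0r addr0 subrKC => /eqP; rewrite subr_eq0 => /eqP.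
Qed.
End Calculus.

Lemma ball_segment (R : realType) (V : normedModType R) (x y : V) (r t : R) :
  ball x r y -> 0 <= t <= 1 -> ball x r (x + t *: (y - x)).
Proof.
rewrite -!ball_normE /= opprD addNKr normrN normrZ => h /andP[t0 t1].
rewrite ger0_norm //; apply: le_lt_trans h; rewrite -[`|x - y|]mul1r distrC.
exact: ler_wpM2r.
Qed.

(** * Symmetry of second derivatives *)

Section Schwarz.
Context {R : realType} {V : normedModType R}.

Lemma MVT_line (f : V -> R) (x v : V) (h : R) : 0 < h ->
  (forall t : R, 0 <= t <= h -> differentiable f (x + t *: v)) ->
  exists2 t : R, 0 <= t <= h & f (x + h *: v) - f x = h * 'D_v f (x + t *: v).
Proof.
move=> h0 df.
pose g := fun t : R => f (x + t *: v).
have dg (t : R) : 0 <= t <= h -> is_derive t 1 g ('D_v f (x + t *: v)).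
  by move=> t01; apply: is_derive_line; exact: df.
have [t|t|c] := @MVT R g (fun t => 'D_v f (x + t *: v)) 0 h h0.
- by rewrite in_itv /= => /andP[t0 t1]; apply: dg; rewrite !ltW.
- apply: derivable_within_continuous => s; rewrite in_itv /= => s01.
  by have [] := dg s s01.
rewrite in_itv /= => /andP[c0 c1]; rewrite /g scale0r addr0 subr0 mulrC => E.
by exists c => //; rewrite !ltW.
Qed.

(** Two applications of the mean value theorem, along v to y |-> f (y + h w)
    - f y, then along w to the derivative of f along v.  The left-hand side
    is symmetric in v and w, which is what makes mixed derivatives commute. *)
Lemma second_difference (f : V -> R) (x v w : V) (h : R) : 0 < h ->
  (forall s t : R, 0 <= s <= h -> 0 <= t <= h ->
     differentiable f (x + s *: v + t *: w) /\
     differentiable ('D_v f) (x + s *: v + t *: w)) ->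
  exists s t : R, [/\ 0 <= s <= h, 0 <= t <= h &
    f (x + h *: v + h *: w) - f (x + h *: v) - f (x + h *: w) + f x =
    h ^+ 2 * 'D_w ('D_v f) (x + s *: v + t *: w)].
Proof.
move=> h0 df.
pose g := fun y => f (y + h *: w) - f y.
have hh : 0 <= h <= h by rewrite lexx andbT ltW.
have h00 : 0 <= (0 : R) <= h by rewrite lexx ltW.
have shiftw (s : R) : 0 <= s <= h ->
    is_diff (x + s *: v) (fun y => f (y + h *: w)) ('d f (x + s *: v + h *: w)).
  move=> s01; have [dfw _] := df s h s01 hh.
  have i1 : is_diff (x + s *: v) (fun y => y + h *: w) id.
    have := is_diffD (is_diff_id (x + s *: v)) (is_diff_cst (h *: w) (x + s *: v)).
    by move=> i; apply: is_diff_eq; apply/funext => y /=; rewrite [LHS]addr0.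
  apply: DiffDef; first exact: (differentiable_comp (@ex_diff _ _ _ _ _ _ _ i1)).
  rewrite (diff_comp (@ex_diff _ _ _ _ _ _ _ i1)) //=.
  by rewrite (@diff_val _ _ _ _ _ _ _ i1).
have dg (s : R) : 0 <= s <= h -> differentiable g (x + s *: v) /\
   'D_v g (x + s *: v) = 'D_v f (x + s *: v + h *: w) - 'D_v f (x + s *: v).
  move=> s01; have i1 := shiftw s s01.
  have [dfw _] := df s h s01 hh.
  have [df0 _] := df s 0 s01 h00; rewrite scale0r addr0 in df0.
  have d1 := @ex_diff _ _ _ _ _ _ _ i1.
  split; first exact: (differentiableB d1 df0).
  have -> : 'D_v g (x + s *: v) = 'D_v ((fun y => f (y + h *: w)) - f) (x + s *: v).
    by [].
  have e1 : derivable (fun y => f (y + h *: w)) (x + s *: v) v by exact: diff_derivable.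
  have e2 : derivable f (x + s *: v) v by exact: diff_derivable.
  rewrite (deriveB e1 e2).
  congr (_ - _).
  by rewrite (deriveE v d1) (@diff_val _ _ _ _ _ _ _ i1) -(deriveE v dfw).
have [s s01 E1] := MVT_line h0 (fun t t01 => (dg t t01).1).
have [t t01] := @MVT_line ('D_v f) (x + s *: v) w h h0
  (fun t t01 => (df s t s01 t01).2).
rewrite -(dg s s01).2 => E2.
exists s, t; split=> //.
by rewrite expr2 -mulrA -E2 -E1 /g opprB addrA [RHS]addrAC.
Qed.

(** On squares that shrink to x, [second_difference] equates a value of one
    mixed derivative with a value of the other; both are continuous at x. *)
Lemma derive_comm_real (U : set V) (f : V -> R) (x v w : V) :
  open U -> smooth U f -> U x -> 'D_v ('D_w f) x = 'D_w ('D_v f) x.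
Proof.
move=> oU sf Ux.
have cF0 := smooth_derive v (smooth_derive w sf) 0%N.
have cG0 := smooth_derive w (smooth_derive v sf) 0%N.
(* The two derivatives are generalised to keep them from being unfolded. *)
have [F EF] : exists F, F = 'D_v ('D_w f) := ex_intro _ _ erefl.
have [G EG] : exists G, G = 'D_w ('D_v f) := ex_intro _ _ erefl.
have FE z : 'D_v ('D_w f) z = F z by rewrite EF.
have GE z : 'D_w ('D_v f) z = G z by rewrite EG.
rewrite -EF in cF0; rewrite -EG in cG0; rewrite FE GE.
apply/eqP; rewrite -subr_eq0 -normr_le0; apply/ler_addgt0Pr => e e0.
rewrite add0r.
have e2 : 0 < e / 2 by rewrite divr_gt0.
have : \forall z \near x, [/\ U z, `|F x - F z| < e / 2 & `|G x - G z| < e / 2].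
  have nU : nbhs x U by apply: open_nbhs_nbhs.
  move/cvgrPdist_lt : (cF0 x Ux) => /(_ _ e2) nF.
  move/cvgrPdist_lt : (cG0 x Ux) => /(_ _ e2) nG.
  by apply: filterS3 nU nF nG => z Uz Fz Gz; split.
move=> /nbhs_ballP [r /= r0 Br].
(* The square with sides h v and h w at x lies in the ball of radius r. *)
pose h := r / (`|v| + `|w| + 1) / 2.
have nvw : 0 < `|v| + `|w| + 1 by rewrite ltr_wpDl // addr_ge0.
have h0 : 0 < h by rewrite !divr_gt0.
have inB (s t : R) : 0 <= s <= h -> 0 <= t <= h -> ball x r (x + s *: v + t *: w).
  move=> /andP[s0 sh] /andP[t0 th].
  rewrite -ball_normE /= -addrA opprD addNKr normrN.
  apply: (le_lt_trans (ler_normD _ _)); rewrite !normrZ !ger0_norm //.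
  have : s * `|v| + t * `|w| <= h * (`|v| + `|w| + 1).
    rewrite mulrDr mulr1 mulrDr; apply: ler_wpDr; first exact: ltW.
    by apply: lerD; exact: ler_wpM2r.
  move=> /le_lt_trans; apply.
  by rewrite /h mulrAC divfK ?gt_eqF // ltr_pdivrMr // mulr_natr mulr2n ltrDl.
have inB' (s t : R) : 0 <= s <= h -> 0 <= t <= h -> ball x r (x + s *: w + t *: v).
  by move=> s01 t01; rewrite addrAC; exact: inB.
have [|s [t [s01 t01]]] := @second_difference f x v w h h0.
  move=> s t s01 t01; have [Uz _ _] := Br _ (inB s t s01 t01).
  by split; apply: smooth_diff Uz => //; exact: smooth_derive.
rewrite GE => E1.
have [|s' [t' [s'01 t'01]]] := @second_difference f x w v h h0.
  move=> s' t' s01' t01'; have [Uz _ _] := Br _ (inB' s' t' s01' t01').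
  by split; apply: smooth_diff Uz => //; exact: smooth_derive.
rewrite FE => E2.
have [_ _ Gz] := Br _ (inB s t s01 t01).
have [_ Fz _] := Br _ (inB' s' t' s'01 t'01).
have E : G (x + s *: v + t *: w) = F (x + s' *: w + t' *: v).
  apply: (@mulfI _ (h ^+ 2)); first by rewrite expf_neq0 // gt_eqF.
  by rewrite -E1 -E2 (addrAC x (h *: w)) [in RHS](addrAC (f _)).
rewrite E in Gz; move: Fz Gz.
move: (F (x + s' *: w + t' *: v)) (F x) (G x) => c a b.
rewrite (_ : a - b = (a - c) - (b - c)); last by ring.
by move=> Fz Gz; rewrite (le_trans (ler_normB _ _)) //; move: Fz Gz; lra.
Qed.
End Schwarz.

(** * Continuity of linear and bilinear maps *)

Section FiniteDim.
Context {R : realType}.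

Lemma rV_linear_sum n (W : normedModType R) (f : 'rV[R]_n -> W) x :
  linear f -> f x = \sum_i x 0 i *: f (delta_mx 0 i).
Proof.
move=> lf; pose fM := GRing.isLinear.Build _ _ _ _ f lf.
pose fL : {linear _ -> _} := HB.pack f fM.
rewrite {1}(row_sum_delta x) -[f]/(fL : _ -> _) linear_sum.
by apply: eq_bigr => i _; rewrite linearZ.
Qed.

Lemma clinear_rV n (W : normedModType R) (f : 'rV[R]_n -> W) :
  linear f -> clinear f.
Proof.
move=> lf; split=> //.
rewrite (_ : f = fun x => \sum_i x 0 i *: f (delta_mx 0 i)); last first.
  by apply/funext => x; exact: rV_linear_sum.
apply: continuous_big => [|i _ x]; first exact: add_continuous.
apply: (@continuous_comp _ _ _ (fun x : 'rV[R]_n => x 0 i) (fun k : R => k *: _) x).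
  exact: coord_continuous.
exact: scalel_continuous.
Qed.

Lemma cbilinear_rV m n (W : normedModType R) (B : 'rV[R]_m -> 'rV[R]_n -> W) :
  (forall y, linear (B ^~ y)) -> (forall x, linear (B x)) -> cbilinear B.
Proof.
move=> l1 l2; split=> //.
rewrite (_ : (fun p : 'rV[R]_m * 'rV[R]_n => B p.1 p.2) = fun p => \sum_i \sum_j
   p.1 0 i *: (p.2 0 j *: B (delta_mx 0 i) (delta_mx 0 j))); last first.
  apply/funext => p; rewrite (rV_linear_sum p.1 (l1 p.2)).
  apply: eq_bigr => i _; rewrite (rV_linear_sum p.2 (l2 _)) scaler_sumr.
  by [].
apply: continuous_big => [|i _]; first exact: add_continuous.
apply: continuous_big => [|j _ p]; first exact: add_continuous.
apply: cvgZ.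
  apply: (@continuous_comp _ _ _ fst (fun x : 'rV[R]_m => x 0 i)).
    exact: cvg_fst.
  exact: coord_continuous.
apply: cvgZr_tmp.
apply: (@continuous_comp _ _ _ snd (fun x : 'rV[R]_n => x 0 j)).
  exact: cvg_snd.
exact: coord_continuous.
Qed.

Lemma pair_ext (T S : Type) (x y : T * S) : x.1 = y.1 -> x.2 = y.2 -> x = y.
Proof. by case: x y => a b [c d] /= -> ->. Qed.

Lemma HH_fstD (x y : 'HH[R]) : (x + y).1 = x.1 + y.1. Proof. by []. Qed.
Lemma HH_sndD (x y : 'HH[R]) : (x + y).2 = x.2 + y.2. Proof. by []. Qed.
Lemma HH_fstZ k (x : 'HH[R]) : (k *: x).1 = k *: x.1. Proof. by []. Qed.
Lemma HH_sndZ k (x : 'HH[R]) : (k *: x).2 = k *: x.2. Proof. by []. Qed.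
Lemma HH_fstN (x : 'HH[R]) : (- x).1 = - x.1. Proof. by []. Qed.
Lemma HH_sndN (x : 'HH[R]) : (- x).2 = - x.2. Proof. by []. Qed.
Definition HHE := (HH_fstD, HH_sndD, HH_fstZ, HH_sndZ, HH_fstN, HH_sndN).

Lemma clinear_HH (W : normedModType R) (f : 'HH[R] -> W) :
  linear f -> clinear f.
Proof.
move=> lf; split=> //.
have f1 : linear (fun a => f (a, 0)).
  by move=> k a b; rewrite -lf /=; congr f; apply: pair_ext; rewrite !HHE /= ?scaler0 ?addr0.
have f2 : linear (fun a => f (0, a)).
  by move=> k a b; rewrite -lf /=; congr f; apply: pair_ext; rewrite !HHE /= ?scaler0 ?addr0.
rewrite (_ : f = fun x => f (x.1, 0) + f (0, x.2)); last first.
  apply/funext => -[a b]; rewrite -[f (a, 0)]scale1r; rewrite scale1r.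
  have := lf 1 (a, 0) (0, b); rewrite !scale1r => <-.
  by congr f; apply: pair_ext; rewrite !HHE /= ?addr0 ?add0r.
move=> x; apply: cvgD.
  apply: (@continuous_comp _ _ _ fst (fun a => f (a, 0))); first exact: cvg_fst.
  by have [_] := clinear_rV f1; exact.
apply: (@continuous_comp _ _ _ snd (fun a => f (0, a))); first exact: cvg_snd.
by have [_] := clinear_rV f2; exact.
Qed.

Lemma cbilinear_HH (W : normedModType R) (B : 'HH[R] -> 'HH[R] -> W) :
  (forall y, linear (B ^~ y)) -> (forall x, linear (B x)) -> cbilinear B.
Proof.
move=> l1 l2; split=> //.
have i1 : forall (k : R) (a b : 'H[R]), k *: ((a, 0) : 'HH[R]) + (b, 0) = (k *: a + b, 0).
  by move=> k a b; apply: pair_ext; rewrite !HHE /= ?scaler0 ?addr0.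
have i2 : forall (k : R) (a b : 'H[R]), k *: ((0, a) : 'HH[R]) + (0, b) = (0, k *: a + b).
  by move=> k a b; apply: pair_ext; rewrite !HHE /= ?scaler0 ?addr0.
have c11 := @cbilinear_rV 4 4 W (fun a b => B (a, 0) (b, 0)).
have c12 := @cbilinear_rV 4 4 W (fun a b => B (a, 0) (0, b)).
have c21 := @cbilinear_rV 4 4 W (fun a b => B (0, a) (b, 0)).
have c22 := @cbilinear_rV 4 4 W (fun a b => B (0, a) (0, b)).
have [||_ _ {}c11] := c11.
- by move=> y k a b; rewrite -i1; exact: l1.
- by move=> y k a b; rewrite -i1; exact: l2.
have [||_ _ {}c12] := c12.
- by move=> y k a b; rewrite -i1; exact: l1.
- by move=> y k a b; rewrite -i2; exact: l2.
have [||_ _ {}c21] := c21.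
- by move=> y k a b; rewrite -i2; exact: l1.
- by move=> y k a b; rewrite -i1; exact: l2.
have [||_ _ {}c22] := c22.
- by move=> y k a b; rewrite -i2; exact: l1.
- by move=> y k a b; rewrite -i2; exact: l2.
have BD (x x' y : 'HH[R]) : B (x + x') y = B x y + B x' y.
  by have := l1 y 1 x x'; rewrite /= !scale1r.
have BD' (x y y' : 'HH[R]) : B x (y + y') = B x y + B x y'.
  by have := l2 x 1 y y'; rewrite /= !scale1r.
have split_HH (x : 'HH[R]) : x = (x.1, 0) + (0, x.2).
  by case: x => a b; apply: pair_ext; rewrite !HHE /= ?addr0 ?add0r.
rewrite (_ : (fun p : 'HH[R] * 'HH[R] => B p.1 p.2) = fun p => B (p.1.1, 0) (p.2.1, 0)
   + B (p.1.1, 0) (0, p.2.2) + (B (0, p.1.2) (p.2.1, 0)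
   + B (0, p.1.2) (0, p.2.2))); last first.
  by apply/funext => p; rewrite {1}(split_HH p.1) {1}(split_HH p.2) BD !BD'.
have cp (f g : 'HH[R] -> 'H[R]) (C : 'H[R] -> 'H[R] -> W) : continuous f ->
    continuous g -> continuous (fun p => C p.1 p.2) ->
    continuous (fun p : 'HH[R] * 'HH[R] => C (f p.1) (g p.2)).
  move=> cf cg cC p.
  apply: (@continuous_comp _ _ _ (fun p : 'HH[R] * 'HH[R] => (f p.1, g p.2))
    (fun p => C p.1 p.2)); last exact: cC.
  have c1 : {for p, continuous (fun p : 'HH[R] * 'HH[R] => f p.1)}.
    by apply: (@continuous_comp _ _ _ fst f); [exact: cvg_fst|exact: cf].
  have c2 : {for p, continuous (fun p : 'HH[R] * 'HH[R] => g p.2)}.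
    by apply: (@continuous_comp _ _ _ snd g); [exact: cvg_snd|exact: cg].
  exact: (cvg_pair c1 c2).
have cfst : continuous (fst : 'HH[R] -> 'H[R]) by move=> p; exact: cvg_fst.
have csnd : continuous (snd : 'HH[R] -> 'H[R]) by move=> p; exact: cvg_snd.
move=> p; apply: cvgD; apply: cvgD.
- exact: (cp _ _ (fun a b => B (a, 0) (b, 0)) cfst cfst c11).
- exact: (cp _ _ (fun a b => B (a, 0) (0, b)) cfst csnd c12).
- exact: (cp _ _ (fun a b => B (0, a) (b, 0)) csnd cfst c21).
- exact: (cp _ _ (fun a b => B (0, a) (0, b)) csnd csnd c22).
Qed.

Lemma fst_cl : clinear (fst : 'HH[R] -> 'H[R]).
Proof. by apply: clinear_HH. Qed.
Lemma snd_cl : clinear (snd : 'HH[R] -> 'H[R]).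
Proof. by apply: clinear_HH. Qed.

Lemma HH_coord_cl (k : 'HH[R] -> 'H[R]) i : linear k -> clinear (fun x => k x 0 i).
Proof.
move=> lk; apply: clinear_HH => a x y /=; rewrite lk !mxE.
by rewrite -[a *: _]/(a * _).
Qed.

Definition dup (b : 'HH[R]) : 'HH[R] := (b.1, b.1).
Lemma dup_cl : clinear dup.
Proof. by apply: clinear_HH => k b c; apply: pair_ext. Qed.

Lemma segment_cst_HH (B : set 'rV[R]_2) (f : 'rV[R]_2 -> 'HH[R]) x y :
  (forall t : R, 0 <= t <= 1 -> B (x + t *: (y - x))) ->
  (forall z, B z -> differentiable f z) ->
  (forall z t, B z -> 'D_t f z = 0) -> f x = f y.
Proof.
move=> seg df Df.
have main (k : 'HH[R] -> 'H[R]) i : linear k -> k (f x) 0 i = k (f y) 0 i.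
  move=> lk; have cl := HH_coord_cl i lk.
  apply: (@segment_cst _ _ B (fun z => k (f z) 0 i) _ _ seg) => [z Bz|z t Bz].
    by have [] := comp_clinear cl (df z Bz).
  rewrite (proj2 (comp_clinear cl (df z Bz))) Df //.
  by have := lk (-1) 0 0; rewrite scaler0 addr0 scaleN1r addNr => ->; rewrite mxE.
apply: pair_ext; apply/rowP => i.
  by apply: (main fst).
by apply: (main snd).
Qed.
End FiniteDim.

(** * Quaternions and pairs of quaternions *)

Section Quat.
Context {R : realType}.
Implicit Types (x y z a b c : 'H[R]) (k : R).

Lemma quat_ext x y : x 0 0 = y 0 0 -> x 0 1 = y 0 1 -> x 0 2 = y 0 2 ->
  x 0 3 = y 0 3 -> x = y.
Proof.
move=> e0 e1 e2 e3; apply/rowP => -[[|[|[|[|i]]]] //= hi].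
- by rewrite (_ : Ordinal hi = 0) //; exact: val_inj.
- by rewrite (_ : Ordinal hi = 1) //; exact: val_inj.
- by rewrite (_ : Ordinal hi = 2) //; exact: val_inj.
- by rewrite (_ : Ordinal hi = 3) //; exact: val_inj.
Qed.

Lemma quat_0 (a b c d : R) : quat a b c d 0 0 = a. Proof. by rewrite mxE. Qed.
Lemma quat_1 (a b c d : R) : quat a b c d 0 1 = b. Proof. by rewrite mxE. Qed.
Lemma quat_2 (a b c d : R) : quat a b c d 0 2 = c. Proof. by rewrite mxE. Qed.
Lemma quat_3 (a b c d : R) : quat a b c d 0 3 = d. Proof. by rewrite mxE. Qed.
Lemma rVD x y i : (x + y) 0 i = x 0 i + y 0 i. Proof. by rewrite mxE. Qed.
Lemma rVN x i : (- x) 0 i = - x 0 i. Proof. by rewrite mxE. Qed.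
Lemma rVZ k x i : (k *: x) 0 i = k * x 0 i. Proof. by rewrite mxE. Qed.
Lemma rV0 i : (0 : 'H[R]) 0 i = 0. Proof. by rewrite mxE. Qed.

Lemma qdotE x y : qdot x y =
  x 0 0 * y 0 0 + x 0 1 * y 0 1 + x 0 2 * y 0 2 + x 0 3 * y 0 3.
Proof.
rewrite /qdot !big_ord_recr big_ord0 /= add0r.
by do ! congr (_ + _); congr (_ * _); congr (_ 0 _); apply: val_inj.
Qed.

Definition qcross x y : 'H[R] := quat 0
  (x 0 2 * y 0 3 - x 0 3 * y 0 2) (x 0 3 * y 0 1 - x 0 1 * y 0 3)
  (x 0 1 * y 0 2 - x 0 2 * y 0 1).

Definition qone : 'H[R] := quat 1 0 0 0.

Definition quatE := (quat_0, quat_1, quat_2, quat_3, rVD, rVN, rVZ, rV0).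

End Quat.

Ltac quat_ring :=
  apply: quat_ext; rewrite ?qdotE /qmul /qcross /qconj /qone ?quatE; ring.
Ltac hh_ring := apply: pair_ext; rewrite /= ?HHE /=; quat_ring.

Section Quat2.
Context {R : realType}.
Implicit Types (x y z a b c : 'H[R]) (k : R).

Lemma qmulA x y z : qmul x (qmul y z) = qmul (qmul x y) z.
Proof. quat_ring. Qed.
Lemma qmulDl x y z : qmul (x + y) z = qmul x z + qmul y z.
Proof. quat_ring. Qed.
Lemma qmulDr x y z : qmul x (y + z) = qmul x y + qmul x z.
Proof. quat_ring. Qed.
Lemma qmulZl k x y : qmul (k *: x) y = k *: qmul x y.
Proof. quat_ring. Qed.
Lemma qmulZr k x y : qmul x (k *: y) = k *: qmul x y.
Proof. quat_ring. Qed.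
Lemma qmulNl x y : qmul (- x) y = - qmul x y.
Proof. quat_ring. Qed.
Lemma qmulNr x y : qmul x (- y) = - qmul x y.
Proof. quat_ring. Qed.
Lemma qmul1q x : qmul qone x = x. Proof. quat_ring. Qed.
Lemma qmulq1 x : qmul x qone = x. Proof. quat_ring. Qed.
Lemma qconjM x y : qconj (qmul x y) = qmul (qconj y) (qconj x).
Proof. quat_ring. Qed.
Lemma qmulVq x : qmul (qconj x) x = qdot x x *: qone. Proof. quat_ring. Qed.
Lemma qmulqV x : qmul x (qconj x) = qdot x x *: qone. Proof. quat_ring. Qed.
Lemma qdotC x y : qdot x y = qdot y x. Proof. rewrite !qdotE; ring. Qed.
Lemma qdotDl x y z : qdot (x + y) z = qdot x z + qdot y z.
Proof. rewrite !qdotE !quatE; ring. Qed.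
Lemma qdotZl k x y : qdot (k *: x) y = k * qdot x y.
Proof. rewrite !qdotE !quatE; ring. Qed.
Lemma qdotDr x y z : qdot z (x + y) = qdot z x + qdot z y.
Proof. by rewrite ![qdot z _]qdotC qdotDl. Qed.
Lemma qdotZr k x y : qdot x (k *: y) = k * qdot x y.
Proof. by rewrite ![qdot x _]qdotC qdotZl. Qed.
Lemma qdotNl x y : qdot (- x) y = - qdot x y.
Proof. by rewrite -scaleN1r qdotZl mulN1r. Qed.
Lemma qdotNr x y : qdot x (- y) = - qdot x y.
Proof. by rewrite -scaleN1r qdotZr mulN1r. Qed.
Lemma qdotM x y z : qdot (qmul x y) (qmul x z) = qdot x x * qdot y z.
Proof. rewrite !qdotE /qmul !quatE; ring. Qed.
Lemma qdot_ge0 x : 0 <= qdot x x.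
Proof. by rewrite qdotE -!expr2 !addr_ge0 // sqr_ge0. Qed.
Lemma qdot_eq0 x : qdot x x = 0 -> x = 0.
Proof.
rewrite qdotE -!expr2 => e.
have h (i : 'I_4) : 0 <= x 0 i ^+ 2 by exact: sqr_ge0.
have := (h 0, h 1, h 2, h 3) => -[[[h0 h1] h2] h3].
by apply: quat_ext; rewrite rV0; apply/eqP; rewrite -sqrf_eq0; apply/eqP; lra.
Qed.
Lemma qconjK x : qconj (qconj x) = x. Proof. quat_ring. Qed.

Lemma qcrossDr x y z : qcross x (y + z) = qcross x y + qcross x z.
Proof. quat_ring. Qed.
Lemma qcrossZl k x y : qcross (k *: x) y = k *: qcross x y.
Proof. quat_ring. Qed.
Lemma qcrossZr k x y : qcross x (k *: y) = k *: qcross x y.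
Proof. quat_ring. Qed.

Implicit Types (u v w : 'HH[R]).
Definition hmul u v : 'HH[R] := (qmul u.1 v.1, qmul u.2 v.2).
Definition hconj u : 'HH[R] := (qconj u.1, qconj u.2).
Definition hcross u v : 'HH[R] := (qcross u.1 v.1, qcross u.2 v.2).
Definition hone : 'HH[R] := (qone, qone).
Definition himag u := u.1 0 0 = 0 /\ u.2 0 0 = 0.

Lemma hmul_cb : cbilinear hmul.
Proof. apply: cbilinear_HH => [y|x] k a b; hh_ring. Qed.
Lemma hcross_cb : cbilinear hcross.
Proof. apply: cbilinear_HH => [y|x] k a b; hh_ring. Qed.
Lemma hconj_cl : clinear hconj.
Proof. apply: clinear_HH => k a b; hh_ring. Qed.
End Quat2.

Section Pairs.
Context {R : realType}.
Implicit Types (u v w x y : 'HH[R]) (k : R).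

Lemma hmulA u v w : hmul u (hmul v w) = hmul (hmul u v) w.
Proof. by rewrite /hmul /= !qmulA. Qed.
Lemma hmul1h u : hmul hone u = u.
Proof. by apply: pair_ext; rewrite /= qmul1q. Qed.
Lemma hmulh1 u : hmul u hone = u.
Proof. by apply: pair_ext; rewrite /= qmulq1. Qed.
Lemma hmulDl u v w : hmul (u + v) w = hmul u w + hmul v w.
Proof. by apply: pair_ext; rewrite /= ?HHE qmulDl. Qed.
Lemma hmulDr u v w : hmul w (u + v) = hmul w u + hmul w v.
Proof. by apply: pair_ext; rewrite /= ?HHE qmulDr. Qed.
Lemma hmulNr u v : hmul u (- v) = - hmul u v.
Proof. by apply: pair_ext; rewrite /= ?HHE qmulNr. Qed.
Lemma hmulNl u v : hmul (- u) v = - hmul u v.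
Proof. by apply: pair_ext; rewrite /= ?HHE qmulNl. Qed.
Lemma hmulZr k u v : hmul u (k *: v) = k *: hmul u v.
Proof. by apply: pair_ext; rewrite /= ?HHE qmulZr. Qed.
Lemma hmulZl k u v : hmul (k *: u) v = k *: hmul u v.
Proof. by apply: pair_ext; rewrite /= ?HHE qmulZl. Qed.
Lemma hmulBr u v w : hmul w (u - v) = hmul w u - hmul w v.
Proof. by rewrite hmulDr hmulNr. Qed.

Lemma hmulh0 u : hmul u 0 = 0.
Proof. by rewrite -[X in hmul _ X](scale0r 0) hmulZr scale0r. Qed.

Lemma unit_hconj x : S3xS3 x -> hmul (hconj x) x = hone.
Proof.
case=> x1 x2; apply: pair_ext; rewrite /= qmulVq.
  by rewrite x1 scale1r.
by rewrite x2 scale1r.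
Qed.
Lemma unit_hconjr x : S3xS3 x -> hmul x (hconj x) = hone.
Proof.
case=> x1 x2; apply: pair_ext; rewrite /= qmulqV.
  by rewrite x1 scale1r.
by rewrite x2 scale1r.
Qed.
Lemma hmulK x u : S3xS3 x -> hmul (hconj x) (hmul x u) = u.
Proof. by move=> xN; rewrite hmulA unit_hconj // hmul1h. Qed.
Lemma hmulVK x u : S3xS3 x -> hmul x (hmul (hconj x) u) = u.
Proof. by move=> xN; rewrite hmulA unit_hconjr // hmul1h. Qed.
Lemma hmul_inj x u v : S3xS3 x -> hmul x u = hmul x v -> u = v.
Proof. by move=> xN e; rewrite -(hmulK u xN) e hmulK. Qed.

Lemma himagD u v : himag u -> himag v -> himag (u + v).
Proof. by move=> [a b] [c d]; split; rewrite HHE !quatE ?a ?b ?c ?d addr0. Qed.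
Lemma himagN u : himag u -> himag (- u).
Proof. by move=> [a b]; split; rewrite HHE !quatE ?a ?b oppr0. Qed.
Lemma himagB u v : himag u -> himag v -> himag (u - v).
Proof. by move=> a b; apply: himagD => //; exact: himagN. Qed.

Lemma tangent_hmul x u : S3xS3 x -> tangent_S3xS3 x (hmul x u) <-> himag u.
Proof.
have h (a b : 'H[R]) : qdot a (qmul a b) = qdot a a * b 0 0.
  by rewrite !qdotE /qmul !quatE; ring.
by case=> x1 x2; rewrite /tangent_S3xS3 /= !h x1 x2 !mul1r.
Qed.

Lemma hconjM_imag (a b : 'HH[R]) : himag b -> hconj (hmul a b) = hmul (- b) (hconj a).
Proof.
move=> [i1 i2]; apply: pair_ext; rewrite /= ?HHE qconjM; congr qmul;
  by apply: quat_ext; rewrite /qconj !quatE ?i1 ?i2 ?oppr0.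
Qed.
Lemma hmul_commutator (a b : 'HH[R]) : himag a -> himag b ->
  hmul b a - hmul a b = - 2 *: hcross a b.
Proof.
move=> [i1 i2] [j1 j2].
by apply: pair_ext; rewrite /= ?HHE; apply: quat_ext;
   rewrite /qmul /qcross /= ?HHE /= !quatE ?i1 ?i2 ?j1 ?j2; ring.
Qed.

Lemma cross_norm (A C : 'H[R]) : himag (A, C) ->
  qdot (qcross A C) (qcross A C) = qdot A A * qdot C C - qdot A C ^+ 2.
Proof. by case=> /= h1 h2; rewrite !qdotE /qcross !quatE h1 h2; ring. Qed.
End Pairs.

Section CrossProduct.
Context {R : realType}.
Implicit Types (a b c x y : 'H[R]).

Lemma qcross_cb : cbilinear (@qcross R).
Proof. by apply: cbilinear_rV => [y|x] k a b /=; quat_ring. Qed.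
Lemma qdot_cb : cbilinear (@qdot R).
Proof.
by apply: cbilinear_rV => [y|x] k a b /=; rewrite ?qdotDl ?qdotZl ?qdotDr ?qdotZr.
Qed.

Lemma qcross_triple a b c : qdot a (qcross b c) = qdot (qcross a b) c.
Proof. by rewrite !qdotE /qcross !quatE; ring. Qed.
Lemma qcrossC a b : qcross a b = - qcross b a.
Proof. quat_ring. Qed.
Lemma qcrossNr a b : qcross a (- b) = - qcross a b. Proof. quat_ring. Qed.
Lemma qcrossxx a : qcross a a = 0. Proof. quat_ring. Qed.
Lemma qcross_cross a b c : a 0 0 = 0 -> b 0 0 = 0 -> c 0 0 = 0 ->
  qcross a (qcross b c) = qdot a c *: b - qdot a b *: c.
Proof.
by move=> ia ib ic; apply: quat_ext; rewrite !qdotE /qcross ?quatE ?ia ?ib ?ic; ring.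
Qed.
Lemma qcross_re a b : (qcross a b) 0 0 = 0. Proof. by rewrite quatE. Qed.

(** Expansion of b in the orthogonal basis y, a, y x a of the imaginary
    quaternions. *)
Lemma orth_frame y a b : y 0 0 = 0 -> a 0 0 = 0 -> b 0 0 = 0 ->
  qdot y y = 3 -> qdot y a = 0 ->
  (3 * qdot a a) *: b = (qdot a a * qdot y b) *: y + (3 * qdot a b) *: a
    + qdot (qcross y a) b *: qcross y a.
Proof.
move=> iy ia ib yy ya.
have yn : qdot (qcross y a) (qcross y a) = 3 * qdot a a.
  have iya : himag (y, a) by [].
  by rewrite (cross_norm iya) yy ya expr0n subr0.
have cramer : qdot (qcross y a) (qcross y a) *: b =
    qdot b (qcross a (qcross y a)) *: y + qdot y (qcross b (qcross y a)) *: a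
    + qdot (qcross y a) b *: qcross y a.
  by apply: quat_ext; rewrite !qdotE /qcross ?quatE ?iy ?ia ?ib; ring.
rewrite yn in cramer; rewrite cramer.
rewrite !qcross_cross // (qdotC a y) ya scale0r subr0 qdotDr qdotNr !qdotZr.
by rewrite yy ya mulr0 subr0 (qdotC b y) (qdotC b a) mulrC [qdot a b * 3]mulrC.
Qed.

Lemma qmul_imag (a b : 'H[R]) : a 0 0 = 0 -> b 0 0 = 0 ->
  qmul a b = qcross a b - qdot a b *: qone.
Proof.
move=> ia ib; apply: quat_ext; rewrite !qdotE /qmul /qcross /qone ?quatE ia ib; ring.
Qed.

(** From a x (a x b) = <a,b> a - |a|^2 b. *)
Lemma qcross_eq0_proportional a b : a 0 0 = 0 -> b 0 0 = 0 -> a != 0 -> qcross a b = 0 ->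
  b = (qdot a b / qdot a a) *: a.
Proof.
move=> ia ib a0 e.
have aa : qdot a a != 0 by apply: contra_neq a0; exact: qdot_eq0.
have f : qdot a a *: b = qdot a b *: a - qcross a (qcross a b).
  by apply: quat_ext; rewrite !qdotE /qcross ?quatE ia ?ib; ring.
have z : qcross a 0 = 0 by quat_ring.
rewrite e z subr0 in f.
by apply: (scalerI aa); rewrite f scalerA mulrC divfK.
Qed.

Definition qi : 'H[R] := quat 0 1 0 0.

Lemma unit_qinv c : qdot c c = 1 -> qinv c = qconj c.
Proof. by move=> h; rewrite /qinv h invr1 scale1r. Qed.

(** The quaternion d = r - i a, with r = |a|, satisfies d a = r i d, so its
    normalisation conjugates a to r i unless d = 0; in that case a = - r i
    already. *)
Lemma conj_to_i a : a 0 0 = 0 ->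
  exists c k, unit_quat c /\ qmul (qmul c a) (qconj c) = k *: qi.
Proof.
move=> ia.
pose r := Num.sqrt (qdot a a).
have r2 : r ^+ 2 = qdot a a by rewrite sqr_sqrtr ?qdot_ge0.
pose d := r *: qone - qmul qi a.
have da : qmul d a = r *: qmul qi d.
  have -> : qmul d a = r *: a + qdot a a *: qi.
    by apply: quat_ext; rewrite /d /qmul /qone /qi !qdotE ?quatE ia; ring.
  rewrite -r2.
  by apply: quat_ext; rewrite /d /qmul /qone /qi ?quatE ia; ring.
have [d0|dn] := eqVneq d 0.
  exists qone, (- r); split; first by rewrite /unit_quat /= qdotE /qone !quatE; ring.
  have -> : qmul (qmul qone a) (qconj qone) = a by quat_ring.
  have : qmul qi d = 0 by rewrite d0; quat_ring.
  have -> : qmul qi d = r *: qi + a by rewrite /d /qi; quat_ring.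
  by move=> /eqP; rewrite addr_eq0 scaleNr => /eqP ->; rewrite opprK.
have dd : qdot d d != 0 by apply: contra_neq dn; exact: qdot_eq0.
have dd0 : 0 < qdot d d by rewrite lt_def dd qdot_ge0.
pose s := Num.sqrt (qdot d d).
have s2 : s ^+ 2 = qdot d d by rewrite sqr_sqrtr ?qdot_ge0.
have sn : s != 0 by rewrite sqrtr_eq0 -ltNge.
exists (s^-1 *: d), r; split.
  by rewrite /unit_quat /= qdotZl qdotZr -s2; field.
have cj k (b : 'H[R]) : qconj (k *: b) = k *: qconj b by quat_ring.
rewrite cj !qmulZl !qmulZr da qmulZl -qmulA qmulqV qmulZr qmulq1 -s2.
by rewrite !scalerA; congr (_ *: _); field.
Qed.

Lemma unit_angle (x y : R) : x ^+ 2 + y ^+ 2 = 1 -> exists s, x = cos s /\ y = sin s.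
Proof.
move=> h.
have x1 : -1 <= x <= 1.
  have := sqr_ge0 y => y2; have x2 : x ^+ 2 <= 1 by move: h y2; lra.
  by rewrite -ler_norml -(@ler_pXn2r _ 2) ?nnegrE // expr1n real_normK ?num_real.
have cx : cos (acos x) = x by rewrite acosK // in_itv.
have sx : sin (acos x) = `|y|.
  rewrite sin_acos // (_ : 1 - x ^+ 2 = y ^+ 2) ?sqrtr_sqr //.
  by move: h; lra.
have [y0|y0] := lerP 0 y.
  by exists (acos x); rewrite cx sx ger0_norm.
by exists (- acos x); rewrite cosN sinN cx sx ltr0_norm // opprK.
Qed.

(** Parallel unit vectors are equal or opposite, and opposite ones are at
    distance 2. *)
Lemma circle_close (x y x' y' : R) : x ^+ 2 + y ^+ 2 = 1 -> x' ^+ 2 + y' ^+ 2 = 1 ->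
  x * y' = y * x' -> (x - x') ^+ 2 + (y - y') ^+ 2 < 1 -> x = x' /\ y = y'.
Proof.
move=> h h' e d.
pose k := x * x' + y * y'.
have ex : x' = k * x.
  have -> : k * x = x' * (x ^+ 2 + y ^+ 2) + y * (x * y' - y * x') by rewrite /k; ring.
  by rewrite h e subrr mulr0 addr0 mulr1.
have ey : y' = k * y.
  have -> : k * y = y' * (x ^+ 2 + y ^+ 2) - x * (x * y' - y * x') by rewrite /k; ring.
  by rewrite h e subrr mulr0 subr0 mulr1.
have k2 : k ^+ 2 = 1.
  rewrite -[RHS]h' [X in X ^+ 2 + _]ex [X in _ + X ^+ 2]ey !exprMn -mulrDr h mulr1 //.
have k1 : 1 / 2 < k.
  have : (x - x') ^+ 2 + (y - y') ^+ 2 = (x ^+ 2 + y ^+ 2) + (x' ^+ 2 + y' ^+ 2) - 2 * k.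
    by rewrite /k; ring.
  move: d; rewrite h h'; lra.
have kk : k = 1.
  have : (k - 1) * (k + 1) = 0 by rewrite -subr_sqr k2 expr1n subrr.
  by move=> /eqP; rewrite mulf_eq0 => /orP[] /eqP; lra.
by rewrite ex ey kk !mul1r.
Qed.
End CrossProduct.

Section Isometries.
Context {R : realType}.
Implicit Types (b x : 'HH[R]) (c : 'H[R]).

(** The isometries extended to linear maps of the ambient space, which makes
    them easy to differentiate. *)
Definition iso_lin (k : 'HH[R]) c b : 'HH[R] := hmul (hmul k b) (qconj c, qconj c).

Lemma iso_lin_cl k c : clinear (iso_lin k c).
Proof.
apply: clinear_HH => s x y; rewrite /iso_lin hmulDr hmulDl hmulZr hmulZl //.
Qed.

Lemma nk_isometryE k1 k2 c x : unit_quat c ->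
  nk_isometry k1 k2 c x = iso_lin (k1, k2) c x.
Proof. by move=> h; rewrite /nk_isometry unit_qinv. Qed.

Lemma unit_qmul (x y : 'H[R]) : unit_quat x -> unit_quat y -> unit_quat (qmul x y).
Proof. by rewrite /unit_quat /= qdotM => -> ->; rewrite mulr1. Qed.
Lemma unit_qconj (x : 'H[R]) : unit_quat x -> unit_quat (qconj x).
Proof. by rewrite /unit_quat /= => <-; rewrite !qdotE /qconj !quatE; ring. Qed.

Lemma iso_lin_unit k c x : S3xS3 k -> unit_quat c -> S3xS3 x -> S3xS3 (iso_lin k c x).
Proof.
by move=> [k1 k2] uc [x1 x2]; split;
  (apply: unit_qmul; [exact: unit_qmul|exact: unit_qconj]).
Qed.

Lemma iso_lin_inj k c b : S3xS3 k -> unit_quat c -> iso_lin k c b = 0 -> b = 0.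
Proof.
move=> kN uc /(congr1 (fun w => hmul w (c, c))).
rewrite /iso_lin -hmulA.
have -> : hmul (qconj c, qconj c) (c, c) = hone.
  by apply: pair_ext; rewrite /= qmulVq uc scale1r.
rewrite hmulh1 => e; apply: (hmul_inj kN); rewrite e hmulh0.
by apply: pair_ext; rewrite /=; quat_ring.
Qed.

(** In the left trivialisation an isometry acts on tangent vectors by
    conjugation with c. *)
Lemma iso_lin_hmul k c x b : unit_quat c ->
  iso_lin k c (hmul x b) = hmul (iso_lin k c x)
    (qmul (qmul c b.1) (qconj c), qmul (qmul c b.2) (qconj c)).
Proof.
move=> uc; have cc : qmul (qconj c) c = qone by rewrite qmulVq uc scale1r.
have h (k' x' b' : 'H[R]) : qmul (qmul k' (qmul x' b')) (qconj c) =
    qmul (qmul (qmul k' x') (qconj c)) (qmul (qmul c b') (qconj c)).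
  by rewrite -!qmulA (qmulA (qconj c) c) cc qmul1q.
by apply: pair_ext; rewrite /= h.
Qed.
End Isometries.

(** * The nearly Kähler structure in the left trivialisation *)

(** The metric [nkg] in the left trivialisation, see [nkg_hmul]. *)
HB.lock Definition g0 {R : realType} (u v : 'HH[R]) : R :=
  4 / 3 * (qdot u.1 v.1 + qdot u.2 v.2 - 2^-1 * (qdot u.1 v.2 + qdot u.2 v.1)).

(** The Levi-Civita connection in the left trivialisation, see
    [levi_civita_left]. *)
HB.lock Definition Gamma0 {R : realType} (u v : 'HH[R]) : 'HH[R] :=
  let m := qcross u.1 v.2 - qcross u.2 v.1 in
  (qcross u.1 v.1 - 3^-1 *: m, qcross u.2 v.2 + 3^-1 *: m).

Section LeftTrivialisation.
Context {R : realType}.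
Implicit Types (u v w x y : 'HH[R]) (k : R).
Lemma Gamma0_cb : cbilinear (@Gamma0 R).
Proof. apply: cbilinear_HH => [y|x] k a b /=; rewrite Gamma0.unlock; hh_ring. Qed.
Lemma g0C u v : g0 u v = g0 v u.
Proof. by rewrite g0.unlock !qdotE; field. Qed.
Lemma g0Dl u v w : g0 (u + v) w = g0 u w + g0 v w.
Proof. by rewrite g0.unlock !HHE !qdotE !quatE; field. Qed.
Lemma g0Zl k u v : g0 (k *: u) v = k * g0 u v.
Proof. by rewrite g0.unlock !HHE !qdotE !quatE; field. Qed.
Lemma g0Dr u v w : g0 w (u + v) = g0 w u + g0 w v.
Proof. by rewrite ![g0 w _]g0C g0Dl. Qed.
Lemma g0Zr k u v : g0 u (k *: v) = k * g0 u v.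
Proof. by rewrite ![g0 u _]g0C g0Zl. Qed.
Lemma g0_cb : cbilinear (@g0 R).
Proof.
by apply: cbilinear_HH => [y|x] k a b /=; rewrite ?g0Dl ?g0Zl ?g0Dr ?g0Zr.
Qed.
(** [g0] u u is the sum of |u.1|^2, |u.2|^2 and |u.1 - u.2|^2, up to a
    factor. *)
Lemma g0_eq0 u : g0 u u = 0 -> u = 0.
Proof.
move=> e; have := qdot_ge0 (u.1 - u.2).
have := (qdot_ge0 u.1, qdot_ge0 u.2) => -[a b] c.
have e1 : g0 u u = 2 / 3 * (qdot u.1 u.1 + qdot u.2 u.2 + qdot (u.1 - u.2) (u.1 - u.2)).
  by rewrite g0.unlock !qdotE !quatE; field.
rewrite e1 in e.
by apply: pair_ext; apply: qdot_eq0; lra.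
Qed.

Lemma himag_Gamma0 u v : himag (Gamma0 u v).
Proof. by split; rewrite Gamma0.unlock /= /qcross !quatE; ring. Qed.

(** [nkJ] in the left trivialisation, see [nkJ_hmul]. *)
Definition J0 u : 'HH[R] :=
  (Num.sqrt 3)^-1 *: (2 *: u.2 - u.1, - (2 *: u.1) + u.2).

Lemma nkJ_hmul x u : qdot x.1 x.1 != 0 -> qdot x.2 x.2 != 0 ->
  nkJ x (hmul x u) = hmul x (J0 u).
Proof.
move=> n1 n2; rewrite /nkJ /J0 hmulZr; congr (_ *: _).
have c (a b d : 'H[R]) : qdot b b != 0 ->
    qmul (qmul a (qinv b)) (qmul b d) = qmul a d.
  move=> n; rewrite /qinv qmulZr qmulZl -qmulA (qmulA _ b) qmulVq qmulZl qmul1q.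
  by rewrite qmulZr scalerA mulVf // scale1r.
by apply: pair_ext; rewrite /= c //; quat_ring.
Qed.

Lemma nkg_hmul_near x u v : qdot x.1 x.1 != 0 -> qdot x.2 x.2 != 0 ->
  nkg x (hmul x u) (hmul x v) =
  2^-1 * (qdot x.1 x.1 * (qdot u.1 v.1 + qdot (J0 u).1 (J0 v).1)
        + qdot x.2 x.2 * (qdot u.2 v.2 + qdot (J0 u).2 (J0 v).2)).
Proof.
move=> n1 n2; rewrite /nkg !nkJ_hmul // /product_metric /= !qdotM.
by field.
Qed.

Lemma sqrt3_sq : (Num.sqrt 3 : R) ^+ 2 = 3.
Proof. by rewrite sqr_sqrtr. Qed.

Lemma sqrt3_neq0 : (Num.sqrt 3 : R) != 0.
Proof. by rewrite sqrtr_eq0 -ltNge ltr0n. Qed.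

Lemma nkg_hmul x u v : S3xS3 x -> nkg x (hmul x u) (hmul x v) = g0 u v.
Proof.
case=> x1 x2.
rewrite nkg_hmul_near; [|by rewrite x1 oner_neq0|by rewrite x2 oner_neq0].
rewrite x1 x2 /J0 !HHE !qdotZl.
rewrite ![qdot _ (_^-1 *: _)]qdotC !qdotZl !mulrA.
have -> : (Num.sqrt 3)^-1 / Num.sqrt 3 = 3^-1 :> R.
  by rewrite -invfM -expr2 sqrt3_sq.
by rewrite g0.unlock /= !qdotE !quatE; field.
Qed.

Definition left_field u : 'HH[R] -> 'HH[R] := fun y => hmul y u.

Lemma left_field_cl u : clinear (left_field u).
Proof. by apply: clinear_HH; have [l _ _] := @hmul_cb R; exact: l. Qed.

Lemma left_field_vf u : himag u -> vector_field S3xS3 tangent_S3xS3 (left_field u).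
Proof.
move=> iu; split; last by move=> x xN; apply/tangent_hmul.
exists setT; split=> //; first exact: openT.
by apply: smooth_clinear; [exact: openT|exact: left_field_cl].
Qed.

Lemma derive_left_field u x v : 'D_v (left_field u) x = hmul v u.
Proof. by have [_ ->] := clinear_diff x (left_field_cl u). Qed.

(** As a function of its base point, the inner product of two left-invariant
    fields is near S^3 x S^3 the quadratic form of such a weighted product;
    this is used to differentiate it. *)
Definition wdot (k1 k2 : R) u v : R := k1 * qdot u.1 v.1 + k2 * qdot u.2 v.2.

Lemma wdot_cb k1 k2 : cbilinear (wdot k1 k2).
Proof.
by apply: cbilinear_HH => [y|x] k a b; rewrite /wdot !HHE !qdotE !quatE;
  rewrite -[k *: _]/(k * _); ring.
Qed.

Lemma near_unit x : S3xS3 x ->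
  \forall y \near x, qdot y.1 y.1 != 0 /\ qdot y.2 y.2 != 0.
Proof.
case=> x1 x2.
have id_d : differentiable (id : 'HH[R] -> 'HH[R]) x by exact: ex_diff.
have [d1 _] := cbilinear_diff (wdot_cb 1 0) id_d id_d.
have [d2 _] := cbilinear_diff (wdot_cb 0 1) id_d id_d.
have c1 := differentiable_continuous d1.
have c2 := differentiable_continuous d2.
have n1 : wdot 1 0 x x != 0 by rewrite /wdot mul0r addr0 mul1r x1 oner_neq0.
have n2 : wdot 0 1 x x != 0 by rewrite /wdot mul0r add0r mul1r x2 oner_neq0.
have m1 : \forall y \near x, wdot 1 0 y y != 0 by apply: cvgr_neq0 c1 n1.
have m2 : \forall y \near x, wdot 0 1 y y != 0 by apply: cvgr_neq0 c2 n2.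
by apply: filterS2 m1 m2 => y; rewrite /wdot !mul0r addr0 add0r !mul1r.
Qed.

(** The metric is left-invariant, so the inner product of two left-invariant
    fields is constant along S^3 x S^3. *)
Lemma derive_nkg_left x u v w : S3xS3 x -> himag w ->
  'D_(hmul x w) (fun y => nkg y (left_field u y) (left_field v y)) x = 0.
Proof.
move=> xN iw.
pose c1 := 2^-1 * (qdot u.1 v.1 + qdot (J0 u).1 (J0 v).1).
pose c2 := 2^-1 * (qdot u.2 v.2 + qdot (J0 u).2 (J0 v).2).
have id_d : differentiable (id : 'HH[R] -> 'HH[R]) x by exact: ex_diff.
have [_ Db] := cbilinear_diff (wdot_cb c1 c2) id_d id_d.
rewrite (@near_eq_derive _ _ _ _ (fun y => wdot c1 c2 y y)); last first.
  apply: filterS (near_unit xN) => y [n1 n2].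
  by rewrite nkg_hmul_near // /wdot /c1 /c2; ring.
rewrite Db derive_id /wdot.
have /(tangent_hmul _ xN) [t1 t2] := iw.
by rewrite ![qdot (hmul x w).1 _]qdotC ![qdot (hmul x w).2 _]qdotC t1 t2; ring.
Qed.

Lemma g0_Gamma0_skew (a b c : 'HH[R]) :
  g0 (Gamma0 a b) c + g0 b (Gamma0 a c) = 0.
Proof.
have sk (p q r : 'H[R]) : qdot q (qcross p r) = - qdot (qcross p q) r.
  by rewrite /qcross !qdotE !quatE; ring.
rewrite g0.unlock Gamma0.unlock /=.
rewrite !(qdotDl, qdotDr, qdotZl, qdotZr, qdotNl, qdotNr) !sk.
lra.
Qed.

(** Koszul: a tensor which is symmetric in its arguments and skew with
    respect to the metric, such as the difference of two torsion-free metric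
    connections, vanishes, by combining the three cyclic permutations of the
    skewness identity. *)
Lemma koszul_uniqueness (V : Type) (P : V -> Prop) (b : V -> V -> R) (S : V -> V -> V) :
  (forall X Y, b X Y = b Y X) ->
  (forall X Y, P X -> P Y -> S X Y = S Y X) ->
  (forall X Y Z, P X -> P Y -> P Z -> b (S X Y) Z + b Y (S X Z) = 0) ->
  forall X Y Z, P X -> P Y -> P Z -> b (S X Y) Z = 0.
Proof.
move=> bC sS kS X Y Z iX iY iZ.
have e1 := kS X Y Z iX iY iZ; have e2 := kS Z X Y iZ iX iY.
have e3 := kS Y Z X iY iZ iX.
rewrite (sS Z X) // (sS Z Y) // in e2; rewrite (sS Y X) // in e3.
have := (bC Y (S X Z), bC X (S Y Z), bC Z (S X Y)) => -[[e4 e5] e6].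
lra.
Qed.

(** The derivative of the left-invariant field x v in the direction x u is x
    u v; this explains the term subtracted on the right.  On left-invariant
    fields GammaN and [Gamma0] are both torsion-free and metric, so that
    [koszul_uniqueness] applies to their difference. *)
Lemma levi_civita_left (GammaN : 'HH[R] -> 'HH[R] -> 'HH[R] -> 'HH[R]) :
  is_levi_civita_S3xS3 GammaN ->
  forall x, S3xS3 x -> forall u v, himag u -> himag v ->
  GammaN x (hmul x u) (hmul x v) = hmul x (Gamma0 u v - hmul u v).
Proof.
move=> [[_ _ tgt] tf mc] x xN u v iu iv.
pose nab u v := nabla GammaN (left_field u) (left_field v) x.
have nabE u' v' : nab u' v' =
    hmul x (hmul u' v') + GammaN x (hmul x u') (hmul x v').
  by rewrite /nab /nabla derive_left_field hmulA.
pose K u v := hmul (hconj x) (nab u v).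
have KE u' v' : nab u' v' = hmul x (K u' v') by rewrite hmulVK.
have iK u' v' : himag u' -> himag v' -> himag (K u' v').
  move=> iu' iv'; apply/(tangent_hmul _ xN); rewrite -KE.
  by apply: tgt => //; exact: left_field_vf.
have KC u' v' : himag u' -> himag v' ->
    K u' v' - K v' u' = hmul u' v' - hmul v' u'.
  move=> iu' iv'; apply: (hmul_inj xN); rewrite !hmulBr -!KE.
  rewrite /nab tf //; [|exact: left_field_vf|exact: left_field_vf].
  by rewrite /lie_bracket !derive_left_field !hmulA.
have Km u' v' w' : himag u' -> himag v' -> himag w' ->
    g0 (K u' v') w' + g0 v' (K u' w') = 0.
  move=> iu' iv' iw'.
  have := mc _ _ _ (left_field_vf iu') (left_field_vf iv') (left_field_vf iw') x xN.
  rewrite derive_nkg_left // => e; rewrite {1}e.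
  by rewrite -!(nkg_hmul _ _ xN) -!KE.
have E : K u v - Gamma0 u v = 0.
  apply: g0_eq0; apply: (@koszul_uniqueness _ (@himag R) _ (fun u v => K u v - Gamma0 u v));
    rewrite //; first exact: g0C.
  - move=> u' v' iu' iv'; apply/eqP; rewrite -subr_eq0.
    have -> : K u' v' - Gamma0 u' v' - (K v' u' - Gamma0 v' u') =
      (K u' v' - K v' u') - (Gamma0 u' v' - Gamma0 v' u').
      by rewrite !opprD !opprK !addrA; congr (_ + _); rewrite addrAC.
    rewrite KC // Gamma0.unlock; case: iu' iv' => [a b] [c d]; apply/eqP.
    apply: pair_ext; rewrite /= ?HHE /=.
      by apply: quat_ext; rewrite /qmul /qcross ?quatE ?a ?b ?c ?d; ring.
    by apply: quat_ext; rewrite /qmul /qcross ?quatE ?a ?b ?c ?d; ring.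
  - move=> u' v' w' iu' iv' iw'.
    rewrite !g0Dl !g0Dr addrACA Km // add0r.
    by rewrite -[- Gamma0 u' v']scaleN1r -[- Gamma0 u' w']scaleN1r g0Zl g0Zr -mulrDr
      g0_Gamma0_skew mulr0.
  - by apply: himagB; [exact: iK|exact: himag_Gamma0].
apply: (@addrI _ (hmul x (hmul u v))); rewrite -nabE KE -hmulDr; congr hmul.
by rewrite addrC subrK; apply/eqP; rewrite -subr_eq0 E.
Qed.

Lemma Gamma0_comm (a b : 'HH[R]) : Gamma0 a b - Gamma0 b a = 2 *: hcross a b.
Proof. by rewrite Gamma0.unlock /hcross; hh_ring. Qed.

Lemma Gamma0Dr (a b c : 'HH[R]) : Gamma0 a (b + c) = Gamma0 a b + Gamma0 a c.
Proof. by have [_ l _] := Gamma0_cb; have := l a 1 b c; rewrite !scale1r. Qed.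
Lemma Gamma0Zr k (a b : 'HH[R]) : Gamma0 a (k *: b) = k *: Gamma0 a b.
Proof.
have [_ l _] := Gamma0_cb; have := l a k b 0; rewrite !addr0 => ->.
have := l a 1 0 0; rewrite !scale1r !addr0 => /eqP.
rewrite -subr_eq0 opprD addrA subrr sub0r oppr_eq0 => /eqP ->.
by rewrite addr0.
Qed.

(** The curvature tensor on left-invariant fields, whose bracket is twice the
    cross product. *)
Definition curv0 (a b c : 'HH[R]) := Gamma0 (- 2 *: hcross a b) c
  + Gamma0 a (Gamma0 b c) - Gamma0 b (Gamma0 a c).
End LeftTrivialisation.

(** * Flat and equilateral tangent vectors *)

Section Dichotomy.
Context {R : realType}.
Implicit Types (a b : 'HH[R]) (A C : 'H[R]).

(** This is exp (pi J0 / 3) = (1 + sqrt 3 J0) / 2, see [hrot_J0].  A plane is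
    invariant under it exactly when it is J-invariant, and its coefficients
    are integers. *)
Definition hrot a : 'HH[R] := (a.2, a.2 - a.1).
Definition flat a := qcross a.1 a.2 = 0.
(** Equivalently |A| = |C| = |A - C|: the triangle 0, A, C is equilateral. *)
Definition equilateral a :=
  qdot a.1 a.1 = 2 * qdot a.1 a.2 /\ qdot a.2 a.2 = 2 * qdot a.1 a.2.

Lemma hrot_J0 a : hrot a = 2^-1 *: (a + Num.sqrt 3 *: J0 a).
Proof.
rewrite /J0 scalerA divff ?sqrt3_neq0 // scale1r.
by apply: pair_ext; rewrite /= ?HHE /=; apply: quat_ext; rewrite ?quatE; field.
Qed.

(** Together with [equilateral_comb]: both conditions depend only on the
    plane spanned by a and [hrot] a. *)
Lemma flat_comb a l m : flat a -> flat (l *: a + m *: hrot a).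
Proof.
rewrite /flat /hrot => h.
have -> : qcross (l *: a + m *: (a.2, a.2 - a.1)).1 (l *: a + m *: (a.2, a.2 - a.1)).2
  = (l ^+ 2 + l * m + m ^+ 2) *: qcross a.1 a.2 by rewrite ?HHE /=; quat_ring.
by rewrite h scaler0.
Qed.

Lemma equilateral_comb a l m : equilateral a -> equilateral (l *: a + m *: hrot a).
Proof.
rewrite /equilateral /hrot => -[h1 h2]; rewrite ?HHE /=.
rewrite !(qdotDl, qdotDr, qdotZl, qdotZr, qdotNl, qdotNr) h1 h2 (qdotC a.2 a.1).
by split; ring.
Qed.

(** |A x C|^2 = |A|^2 |C|^2 - <A,C>^2 is 3 <A,C>^2 in the equilateral case. *)
Lemma flat_equilateral a : himag a -> flat a -> equilateral a -> a = 0.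
Proof.
case: a => A C ia fl [/= h1 h2]; have := cross_norm ia.
rewrite /flat /= in fl; rewrite fl.
have -> : qdot (0 : 'H[R]) 0 = 0 by rewrite qdotE !quatE; ring.
rewrite h1 h2 => e.
have e' : qdot A C ^+ 2 = 0 by move: e; rewrite !expr2; lra.
have {}e' : qdot A C = 0 by apply/eqP; rewrite -sqrf_eq0; apply/eqP.
by apply: pair_ext; apply: qdot_eq0; rewrite /= ?h1 ?h2 e' mulr0.
Qed.

(** All terms are multiples of N = A x C or cross products of N with A and C. *)
Lemma curvature_hrot A C : himag (A, C) ->
  curv0 (A, C) (hrot (A, C)) (A, C) = (4 / 3) *: (qdot A C *: A - qdot A A *: C,
                                              qdot C C *: A - qdot A C *: C).
Proof.
move=> iAC; set X := (A, C).
pose N := qcross A C.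
have E1 : hcross X (hrot X) = (N, N) by rewrite /hcross /hrot /N /=; hh_ring.
have E2 : Gamma0 (hrot X) X = (- (4 / 3) *: N, - (2 / 3) *: N).
  by rewrite Gamma0.unlock /hrot /N /=; apply: pair_ext; apply: quat_ext;
    rewrite /= /qcross ?quatE; field.
have E3 : Gamma0 X X = (- (2 / 3) *: N, (2 / 3) *: N).
  by rewrite Gamma0.unlock /N /=; apply: pair_ext; apply: quat_ext;
    rewrite /= /qcross ?quatE; field.
have <- : qcross A N = qdot A C *: A - qdot A A *: C.
  by case: iAC => /= h1 h2; apply: quat_ext;
    rewrite !qdotE /N /qcross ?quatE h1 ?h2; ring.
have <- : qcross C N = qdot C C *: A - qdot A C *: C.
  by case: iAC => /= h1 h2; apply: quat_ext;
    rewrite !qdotE /N /qcross ?quatE h2 ?h1; ring.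
rewrite /curv0 E1 E2 E3 Gamma0.unlock /hrot; move: N {E1 E2 E3} => N.
by apply: pair_ext; apply: quat_ext; rewrite /= /qcross ?HHE /= ?quatE; field.
Qed.

(** If A x C <> 0 then A and C are linearly independent, and comparing their
    coefficients in both components leaves |A|^2 = |C|^2 = 2<A,C>. *)
Lemma dichotomy_alg a l m : himag a -> curv0 a (hrot a) a = l *: a + m *: hrot a ->
  flat a \/ equilateral a.
Proof.
case: a => A C ia; rewrite (curvature_hrot ia) /flat /equilateral /=.
move: (qdot A A) (qdot A C) (qdot C C) => aa ac cc e.
have [->|n] := eqVneq (qcross A C) 0; [by left|right].
have z k : k *: qcross A C = 0 -> k = 0.
  by move=> /eqP; rewrite scaler_eq0 (negPf n) orbF => /eqP.
have e1 := congr1 (fun p : 'HH[R] => p.1) e.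
have e2 := congr1 (fun p : 'HH[R] => p.2) e.
rewrite /hrot !HHE /= in e1 e2.
(* f1 and f3 compare coefficients of C, f2 and f4 those of A. *)
have f1 : (- (4 / 3) * aa - m) *: qcross A C = 0.
  transitivity (qcross A ((4 / 3) *: (ac *: A - aa *: C)) - qcross A (l *: A + m *: C)).
    by quat_ring.
  by rewrite e1 subrr.
have f2 : (4 / 3 * ac - l) *: qcross A C = 0.
  transitivity (qcross ((4 / 3) *: (ac *: A - aa *: C)) C - qcross (l *: A + m *: C) C).
    by quat_ring.
  by rewrite e1 subrr.
have f3 : (- (4 / 3) * ac - l - m) *: qcross A C = 0.
  transitivity (qcross A ((4 / 3) *: (cc *: A - ac *: C)) - qcross A (l *: C + m *: (C - A))).
    by quat_ring.
  by rewrite e2 subrr.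
have f4 : (4 / 3 * cc + m) *: qcross A C = 0.
  transitivity (qcross ((4 / 3) *: (cc *: A - ac *: C)) C - qcross (l *: C + m *: (C - A)) C).
    by quat_ring.
  by rewrite e2 subrr.
have := (z _ f1, z _ f2, z _ f3, z _ f4) => -[[[g1 g2] g3] g4].
by split; lra.
Qed.

(** [hrot] satisfies t^2 - t + 1 = 0, which has no real root. *)
Lemma hrot_no_eigen a k : hrot a = k *: a -> a = 0.
Proof.
case: a => A C; rewrite /hrot /= => e.
have e1 := congr1 (fun p : 'HH[R] => p.1) e; have e2 := congr1 (fun p : 'HH[R] => p.2) e.
rewrite !HHE /= in e1 e2.
have f : (k ^+ 2 - k + 1) *: A = 0.
  have -> : (k ^+ 2 - k + 1) *: A = k *: (k *: A) - (k *: A - A) by quat_ring.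
  by rewrite -e1 e2 subrr.
have kn : k ^+ 2 - k + 1 != 0.
  rewrite gt_eqF //; have := sqr_ge0 (k - 2^-1); rewrite !expr2; lra.
have A0 : A = 0 by move/eqP: f; rewrite scaler_eq0 (negPf kn) => /eqP.
by apply: pair_ext => //=; rewrite e1 A0 scaler0.
Qed.

Lemma rV2_ext (v w : 'rV[R]_2) : v 0 0 = w 0 0 -> v 0 1 = w 0 1 -> v = w.
Proof.
by move=> h0 h1; apply/rowP => -[[|[|//]] hi];
  [rewrite (_ : Ordinal hi = 0)|rewrite (_ : Ordinal hi = 1)] => //; exact: val_inj.
Qed.

Lemma rV2_span (v w : 'rV[R]_2) : v != 0 -> (forall k, w != k *: v) ->
  forall z, exists l m, z = l *: v + m *: w.
Proof.
move=> v0 ind z.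
pose D := v 0 0 * w 0 1 - v 0 1 * w 0 0.
have [D0|Dn] := eqVneq D 0; last first.
  exists ((z 0 0 * w 0 1 - z 0 1 * w 0 0) / D), ((v 0 0 * z 0 1 - v 0 1 * z 0 0) / D).
  by apply: rV2_ext; rewrite !mxE; move: Dn; rewrite /D => Dn; field.
have [a0|an] := eqVneq (v 0 0) 0; last first.
  have := ind (w 0 0 / v 0 0); case/eqP; apply: rV2_ext; rewrite !mxE; first by field.
  by apply: (mulfI an); rewrite mulrA mulrCA divff // mulr1; move: D0; rewrite /D; lra.
have [b0|bn] := eqVneq (v 0 1) 0.
  by case/eqP: v0; apply: rV2_ext; rewrite !mxE.
have := ind (w 0 1 / v 0 1); case/eqP; apply: rV2_ext; rewrite !mxE; last by field.
by apply: (mulfI bn); rewrite mulrA mulrCA divff // mulr1; move: D0; rewrite /D; lra.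
Qed.
End Dichotomy.

(** * Directional derivatives *)

Section DeriveComm.
Context {R : realType}.

Lemma derive_comm_HH (V : normedModType R) (U : set V) (f : V -> 'HH[R]) (x v w : V) :
  open U -> smooth U f -> U x -> 'D_v ('D_w f) x = 'D_w ('D_v f) x.
Proof.
move=> oU sf Ux.
(* The real case is applied to every coordinate. *)
have main (k : 'HH[R] -> 'H[R]) i : linear k ->
    k ('D_v ('D_w f) x) 0 i = k ('D_w ('D_v f) x) 0 i.
  move=> lk; have cl := HH_coord_cl i lk.
  have sub v' y : U y -> 'D_v' (fun x => k (f x) 0 i) y = k ('D_v' f y) 0 i.
    by move=> Uy; have [_ ->] := comp_clinear cl (smooth_diff sf Uy).
  have sub2 v' w' : 'D_v' ('D_w' (fun x => k (f x) 0 i)) x = k ('D_v' ('D_w' f) x) 0 i.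
    rewrite (@near_eq_derive _ _ _ _ (fun y => k ('D_w' f y) 0 i)); last first.
      by apply: filterS (open_nbhs_nbhs (conj oU Ux)) => y Uy; exact: sub.
    have d := smooth_diff (smooth_derive w' sf) Ux.
    by have [_ ->] := comp_clinear cl d.
  have sk := smooth_comp_clinear oU cl sf.
  have e := derive_comm_real v w oU sk Ux.
  exact: (etrans (esym (sub2 v w)) (etrans e (sub2 w v))).
apply: pair_ext; apply/rowP => i.
  by apply: (main fst i).
by apply: (main snd i).
Qed.
End DeriveComm.

(** A sealed copy of the directional derivative: two iterated derivatives
    that differ only in their directions are then seen to be distinct without
    unfolding limits. *)
HB.lock Definition pdv {R : realType} {V W : normedModType R} (v : V)
  (f : V -> W) (x : V) : W := 'D_v f x.

Section Pdv.
Context {R : realType} {V W : normedModType R}.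
Implicit Types (f g : V -> W) (v w x : V).

Lemma pdvE v f x : 'D_v f x = pdv v f x. Proof. by rewrite pdv.unlock. Qed.

Lemma pdv_fun v f : 'D_v f = pdv v f.
Proof. by apply/funext => x; rewrite pdvE. Qed.

Lemma near_pdv v f g x : (\near x, f x = g x) -> pdv v f x = pdv v g x.
Proof. by rewrite -!pdvE; exact: near_eq_derive. Qed.

Lemma pdv_cst v (c : W) x : pdv v (fun=> c) x = 0.
Proof. by rewrite -pdvE; exact: derive_cst. Qed.

Lemma pdvD v f g x : differentiable f x -> differentiable g x ->
  pdv v (fun y => f y + g y) x = pdv v f x + pdv v g x.
Proof.
by move=> df dg; rewrite -!pdvE;
  exact: (deriveD (@diff_derivable _ _ _ _ _ v df) (@diff_derivable _ _ _ _ _ v dg)).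
Qed.

Lemma pdv_smooth (U : set V) v f : smooth U f -> smooth U (pdv v f).
Proof. by move=> sf; rewrite -pdv_fun; exact: smooth_derive. Qed.

Lemma pdv_linear f x : differentiable f x -> linear (fun v => pdv v f x).
Proof. by move=> df k v w; rewrite -!pdvE !deriveE // linearP. Qed.

Lemma pdv_bilin (T U : normedModType R) (B : T -> U -> W) (f : V -> T)
    (g : V -> U) v x :
  cbilinear B -> differentiable f x -> differentiable g x ->
  pdv v (fun y => B (f y) (g y)) x = B (pdv v f x) (g x) + B (f x) (pdv v g x).
Proof.
move=> cB df dg; have [_] := cbilinear_diff cB df dg => /(_ v).
by rewrite pdv.unlock.
Qed.

Lemma pdv_lin (T : normedModType R) (L : T -> W) (f : V -> T) v x :
  clinear L -> differentiable f x ->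
  pdv v (fun y => L (f y)) x = L (pdv v f x).
Proof.
by move=> cL df; have [_] := comp_clinear cL df => /(_ v); rewrite pdv.unlock.
Qed.
End Pdv.

Lemma pdv_comm (R : realType) (V : normedModType R) (U : set V) (f : V -> 'HH[R])
    (x v w : V) :
  open U -> smooth U f -> U x -> pdv v (pdv w f) x = pdv w (pdv v f) x.
Proof.
move=> oU sf Ux; rewrite -!pdv_fun.
exact: derive_comm_HH oU sf Ux.
Qed.

(** * Open pieces of an immersed surface *)

Section NearestPoint.
Context {R : realType}.
Implicit Types (x v w : 'rV[R]_2) (a b y : 'HH[R]).
Local Notation pm := product_metric.

Lemma pmE a b : pm a b = wdot 1 1 a b.
Proof. by rewrite /product_metric /wdot !mul1r. Qed.
Lemma pm_ge0 a : 0 <= pm a a.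
Proof. by rewrite /product_metric addr_ge0 // qdot_ge0. Qed.
Lemma pm_eq0 a : pm a a = 0 -> a = 0.
Proof.
rewrite /product_metric => e; have := (qdot_ge0 a.1, qdot_ge0 a.2) => -[h1 h2].
by apply: pair_ext; apply: qdot_eq0; lra.
Qed.
Lemma pmC a b : pm a b = pm b a.
Proof. by rewrite /product_metric qdotC (qdotC a.2). Qed.
Lemma pmN a : pm (- a) (- a) = pm a a.
Proof. by rewrite /product_metric !HHE !qdotNl !qdotNr !opprK. Qed.
Lemma pmD_le a b : pm (a + b) (a + b) <= 2 * pm a a + 2 * pm b b.
Proof.
have := pm_ge0 (a - b); rewrite /product_metric !HHE.
rewrite !(qdotDl, qdotDr, qdotNl, qdotNr) (qdotC b.1) (qdotC b.2); lra.
Qed.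

Lemma dist_continuous x : continuous (fun y : 'rV[R]_2 => `|y - x|).
Proof.
move=> y.
have d : differentiable ((id : 'rV[R]_2 -> 'rV[R]_2) - cst x) y.
  by apply: differentiableB; [exact: ex_diff|exact: differentiable_cst].
exact: (continuous_comp (differentiable_continuous d) (@norm_continuous _ _ _)).
Qed.

Lemma compact_sphere x (r : R) : compact [set y : 'rV[R]_2 | `|y - x| = r].
Proof.
apply: bounded_closed_compact.
  exists (`|x| + `|r|); split; first exact: num_real.
  move=> M /ltW le y /= yr; apply: le_trans le.
  rewrite -[y](subrK x) addrC (le_trans (ler_normD _ _)) // lerD2l yr; exact: ler_norm.
rewrite (_ : [set _ | _] = (fun y : 'rV[R]_2 => `|y - x|) @^-1` [set r]) //.
apply: closed_comp; last exact: closed_eq.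
by move=> y _; exact: dist_continuous.
Qed.

Lemma compact_cball x (r : R) : compact [set y : 'rV[R]_2 | `|y - x| <= r].
Proof.
apply: bounded_closed_compact.
  exists (`|x| + `|r|); split; first exact: num_real.
  move=> M /ltW le y /= yr; apply: le_trans le.
  rewrite -[y](subrK x) addrC (le_trans (ler_normD _ _)) // lerD2l (le_trans yr) //.
  exact: ler_norm.
rewrite (_ : [set _ | _] = (fun y : 'rV[R]_2 => `|y - x|) @^-1` [set s | s <= r]) //.
apply: closed_comp; last exact: closed_le.
by move=> y _; exact: dist_continuous.
Qed.

Lemma EVT_min_on (f : 'rV[R]_2 -> R) (K : set 'rV[R]_2) x0 : compact K -> K x0 ->
  (forall x, K x -> {for x, continuous f}) ->
  exists2 c, K c & forall t, K t -> f c <= f t.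
Proof.
move=> cK Kx cf.
have [||c Kc h] := @EVT_min_rV R 2 f K _ cK.
- by exists x0.
- by apply: continuous_in_subspaceT => y; rewrite inE => /cf.
exists c; first by rewrite inE in Kc.
by move=> t Kt; apply: h; rewrite inE.
Qed.

(** By compactness of the unit sphere |df h| >= mu |h| for some mu > 0, and
    the error term of the differential is smaller than mu |h| / 2 near 0. *)
Lemma injective_differential_near (f : 'rV[R]_2 -> 'HH[R]) x :
  differentiable f x -> (forall v, 'D_v f x = 0 -> v = 0) ->
  \forall h \near (0 : 'rV[R]_2), f (x + h) = f x -> h = 0.
Proof.
move=> df inj.
pose g v := `|'d f x v|.
have cg : continuous ('d f x) by exact: diff_continuous.
have x1 : exists v1 : 'rV[R]_2, `|v1 - 0| = 1.
  exists (`|(const_mx 1 : 'rV[R]_2)|^-1 *: const_mx 1).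
  rewrite subr0 normrZ normfV normr_id mulVf // normr_eq0.
  by apply/eqP => /rowP /(_ 0); rewrite !mxE => /eqP; rewrite oner_eq0.
have [v1 v11] := x1.
have [|c c1 cmin] := @EVT_min_on g _ v1 (@compact_sphere 0 1) v11.
  by move=> v _; exact: (continuous_comp (cg v) (@norm_continuous _ _ _)).
have mu : 0 < g c.
  rewrite normr_gt0; apply/eqP => e.
  have c0 : c = 0 by apply: inj; rewrite deriveE.
  by move: c1; rewrite /= c0 subr0 normr0 => /eqP; rewrite eq_sym oner_eq0.
have low h : g c * `|h| <= `|'d f x h|.
  have [->|h0] := eqVneq h 0; first by rewrite normr0 mulr0.
  have nh : `|h| != 0 by rewrite normr_eq0.
  have : g c <= g (`|h|^-1 *: h).
    by apply: cmin; rewrite /= subr0 normrZ normfV normr_id mulVf.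
  rewrite {2}/g linearZ normrZ normfV normr_id mulrC ler_pdivlMr //.
  by rewrite lt_def nh normr_ge0.
have := diff_locally df => /eqaddoP /(_ (g c / 2)).
rewrite divr_gt0 // => /(_ isT); apply: filterS => h /= hle fxh.
move: hle; rewrite (_ : (f \o shift x - (cst (f x) + 'd f x)) h = - 'd f x h); last first.
  by rewrite -[LHS]/(f (h + x) - (f x + 'd f x h)) addrC [h + x]addrC fxh opprD addrAC addNr add0r.
rewrite normrN => hle; have := le_trans (low h) hle.
have [//|h0] := eqVneq h 0.
have nh : 0 < `|h| by rewrite normr_gt0.
by rewrite (ler_pM2r nh) => le; exfalso; move: mu le; lra.
Qed.

(** The squared distance to y is minimised on a closed ball around x on which
    f takes the value f x only at x.  If y is close to f x, the minimum is
    not attained on the boundary of the ball, so the derivative vanishes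
    there. *)
Lemma nearest_point (B : set 'rV[R]_2) (f : 'rV[R]_2 -> 'HH[R]) x (e : R) :
  open B -> B x -> (forall z, B z -> differentiable f z) ->
  (forall v, 'D_v f x = 0 -> v = 0) -> 0 < e ->
  exists2 d : R, 0 < d & forall y, pm (f x - y) (f x - y) < d ->
    exists2 z, B z & pm (f z - y) (f z - y) < e /\
      forall v, pm (f z - y) (pdv v f z) = 0.
Proof.
move=> oB Bx df inj e0.
have nB : \forall h \near (0 : 'rV[R]_2), B (x + h).
  have : nbhs x B by exact: open_nbhs_nbhs.
  move=> /nbhs_ballP[r /= r0 rB]; apply/nbhs_ballP; exists r => // h.
  by rewrite -ball_normE /= sub0r normrN => hr; apply: rB;
    rewrite -ball_normE /= opprD addNKr normrN.
have nn : nbhs (0 : 'rV[R]_2) [set h | B (x + h) /\ (f (x + h) = f x -> h = 0)].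
  exact: filterI nB (injective_differential_near (df x Bx) inj).
have [r0 /= r00 hr0] := (nbhs_ballP _ _).1 nn.
pose r := r0 / 2.
have rp : 0 < r by rewrite divr_gt0.
have inr z : `|z - x| <= r -> B z /\ (f z = f x -> z = x).
  move=> zr; have [|h1 h2] := hr0 (z - x).
    rewrite -ball_normE /= sub0r normrN (le_lt_trans zr) // /r.
    by rewrite ltr_pdivrMr // mulr_natr mulr2n ltrDl.
  rewrite /= subrKC in h1 h2; split=> // /h2 /eqP.
  by rewrite subr_eq0 => /eqP.
have dN y z : B z -> differentiable (fun t => pm (f t - y) (f t - y) : R) z /\
   forall v, pdv v (fun t => pm (f t - y) (f t - y)) z = 2 * pm (f z - y) (pdv v f z).
  move=> Bz.
  have dd : differentiable (fun t => f t + (- y)) z.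
    by apply: differentiableD; [exact: df|exact: differentiable_cst].
  have -> : (fun t => pm (f t - y) (f t - y)) = fun t => wdot 1 1 (f t - y) (f t - y).
    by apply/funext => t; rewrite pmE.
  have [dw _] := cbilinear_diff (wdot_cb 1 1) dd dd.
  split=> // v; rewrite (pdv_bilin v (wdot_cb 1 1) dd dd).
  rewrite (pdvD v (df z Bz) (differentiable_cst (- y) z)) pdv_cst addr0 -!pmE.
  by rewrite (pmC (pdv _ _ _)) mulr_natl mulr2n.
have cN y z : B z -> {for z, continuous (fun t => pm (f t - y) (f t - y) : R)}.
  by move=> Bz; apply: differentiable_continuous; have [] := dN y z Bz.
have [v1 v11] : exists v1 : 'rV[R]_2, `|(x + v1) - x| = r.
  exists ((r / `|(const_mx 1 : 'rV[R]_2)|) *: const_mx 1).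
  rewrite addrAC subrr add0r normrZ normrM normfV normr_id divfK ?gtr0_norm //.
  rewrite normr_eq0.
  by apply/eqP => /rowP /(_ 0); rewrite !mxE => /eqP; rewrite oner_eq0.
have [|c c1 cmin] := @EVT_min_on (fun t => pm (f t - f x) (f t - f x)) _ (x + v1)
    (@compact_sphere x r) v11.
  by move=> z zr; apply: cN; have [] := inr z _; rewrite // zr.
set m := pm (f c - f x) (f c - f x) in cmin.
have m0 : 0 < m.
  rewrite lt_def pm_ge0 andbT; apply/eqP => /pm_eq0 /eqP.
  rewrite subr_eq0 => /eqP fcx.
  have cr : `|c - x| <= r by rewrite c1.
  have [_ /(_ fcx) cx] := inr c cr.
  by move: c1; rewrite /= cx subrr normr0 => r_0; move: rp; rewrite -r_0 ltxx.
(* On the boundary m <= |f z - f x|^2 <= 2|f z - y|^2 + 2|f x - y|^2, so that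
   the distance from y to f x must be below m / 4. *)
exists (Num.min e (m / 4)); first by rewrite lt_min e0 divr_gt0.
move=> y; rewrite lt_min => /andP[ye ym].
have [||z zr zmin] := @EVT_min_on (fun t => pm (f t - y) (f t - y)) _ x (@compact_cball x r).
- by rewrite /= subrr normr0 ltW.
- by move=> z zr; apply: cN; have [] := inr z zr.
have zx : pm (f z - y) (f z - y) <= pm (f x - y) (f x - y).
  by apply: zmin; rewrite /= subrr normr0 ltW.
have [Bz _] := inr z zr.
exists z => //; split; first exact: le_lt_trans zx ye.
have zlt : `|z - x| < r.
  rewrite lt_neqAle zr andbT; apply/eqP => zr'.
  have := cmin z zr'; have := pmD_le (f z - y) (- (f x - y)).
  rewrite pmN opprB addrA subrK => h1 h2.
  move: ym zx h1 h2; rewrite ltr_pdivlMr //.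
  move: (pm (f z - y) _) (pm (f x - y) _) (pm (f z - f x) _) => a b d; lra.
move=> v.
pose g (t : R) := pm (f (z + t *: v) - y) (f (z + t *: v) - y).
have [s s0 sin] : exists2 s : R, 0 < s & forall t, t \in `]-s, s[ -> `|z + t *: v - x| < r.
  have nv : 0 < `|v| + 1 by rewrite ltr_wpDl.
  exists ((r - `|z - x|) / (`|v| + 1)); first by rewrite divr_gt0 // subr_gt0.
  move=> t; rewrite in_itv /= => /andP[t1 t2].
  have : `|t| < (r - `|z - x|) / (`|v| + 1) by rewrite ltr_norml t1 t2.
  rewrite ltr_pdivlMr // => tl.
  rewrite addrAC (le_lt_trans (ler_normD _ _)) // normrZ -ltrBrDl.
  apply: le_lt_trans tl; rewrite ler_wpM2l // lerDl //.
have dg t : t \in `]-s, s[ -> is_derive t 1 g (2 * pm (f (z + t *: v) - y) (pdv v f (z + t *: v))).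
  move=> ts; have [Bt _] := inr _ (ltW (sin t ts)).
  have [d D] := dN y _ Bt; rewrite -D -pdvE.
  exact: (@is_derive_line _ _ _ (fun u => pm (f u - y) (f u - y))).
have z0 : 0 \in `]-s, s[ by rewrite in_itv /= s0 oppr_lt0 s0.
have h0 : is_derive (0 : R) (1 : R) g 0.
  apply: (@derive1_at_min _ g (- s) s 0) => //.
  - by rewrite ge0_cp // ltW.
  - by move=> t ts; have [] := dg t ts.
  - move=> t ts; rewrite /g scale0r addr0; apply: zmin; rewrite /=.
    exact: ltW (sin t ts).
have := @derive_val _ _ _ _ _ _ _ h0.
have h1 := dg 0 z0; have -> := @derive_val _ _ _ _ _ _ _ h1.
by rewrite scale0r addr0 => /eqP; rewrite mulf_eq0 pnatr_eq0 /= => /eqP.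
Qed.

(** Openness in the model surface, in the form that [nearest_point] provides. *)
Lemma open_piece (T : topologicalType) (D : set T) (f : T -> 'HH[R]) (P : set 'HH[R]) :
  continuous f -> P `<=` f @` D ->
  (forall a, P a -> exists2 d : R, 0 < d &
     forall z, D z -> pm (a - f z) (a - f z) < d -> P (f z)) ->
  exists W : set T, open W /\ P = f @` (D `&` W).
Proof.
move=> cf Pf h; exists (interior [set z | D z -> P (f z)]).
split; first exact: open_interior.
apply/seteqP; split=> [a Pa|_ [z [Dz /interior_subset Wz] <-]]; last exact: Wz.
have [z Dz fz] := Pf a Pa; exists z => //; split=> //.
have [d d0 hd] := h a Pa.
rewrite -fz in hd.
have id_d : differentiable (id : 'HH[R] -> 'HH[R]) (f z) by exact: ex_diff.
have db : differentiable (fun b => f z + (-1) *: b) (f z).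
  by apply: differentiableD; [exact: differentiable_cst|exact: differentiableZ].
have [dw _] := cbilinear_diff (wdot_cb 1 1) db db.
have cw := continuous_comp (cf z) (differentiable_continuous dw).
have lt : \forall t \near z, wdot 1 1 (f z + (-1) *: f t) (f z + (-1) *: f t) < d.
  have : wdot 1 1 (f z + (-1) *: f z) (f z + (-1) *: f z) < d.
    by rewrite scaleN1r subrr /wdot !qdotE !quatE !mulr0 !addr0 mulr0 addr0.
  by move=> l; apply: (cvgr_lt _ cw).
apply: filterS lt => t; rewrite -pmE scaleN1r => l Dt; exact: hd.
Qed.
End NearestPoint.

Section ModelSurfaces.
Context {R : realType}.

Lemma flat_torus_continuous : continuous (@flat_torus R).
Proof.
have q (x y : R) : quat x y 0 0 = x *: qone + y *: qi.
  by rewrite /qone /qi; quat_ring.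
have c (h : R * R -> R) : continuous h ->
    continuous (fun st : R * R => quat (cos (h st)) (sin (h st)) 0 0).
  move=> ch st.
  rewrite (_ : (fun st => _) = fun st => cos (h st) *: qone + sin (h st) *: qi); last first.
    by apply/funext => st'; exact: q.
  apply: cvgD; apply: cvgZr_tmp.
    exact: (continuous_comp (ch st) (@continuous_cos R (h st))).
  exact: (continuous_comp (ch st) (@continuous_sin R (h st))).
move=> st.
have f1 : continuous (fst : R * R -> R) by move=> p; exact: cvg_fst.
have f2 : continuous (snd : R * R -> R) by move=> p; exact: cvg_snd.
have c1 := c fst f1 st; have c2 := c snd f2 st.
rewrite -[@flat_torus R]/(fun st : R * R =>
  (quat (cos st.1) (sin st.1) 0 0, quat (cos st.2) (sin st.2) 0 0)).
exact: (cvg_pair c1 c2).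
Qed.

Lemma round_sphere_continuous : continuous (@round_sphere R).
Proof.
move=> z.
pose L (b : 'H[R]) : 'HH[R] := (- ((2^-1 * Num.sqrt 3) *: b), (2^-1 * Num.sqrt 3) *: b).
have cl : clinear L.
  by apply: clinear_rV => k a b; apply: pair_ext; rewrite /= ?HHE /=; quat_ring.
have [dL _] := clinear_diff z cl.
have d : differentiable (cst (2^-1 *: qone, 2^-1 *: qone) + L : 'H[R] -> 'HH[R]) z.
  by apply: differentiableD => //; exact: differentiable_cst.
have -> : @round_sphere R = cst (2^-1 *: qone, 2^-1 *: qone) + L.
  apply/funext => b; rewrite /round_sphere.
  apply: pair_ext; rewrite ?HHE /= -[quat 1 0 0 0]/qone scalerDr ?scalerN scalerA //.
exact: differentiable_continuous d.
Qed.
End ModelSurfaces.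

(** * The Maurer-Cartan form of an immersed surface *)

(** The Maurer-Cartan form of u, applied to the vector v at x. *)
HB.lock Definition om {R : realType} (u : 'rV[R]_2 -> 'HH[R]) (v x : 'rV[R]_2) :
  'HH[R] := hmul (hconj (u x)) (pdv v u x).

(** Coordinates of the orthogonal projection to the tangent plane, in the
    left trivialisation. *)
HB.lock Definition tcoord {R : realType} (u : 'rV[R]_2 -> 'HH[R]) (x : 'rV[R]_2)
  (a : 'HH[R]) : 'rV[R]_2 := tangent_coord u x (hmul (u x) a).

(** The common axis y of the equilateral triangles spanned by the tangent
    vectors.  It is defined by the first coordinate vector, and [yv_om] shows
    that all tangent vectors yield the same y. *)
HB.lock Definition yvec {R : realType} (u : 'rV[R]_2 -> 'HH[R]) (x : 'rV[R]_2) : 'H[R] :=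
  let w := om u (delta_mx 0 0) x in (2 / qdot w.1 w.1) *: qcross w.1 w.2.

Section Chart.
Context {R : realType}.
Implicit Types (v w z x y : 'rV[R]_2) (zeta : 'rV[R]_2 -> 'HH[R]).
Variables (O : set 'rV[R]_2) (u : 'rV[R]_2 -> 'HH[R]).
Hypothesis oO : open O.
Hypothesis uN : forall x, O x -> S3xS3 (u x).
Hypothesis su : smooth O u.
Hypothesis imm : forall x, O x -> forall v, 'D_v u x = 0 -> v = 0.

Local Notation om := (om u).

Lemma nearO (P : set 'rV[R]_2) x : O x -> (forall y, O y -> P y) -> \forall y \near x, P y.
Proof. by move=> Ox OP; apply: filterS OP _; apply: open_nbhs_nbhs. Qed.

Lemma near_pdvO (W : normedModType R) (f g : 'rV[R]_2 -> W) v x : O x ->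
  (forall y, O y -> f y = g y) -> pdv v f x = pdv v g x.
Proof. by move=> Ox fg; apply: near_pdv; exact: nearO. Qed.

Lemma pdv_immersion v x : O x -> pdv v u x = hmul (u x) (om v x).
Proof. by move=> Ox; rewrite om.unlock hmulVK //; exact: uN. Qed.

Lemma om_smooth v : smooth O (om v).
Proof.
have -> : om v = fun x => hmul (hconj (u x)) (pdv v u x).
  by apply/funext => x; rewrite om.unlock.
apply: (smooth_cbilinear oO hmul_cb); last exact: pdv_smooth.
exact: (smooth_comp_clinear oO hconj_cl).
Qed.

Lemma om_diff v x : O x -> differentiable (om v) x.
Proof. by move=> Ox; exact: smooth_diff (om_smooth v) Ox. Qed.

Lemma om_linear x : O x -> linear (om ^~ x).
Proof.
move=> Ox k v w; rewrite om.unlock /= -hmulZr -hmulDr; congr hmul.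
by apply: (pdv_linear (f := u)); exact: smooth_diff Ox.
Qed.
Lemma omD x v w : O x -> om (v + w) x = om v x + om w x.
Proof. by move=> Ox; have := om_linear Ox 1 v w; rewrite !scale1r. Qed.
Lemma om0 x : O x -> om 0 x = 0.
Proof. by move=> Ox; apply: (addrI (om 0 x)); rewrite -omD // !addr0. Qed.
Lemma omZ x k v : O x -> om (k *: v) x = k *: om v x.
Proof. by move=> Ox; have := om_linear Ox k v 0; rewrite !addr0 om0 // addr0. Qed.
Lemma omN x v : O x -> om (- v) x = - om v x.
Proof. by move=> Ox; rewrite -scaleN1r omZ // scaleN1r. Qed.
Lemma omB x v w : O x -> om (v - w) x = om v x - om w x.
Proof. by move=> Ox; rewrite omD // omN. Qed.

Lemma om_eq0 x v : O x -> om v x = 0 -> v = 0.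
Proof.
move=> Ox e; apply: (imm Ox); rewrite pdvE pdv_immersion // e.
by rewrite -[in LHS](scale0r (0 : 'HH[R])) hmulZr scale0r.
Qed.

Lemma om_imag x v : O x -> himag (om v x).
Proof.
move=> Ox; apply/(tangent_hmul _ (uN Ox)); rewrite -pdv_immersion //.
have du := smooth_diff su Ox.
have h k1 k2 : wdot k1 k2 (u x) (pdv v u x) = 0.
  have e : wdot k1 k2 (pdv v u x) (u x) + wdot k1 k2 (u x) (pdv v u x) = 0.
    rewrite -(pdv_bilin v (wdot_cb k1 k2) du du).
    rewrite (@near_pdvO _ _ (fun=> k1 + k2)) ?pdv_cst //.
    by move=> y Oy; case: (uN Oy) => e1 e2; rewrite /wdot e1 e2 !mulr1.
  rewrite {1}/wdot (qdotC (pdv v u x).1) (qdotC (pdv v u x).2) in e.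
  move: e; rewrite /wdot; lra.
by split; [have := h 1 0|have := h 0 1]; rewrite /wdot; lra.
Qed.

(** The Maurer-Cartan equation: the second derivatives of u cancel by
    symmetry, and the commutator of imaginary quaternions is twice their
    cross product. *)
Lemma structure_eq x v w : O x ->
  pdv v (om w) x - pdv w (om v) x = - 2 *: hcross (om v x) (om w x).
Proof.
move=> Ox.
have du := smooth_diff su Ox.
have D v' w' : pdv v' (om w') x =
    - hmul (om v' x) (om w' x) + hmul (hconj (u x)) (pdv v' (pdv w' u) x).
  have [dc _] := comp_clinear hconj_cl du.
  have -> : om w' = fun x => hmul (hconj (u x)) (pdv w' u x).
    by apply/funext => y; rewrite om.unlock.
  rewrite (pdv_bilin v' hmul_cb dc (smooth_diff (pdv_smooth w' su) Ox)).
  congr (_ + _); rewrite (pdv_lin v' hconj_cl du).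
  rewrite !(pdv_immersion _ Ox) hconjM_imag; last exact: om_imag.
  by rewrite -hmulA hmulK ?hmulNl //; exact: uN.
rewrite (D v w) (D w v) (pdv_comm v w oO su Ox).
rewrite opprD opprK addrACA subrr addr0 addrC.
by rewrite hmul_commutator //; exact: om_imag.
Qed.

(** The covariant derivative along u of the field x |-> u x * zeta x, see
    [pullbackE]. *)
Definition cov w zeta x : 'HH[R] := pdv w zeta x + Gamma0 (om w x) (zeta x).

Lemma near_cov f g w x : O x -> (forall y, O y -> f y = g y) ->
  cov w f x = cov w g x.
Proof. by move=> Ox fg; rewrite /cov (near_pdvO _ Ox fg) fg. Qed.

Lemma covD f g w x : differentiable f x -> differentiable g x ->
  cov w (fun y => f y + g y) x = cov w f x + cov w g x.
Proof. by move=> df dg; rewrite /cov pdvD // Gamma0Dr addrACA. Qed.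

Lemma covZ (a : 'rV[R]_2 -> R) f w x : differentiable a x -> differentiable f x ->
  cov w (fun y => a y *: f y) x = pdv w a x *: f x + a x *: cov w f x.
Proof.
move=> da df; rewrite /cov (pdv_bilin w (scale_cbilinear _) da df).
by rewrite Gamma0Zr scalerDr addrA.
Qed.

(** The second derivative of u, in the direction w, of the coordinate field
    z. *)
Definition nabla_om w z x := cov w (om z) x.

Lemma nabla_om_smooth w z : smooth O (nabla_om w z).
Proof.
move=> k; apply: CkD => //; first exact: (pdv_smooth w (om_smooth z)).
by apply: (smooth_cbilinear oO Gamma0_cb); exact: om_smooth.
Qed.

Notation e0 := (delta_mx 0 0 : 'rV[R]_2).
Notation e1 := (delta_mx 0 1 : 'rV[R]_2).

Lemma rV2E (c : 'rV[R]_2) : c = c 0 0 *: e0 + c 0 1 *: e1.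
Proof.
rewrite {1}(row_sum_delta c) !big_ord_recl big_ord0 addr0.
by congr (_ *: _ + c 0 _ *: delta_mx 0 _); apply: val_inj.
Qed.

Lemma omE c x : O x -> om c x = c 0 0 *: om e0 x + c 0 1 *: om e1 x.
Proof. by move=> Ox; rewrite {1}(rV2E c) omD // !omZ. Qed.

Lemma gramE x i j : O x -> gram u x i j = g0 (om (delta_mx 0 i) x) (om (delta_mx 0 j) x).
Proof.
by move=> Ox; rewrite mxE /induced_metric !pdvE !pdv_immersion // nkg_hmul //; exact: uN.
Qed.

Lemma mul_gram x (c : 'rV[R]_2) j : O x ->
  (c *m gram u x) 0 j = g0 (om c x) (om (delta_mx 0 j) x).
Proof.
move=> Ox; rewrite mxE omE // g0Dl !g0Zl !big_ord_recl big_ord0 addr0 !gramE //.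
by congr (_ * g0 (om (delta_mx 0 _) x) _ + c 0 _ * g0 (om (delta_mx 0 _) x) _);
  apply: val_inj.
Qed.

Lemma g0_om_basis x a : O x -> (forall j, g0 a (om (delta_mx 0 j) x) = 0) ->
  forall v, g0 a (om v x) = 0.
Proof. by move=> Ox h v; rewrite omE // g0Dr !g0Zr !h !mulr0 addr0. Qed.

Lemma gram_unit x : O x -> gram u x \in unitmx.
Proof.
move=> Ox; rewrite -row_free_unit; apply: inj_row_free => c cG.
apply: (om_eq0 Ox); apply: g0_eq0; apply: g0_om_basis => // j.
by rewrite -mul_gram // cG mxE.
Qed.

Local Notation tc := (tcoord u).

Lemma tc_gram x a j : O x -> (tc x a *m gram u x) 0 j = g0 a (om (delta_mx 0 j) x).
Proof.
move=> Ox; rewrite tcoord.unlock /tangent_coord mulmxKV ?gram_unit // mxE.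
by rewrite pdvE pdv_immersion // nkg_hmul //; exact: uN.
Qed.

Definition nproj x (a : 'HH[R]) : 'HH[R] := a - om (tc x a) x.

Lemma nproj_orth x a v : O x -> g0 (nproj x a) (om v x) = 0.
Proof.
move=> Ox; apply: g0_om_basis => // j.
by rewrite /nproj -[- _]scaleN1r g0Dl g0Zl -mul_gram // tc_gram // mulN1r subrr.
Qed.

Lemma tc_uniq x a c : O x -> (forall v, g0 (a - om c x) (om v x) = 0) -> tc x a = c.
Proof.
move=> Ox h; apply/eqP; rewrite -subr_eq0; apply/eqP; apply: (om_eq0 Ox).
apply: g0_eq0; rewrite omB //.
have := h (tc x a - c); have := nproj_orth a (tc x a - c) Ox.
rewrite /nproj omB //; move: (om (tc x a) x) (om c x) => p q.
have E : p - q = (a - q) + (- 1) *: (a - p).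
  by rewrite scaleN1r opprB [RHS]addrC addrA subrK.
by move=> n1 n2; rewrite {1}E g0Dl g0Zl n1 n2 mulr0 addr0.
Qed.

Lemma tcD x a b : O x -> tc x (a + b) = tc x a + tc x b.
Proof.
move=> Ox; apply: tc_uniq => // v; rewrite omD // opprD addrACA g0Dl.
by rewrite -!/(nproj _ _) !nproj_orth // addr0.
Qed.

Lemma tc_om x c : O x -> tc x (om c x) = c.
Proof.
move=> Ox; apply: tc_uniq => // v; rewrite subrr.
by rewrite -(scale0r (0 : 'HH[R])) g0Zl mul0r.
Qed.

Lemma nprojD x a b : O x -> nproj x (a + b) = nproj x a + nproj x b.
Proof. by move=> Ox; rewrite /nproj tcD // omD // opprD addrACA. Qed.
Lemma nproj_om x c : O x -> nproj x (om c x) = 0.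
Proof. by move=> Ox; rewrite /nproj tc_om // subrr. Qed.
Lemma nproj0 x : O x -> nproj x 0 = 0.
Proof. by move=> Ox; rewrite -[X in nproj x X](om0 Ox) nproj_om. Qed.
Lemma nprojN x a : O x -> nproj x (- a) = - nproj x a.
Proof. by move=> Ox; apply: (addrI (nproj x a)); rewrite -nprojD // !subrr nproj0. Qed.
Lemma nprojB x a b : O x -> nproj x (a - b) = nproj x a - nproj x b.
Proof. by move=> Ox; rewrite nprojD // nprojN. Qed.
Lemma nproj_eq0 x a : nproj x a = 0 -> a = om (tc x a) x.
Proof. by rewrite /nproj => /eqP; rewrite subr_eq0 => /eqP. Qed.
Lemma normal_partE x a : O x -> normal_part u x (hmul (u x) a) = hmul (u x) (nproj x a).
Proof. by move=> Ox; rewrite /normal_part pdvE pdv_immersion // -hmulBr /nproj tcoord.unlock. Qed.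

Lemma g0_diff f g x : O x -> differentiable f x -> differentiable g x ->
  differentiable (fun y => g0 (f y) (g y) : R) x.
Proof. by move=> Ox df dg; have [] := cbilinear_diff g0_cb df dg. Qed.

(** By Cramer's rule for the Gram matrix, the coordinates are rational
    functions of differentiable functions. *)
Lemma tc_diff f x i : O x -> (forall y, O y -> differentiable f y) ->
  differentiable (fun y => tc y (f y) 0 i : R) x.
Proof.
move=> Ox df.
pose a y := g0 (om e0 y) (om e0 y); pose b y := g0 (om e0 y) (om e1 y).
pose c y := g0 (om e1 y) (om e1 y).
pose r y := g0 (f y) (om e0 y); pose s y := g0 (f y) (om e1 y).
pose d y := a y * c y - b y * b y.
have sys y : O y -> tc y (f y) 0 0 * a y + tc y (f y) 0 1 * b y = r y /\
                    tc y (f y) 0 0 * b y + tc y (f y) 0 1 * c y = s y.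
  move=> Oy; split; rewrite -[in RHS]/(g0 _ _).
    by rewrite /r -tc_gram // mul_gram // [in RHS]omE // g0Dl !g0Zl [g0 (om e1 y) _]g0C.
  by rewrite /s -tc_gram // mul_gram // [in RHS]omE // g0Dl !g0Zl.
have dn0 y : O y -> d y != 0.
  move=> Oy; apply/eqP => d0.
  have w0 : c y *: e0 - b y *: e1 = 0.
    apply: (om_eq0 Oy); apply: g0_eq0; apply: g0_om_basis => // j.
    rewrite omB // !omZ // -[- (_ *: _)]scaleN1r !g0Dl !g0Zl.
    have [->|->] : j = 0 \/ j = 1.
      by case: j => -[|[|//]] hj; [left|right]; exact: val_inj.
    - rewrite -[g0 (om e0 y) _]/(a y) [g0 (om e1 y) _]g0C -[g0 (om e0 y) _]/(b y).
      by move: d0; rewrite /d; lra.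
    - by rewrite -[g0 (om e0 y) _]/(b y) -[g0 (om e1 y) _]/(c y); ring.
  have /(congr1 (fun w : 'rV[R]_2 => w 0 0)) := w0.
  rewrite !mxE /= mulr1 mulr0 subr0 => /g0_eq0 /(om_eq0 Oy).
  move=> /(congr1 (fun w : 'rV[R]_2 => w 0 1)); rewrite !mxE /=.
  by move/eqP; rewrite oner_eq0.
have E0 y : O y -> tc y (f y) 0 0 = (r y * c y - s y * b y) / d y.
  by move=> Oy; have [<- <-] := sys y Oy; have := dn0 y Oy; rewrite /d => n; field.
have E1 y : O y -> tc y (f y) 0 1 = (s y * a y - r y * b y) / d y.
  by move=> Oy; have [<- <-] := sys y Oy; have := dn0 y Oy; rewrite /d => n; field.
have da : differentiable a x by apply: g0_diff => //; exact: om_diff.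
have db : differentiable b x by apply: g0_diff => //; exact: om_diff.
have dc : differentiable c x by apply: g0_diff => //; exact: om_diff.
have dr : differentiable r x by apply: g0_diff => //; [exact: df|exact: om_diff].
have ds : differentiable s x by apply: g0_diff => //; [exact: df|exact: om_diff].
have dd : differentiable d x.
  by apply: differentiableB; apply: differentiableM.
have ddv : differentiable (fun y => (d y)^-1) x by apply: differentiableV => //; exact: dn0.
have [->|->] : i = 0 \/ i = 1.
  by case: i => -[|[|//]] hi; [left|right]; exact: val_inj.
- apply: (@near_eq_diff _ _ _ (fun y => (r y * c y - s y * b y) / d y)).
    by apply: nearO => // y Oy; rewrite E0.
  by apply: differentiableM => //; apply: differentiableB; apply: differentiableM.
- apply: (@near_eq_diff _ _ _ (fun y => (s y * a y - r y * b y) / d y)).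
    by apply: nearO => // y Oy; rewrite E1.
  by apply: differentiableM => //; apply: differentiableB; apply: differentiableM.
Qed.

(** The tangent and normal parts of [nabla_om] are the Christoffel symbols of
    the surface ([GammaM_chris]) and its second fundamental form ([sffE]). *)
Definition chris w z x := tc x (nabla_om w z x).
Definition sff w z x := nproj x (nabla_om w z x).

Lemma nabla_omE w z x : nabla_om w z x = om (chris w z x) x + sff w z x.
Proof. by rewrite /sff /nproj addrC subrK. Qed.

Lemma nabla_om_diff w z x : O x -> differentiable (nabla_om w z) x.
Proof. by move=> Ox; exact: smooth_diff (nabla_om_smooth w z) Ox. Qed.

Lemma nabla_om_imag w z x : O x -> himag (nabla_om w z x).
Proof.
move=> Ox; apply: himagD; last exact: himag_Gamma0.
have d := om_diff z Ox.
have real1 (L : 'HH[R] -> R) : clinear L -> (forall a, himag a -> L a = 0) ->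
    L (pdv w (om z) x) = 0.
  move=> cL L0; rewrite -(pdv_lin w cL d).
  rewrite (@near_pdvO _ _ (fun=> 0)) ?pdv_cst // => y Oy.
  exact: L0 (om_imag z Oy).
split.
- apply: (real1 (fun a => a.1 0 0)); last by move=> a [].
  exact: (@HH_coord_cl _ fst).
- apply: (real1 (fun a => a.2 0 0)); last by move=> a [].
  exact: (@HH_coord_cl _ snd).
Qed.

Lemma nabla_om_sym w z x : O x -> nabla_om w z x = nabla_om z w x.
Proof.
move=> Ox; apply/eqP; rewrite -subr_eq0 /nabla_om /cov opprD addrACA.
by rewrite structure_eq // Gamma0_comm -scalerDl addNr scale0r.
Qed.

Lemma chris_sym w z x : O x -> chris w z x = chris z w x.
Proof. by move=> Ox; rewrite /chris nabla_om_sym. Qed.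
Lemma sff_sym w z x : O x -> sff w z x = sff z w x.
Proof. by move=> Ox; rewrite /sff nabla_om_sym. Qed.

Lemma chris_diff w z i x : O x -> differentiable (fun y => chris w z y 0 i : R) x.
Proof. by move=> Ox; exact: (tc_diff i Ox (fun y Oy => nabla_om_diff w z Oy)). Qed.

Lemma om_chris_diff w z x : O x -> differentiable (fun y => om (chris w z y) y) x.
Proof.
move=> Ox.
apply: (@near_eq_diff _ _ _
  (fun y => chris w z y 0 0 *: om e0 y + chris w z y 0 1 *: om e1 y)).
  by apply: nearO => // y Oy; rewrite [RHS]omE.
have sc (a : 'rV[R]_2 -> R) f : differentiable a x -> differentiable f x ->
    differentiable (fun y => a y *: (f y : 'HH[R])) x.
  by move=> da df; have [] := cbilinear_diff (scale_cbilinear _) da df.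
by apply: differentiableD; apply: sc; try exact: chris_diff; exact: om_diff.
Qed.

Lemma sff_diff w z x : O x -> differentiable (sff w z) x.
Proof.
by move=> Ox; apply: differentiableB; [exact: nabla_om_diff|exact: om_chris_diff].
Qed.

(** By the Leibniz rule, the derivatives of the coefficients of a tangent
    field contribute a tangent vector only. *)
Lemma cov_om_chris t w z x : O x ->
  exists d, cov t (fun y => om (chris w z y) y) x = om d x + nabla_om t (chris w z x) x.
Proof.
move=> Ox.
pose c i y := chris w z y 0 i.
have dc i : differentiable (c i) x by exact: chris_diff.
have sc i v : differentiable (fun y => c i y *: om v y) x.
  by have [] := cbilinear_diff (scale_cbilinear _) (dc i) (om_diff v Ox).
exists (pdv t (c 0) x *: e0 + pdv t (c 1) x *: e1).
rewrite (@near_cov _ (fun y => c 0 y *: om e0 y + c 1 y *: om e1 y)) //; last first.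
  by move=> y Oy; rewrite omE.
rewrite covD // !covZ //; try exact: om_diff.
rewrite omD // !omZ // addrACA; congr (_ + _).
rewrite /nabla_om (@near_cov (om (chris w z x))
  (fun y => (cst (c 0 x)) y *: om e0 y + (cst (c 1 x)) y *: om e1 y)) //; last first.
  by move=> y Oy; rewrite [LHS]omE.
have sc' (k : R) v : differentiable (fun y => cst k y *: om v y) x.
  by have [] := cbilinear_diff (scale_cbilinear _) (differentiable_cst k x) (om_diff v Ox).
rewrite covD //; try exact: sc'.
by rewrite !covZ ?pdv_cst ?scale0r ?add0r //; try exact: om_diff.
Qed.

Section Connections.
Variable GammaN : 'HH[R] -> 'HH[R] -> 'HH[R] -> 'HH[R].
Variable GammaM : 'rV[R]_2 -> 'rV[R]_2 -> 'rV[R]_2 -> 'rV[R]_2.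
Hypothesis NLC : is_levi_civita_S3xS3 GammaN.
Hypothesis MLC : is_levi_civita O (fun=> setT) (induced_metric u) GammaM.
Hypothesis par : forall X Y Z : 'rV[R]_2 -> 'rV[R]_2,
  smooth O X -> smooth O Y -> smooth O Z ->
  forall x, O x -> nabla_h u GammaN GammaM X Y Z x = 0.

Lemma pullbackE X xi zeta x : O x -> (forall y, O y -> xi y = hmul (u y) (zeta y)) ->
  differentiable zeta x -> himag (zeta x) ->
  pullback_nabla u GammaN X xi x = hmul (u x) (cov (X x) zeta x).
Proof.
move=> Ox xiE dz iz; rewrite /pullback_nabla !pdvE (near_pdvO _ Ox xiE).
rewrite (pdv_bilin _ hmul_cb (smooth_diff su Ox) dz) xiE // pdv_immersion //.
rewrite (levi_civita_left NLC) //; [|exact: uN|exact: om_imag].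
by rewrite /cov -hmulA -!hmulDr; congr hmul; rewrite [LHS]addrC addrA subrK addrC.
Qed.

Lemma sffE X Y x : O x -> differentiable (fun y => om (Y y) y) x ->
  second_fundamental_form u GammaN X Y x =
  hmul (u x) (nproj x (cov (X x) (fun y => om (Y y) y) x)).
Proof.
move=> Ox dY; rewrite /second_fundamental_form.
have h y : O y -> Defs.pushforward u Y y = hmul (u y) (om (Y y) y).
  by move=> Oy; rewrite /Defs.pushforward pdvE pdv_immersion.
by rewrite (pullbackE _ Ox h dY (om_imag _ Ox)) normal_partE.
Qed.

Lemma cst_vector_field v : vector_field O (fun=> setT) (fun _ : 'rV[R]_2 => v).
Proof.
by split=> //; exists O; split=> //; exact: smooth_cst.
Qed.

Lemma induced_metricE x v w : O x -> induced_metric u x v w = g0 (om v x) (om w x).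
Proof. by move=> Ox; rewrite /induced_metric !pdvE !pdv_immersion // nkg_hmul //; exact: uN. Qed.

(** Both sides are torsion-free and compatible with the induced metric, so
    [koszul_uniqueness] applies.  For [chris] this follows from the symmetry
    of [nabla_om] and the skewness of [Gamma0]. *)
Lemma GammaM_chris x v w : O x -> GammaM x v w = chris v w x.
Proof.
move=> Ox; have [_ tf mc] := MLC.
have nab v' w' : nabla GammaM (fun=> v') (fun=> w') x = GammaM x v' w'.
  by rewrite /nabla pdvE pdv_cst add0r.
apply/eqP; rewrite -subr_eq0; apply/eqP.
apply: (om_eq0 Ox); apply: g0_eq0.
pose b a b := g0 (om a x) (om b x); pose S v w := GammaM x v w - chris v w x.
have bC a c : b a c = b c a by exact: g0C.
have SC a c : True -> True -> S a c = S c a.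
  move=> _ _; rewrite /S (chris_sym a) //; congr (_ - _).
  have := tf _ _ (cst_vector_field a) (cst_vector_field c) x Ox.
  rewrite !nab /lie_bracket !pdvE !pdv_cst subrr => /eqP.
  by rewrite subr_eq0 => /eqP.
suff Sk a c d : True -> True -> True -> b (S a c) d + b c (S a d) = 0.
  exact: (koszul_uniqueness bC SC Sk).
move=> _ _ _; rewrite /b /S {bC SC}.
have := mc _ _ _ (cst_vector_field a) (cst_vector_field c) (cst_vector_field d) x Ox.
rewrite !nab pdvE.
rewrite (@near_pdvO _ _ (fun y => g0 (om c y) (om d y))) //; last first.
  by move=> y Oy; exact: induced_metricE.
rewrite (pdv_bilin a g0_cb (om_diff c Ox) (om_diff d Ox)) !induced_metricE //.
have e (b' c' : 'rV[R]_2) : g0 (pdv a (om b') x) (om c' x) =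
    g0 (om (chris a b' x) x) (om c' x) - g0 (Gamma0 (om a x) (om b' x)) (om c' x).
  have : g0 (nabla_om a b' x) (om c' x) = g0 (om (chris a b' x) x) (om c' x).
    by rewrite nabla_omE g0Dl nproj_orth // addr0.
  by rewrite {1}/nabla_om /cov g0Dl => <-; rewrite addrK.
rewrite e [g0 (om c x) (pdv _ _ _)]g0C e.
have sk := g0_Gamma0_skew (om a x) (om c x) (om d x).
rewrite [g0 (om c x) (Gamma0 _ _)]g0C in sk.
rewrite (g0C (om c x) (om (GammaM x a d) x)) (g0C (om c x) (om (_ - _) x)).
have oB p q : om (p - q) x = om p x + (-1) *: om q x by rewrite omB // scaleN1r.
rewrite (oB (GammaM x a c)) (oB (GammaM x a d)).
rewrite !g0Dl !g0Zl.
move: sk; lra.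
Qed.

(** The hypothesis of parallelism, evaluated on coordinate fields and
    translated to the left trivialisation. *)
Lemma parallel_sff t v w x : O x ->
  nproj x (cov t (sff v w) x) = sff (chris t v x) w x + sff v (chris t w x) x.
Proof.
move=> Ox.
have := par (smooth_cst _ t) (smooth_cst _ v) (smooth_cst _ w) Ox.
rewrite /nabla_h.
have sffc X z y : O y -> second_fundamental_form u GammaN X (fun=> z) y =
    hmul (u y) (sff (X y) z y).
  by move=> Oy; rewrite sffE //; exact: om_diff.
have nab a b y : nabla GammaM (fun=> a) (fun=> b) y = GammaM y a b.
  by rewrite /nabla pdvE pdv_cst add0r.
rewrite (sffc (nabla GammaM (fun=> t) (fun=> v))) // nab GammaM_chris //.
have -> : second_fundamental_form u GammaN (fun=> v)
      (nabla GammaM (fun=> t) (fun=> w)) x = hmul (u x) (sff v (chris t w x) x).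
  have gE y : O y -> nabla GammaM (fun=> t) (fun=> w) y = chris t w y.
    by move=> Oy; rewrite nab GammaM_chris.
  have d : differentiable (fun y => om (nabla GammaM (fun=> t) (fun=> w) y) y) x.
    apply: (@near_eq_diff _ _ _ (fun y => om (chris t w y) y)); last exact: om_chris_diff.
    by apply: nearO => // y Oy; rewrite gE.
  have e : cov v (fun y => om (nabla GammaM (fun=> t) (fun=> w) y) y) x =
           cov v (fun y => om (chris t w y) y) x.
    by apply: near_cov => // y Oy; rewrite gE.
  rewrite (sffE _ Ox d) e.
  by have [d' ->] := cov_om_chris v t w Ox; rewrite nprojD // nproj_om // add0r.
have ie : himag (sff v w x).
  by rewrite /sff /nproj; apply: himagB; [exact: nabla_om_imag|exact: om_imag].
rewrite /normal_connection (pullbackE _ Ox _ (sff_diff v w Ox) ie); last first.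
  by move=> y Oy; rewrite sffc.
rewrite normal_partE // -!hmulBr => e.
have /(hmul_inj (uN Ox)) /eqP := etrans e (esym (hmulh0 (u x))).
by rewrite -addrA -opprD subr_eq0 => /eqP.
Qed.

(** The Ricci identity: the second derivatives of [om] cancel, and the
    structure equation turns the antisymmetrised first derivatives into a
    cross product. *)
Lemma curvature v w z x : O x ->
  cov v (nabla_om w z) x - cov w (nabla_om v z) x = curv0 (om v x) (om w x) (om z x).
Proof.
move=> Ox.
have dz := om_diff z Ox.
have D v' w' : cov v' (nabla_om w' z) x = pdv v' (pdv w' (om z)) x
    + Gamma0 (pdv v' (om w') x) (om z x) + (Gamma0 (om w' x) (pdv v' (om z) x)
    + Gamma0 (om v' x) (pdv w' (om z) x))
    + Gamma0 (om v' x) (Gamma0 (om w' x) (om z x)).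
  have dw := om_diff w' Ox.
  have dd := smooth_diff (pdv_smooth w' (om_smooth z)) Ox.
  have [dG _] := cbilinear_diff Gamma0_cb dw dz.
  rewrite /cov /nabla_om /cov pdvD // (pdv_bilin v' Gamma0_cb dw dz) Gamma0Dr.
  by rewrite !addrA.
rewrite (D v w) (D w v) (pdv_comm v w oO (om_smooth z) Ox).
have alg (a b b' c c' d d' : 'HH[R]) :
    (a + b + (c + c') + d) - (a + b' + (c' + c) + d') = (b - b') + d - d'.
  hh_ring.
rewrite alg /curv0 -structure_eq //; congr (_ + _ - _).
have [l _ _] := @Gamma0_cb R.
have := l (om z x) (-1) (pdv w (om v) x) (pdv v (om w) x).
by rewrite /= !scaleN1r => l'; rewrite addrC -l'; congr Gamma0; rewrite addrC.
Qed.

(** By [parallel_sff] the normal part of the covariant derivative of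
    [nabla_om] along v is sff v (chris w z) + sff (chris v w) z + sff w
    (chris v z), which is symmetric in v and w.  Hence the curvature has no
    normal part. *)
Lemma curvature_tangent v w z x : O x ->
  exists c, curv0 (om v x) (om w x) (om z x) = om c x.
Proof.
move=> Ox; exists (tc x (curv0 (om v x) (om w x) (om z x))); apply: nproj_eq0.
rewrite -curvature //.
have split_cov a b : nproj x (cov a (nabla_om b z) x) =
    sff a (chris b z x) x + (sff (chris a b x) z x + sff b (chris a z x) x).
  have e : cov a (nabla_om b z) x = cov a (fun y => om (chris b z y) y + sff b z y) x.
    by apply: near_cov => // y _; rewrite nabla_omE.
  rewrite -parallel_sff // e.
  rewrite (covD a (om_chris_diff b z Ox) (sff_diff b z Ox)).
  have [d ->] := cov_om_chris a b z Ox.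
  by rewrite nprojD // (nprojD (om d x)) // nproj_om // add0r.
rewrite nprojB // !split_cov (chris_sym w v) //.
have alg (a b c : 'HH[R]) : (a + (b + c)) - (c + (b + a)) = 0.
  hh_ring.
exact: alg.
Qed.

(** The form in which parallelism enters the equilateral case: up to tangent
    vectors, the derivative of [sff] is a sum of values of [sff]. *)
Lemma parallel_tangent t v w x : O x -> exists c v1 w1 v2 w2,
  cov t (sff v w) x = om c x + (sff v1 w1 x + sff v2 w2 x).
Proof.
move=> Ox; exists (tc x (cov t (sff v w) x)), (chris t v x), w, v, (chris t w x).
by rewrite -parallel_sff // /nproj addrC subrK.
Qed.
End Connections.

(** * Almost complex surfaces *)

Hypothesis AC : forall x, O x ->
  nkJ (u x) @` tangent_plane u x = tangent_plane u x.

Lemma hrot_tangent x v : O x -> exists w, om w x = hrot (om v x).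
Proof.
move=> Ox.
have : (nkJ (u x) @` tangent_plane u x) (nkJ (u x) ('D_v u x)).
  by exists ('D_v u x) => //; exists v.
rewrite AC // => -[w _]; have [x1 x2] := uN Ox.
rewrite !pdvE !(pdv_immersion) // nkJ_hmul; [|by rewrite x1 oner_neq0|by rewrite x2 oner_neq0].
move=> /(hmul_inj (uN Ox)) e.
exists (2^-1 *: (v + Num.sqrt 3 *: w)).
by rewrite hrot_J0 omZ // omD // omZ // e.
Qed.

(** An almost complex tangent plane is spanned by any nonzero vector and its
    image under [hrot]. *)
Lemma tangent_span x v : O x -> v != 0 ->
  forall z, exists l m, om z x = l *: om v x + m *: hrot (om v x).
Proof.
move=> Ox v0 z; have [w ew] := hrot_tangent v Ox.
have ind k : w != k *: v.
  apply/eqP => e; case/eqP: v0; apply: (om_eq0 Ox).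
  by apply: (@hrot_no_eigen _ _ k); rewrite -ew e omZ.
have [l [m ->]] := rV2_span v0 ind z.
by exists l, m; rewrite omD // !omZ // ew.
Qed.

Lemma e0_neq0 : e0 != 0.
Proof.
apply/eqP => /(congr1 (fun w : 'rV[R]_2 => w 0 0)); rewrite !mxE /= => /eqP.
by rewrite oner_eq0.
Qed.

(** * The flat case *)

Section Flat.
Hypothesis flatO : forall x v, O x -> flat (om v x).

Lemma om_fst_neq0 x : O x -> exists v, (om v x).1 != 0.
Proof.
move=> Ox; pose e0 : 'rV[R]_2 := delta_mx 0 0.
have [h|h] := eqVneq (om e0 x).1 0; last by exists e0.
have [w ew] := hrot_tangent e0 Ox.
exists w; rewrite ew /hrot /=; apply/eqP => h2.
have : e0 = 0 by apply: (om_eq0 Ox); exact: pair_ext.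
move/(congr1 (fun w : 'rV[R]_2 => w 0 0)); rewrite !mxE /= => /eqP.
by rewrite oner_eq0.
Qed.

Section Direction.
Variables (v : 'rV[R]_2) (B : set 'rV[R]_2).
Hypothesis oB : open B.
Hypothesis BO : B `<=` O.
Hypothesis nB : forall x, B x -> (om v x).1 != 0.
Local Notation a := (fun x => (om v x).1).

Lemma v_neq0 x : B x -> v != 0.
Proof.
move=> Bx; apply: contraNneq (nB Bx) => ->.
by rewrite (om0 (BO Bx)).
Qed.

Lemma a_imag x : B x -> (a x) 0 0 = 0.
Proof. by move=> /BO Ox; have [] := om_imag v Ox. Qed.

Lemma om_v x : B x -> exists c, om v x = (a x, c *: a x).
Proof.
move=> Bx; have [i1 i2] := om_imag v (BO Bx).
have e := qcross_eq0_proportional i1 i2 (nB Bx) (flatO v (BO Bx)).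
by exists (qdot (a x) (om v x).2 / qdot (a x) (a x)); apply: pair_ext.
Qed.

Lemma om_line x t : B x -> exists l m, om t x = (l *: a x, m *: a x).
Proof.
move=> Bx; have [c ec] := om_v Bx.
have [l [m ->]] := tangent_span (BO Bx) (v_neq0 Bx) t.
exists (l + m * c), (l * c + m * (c - 1)); rewrite {1 2}ec /hrot.
by apply: pair_ext; rewrite /= ?HHE /=; quat_ring.
Qed.

(** The tangent plane is two-dimensional, hence all of (R a, R a). *)
Lemma om_full x : B x ->
  (exists t k, k != 0 /\ om t x = (k *: a x, 0)) /\
  (exists t k, k != 0 /\ om t x = (0, k *: a x)).
Proof.
move=> Bx; have [c ec] := om_v Bx; have Ox := BO Bx.
have [w ew] := hrot_tangent v Ox.
rewrite ec /hrot /= in ew.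
have k0 : c ^+ 2 - c + 1 != 0.
  rewrite gt_eqF //; have := sqr_ge0 (c - 2^-1); rewrite !expr2; lra.
set A := (om v x).1 in ec ew *.
split.
  exists (c *: w - (c - 1) *: v), (c ^+ 2 - c + 1); split=> //.
  rewrite omB // !omZ // ew ec.
  by apply: pair_ext; rewrite /= ?HHE /=; quat_ring.
exists (c *: v - w), (c ^+ 2 - c + 1); split=> //.
rewrite omB // omZ // ew ec.
by apply: pair_ext; rewrite /= ?HHE /=; quat_ring.
Qed.

(** The values of [om] are in (R a, R a), so the structure equation makes the
    derivative of om t along s symmetric in s and t.  Differentiating om t x
    a = 0 shows that om t x (derivative of a along s) is symmetric too.
    Evaluated on the tangent vectors v and [hrot] v, this symmetry gives a x
    da = 0. *)
Lemma direction_derivative x t : B x -> qcross (a x) (pdv t (om v) x).1 = 0.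
Proof.
move=> Bx; have Ox := BO Bx.
pose A2 y := dup (om v y).
have dA : differentiable A2 x by have [] := comp_clinear dup_cl (om_diff v Ox).
have line0 s y : B y -> hcross (om s y) (A2 y) = 0.
  move=> By; have [l [m ->]] := om_line s By; rewrite /A2 /dup /hcross /=.
  by apply: pair_ext; rewrite /=; quat_ring.
have struct0 s s' : pdv s (om s') x = pdv s' (om s) x.
  apply/eqP; rewrite -subr_eq0 structure_eq //.
  have [l [m ->]] := om_line s Bx; have [l' [m' ->]] := om_line s' Bx.
  rewrite (_ : hcross _ _ = 0) ?scaler0 //.
  by apply: pair_ext; rewrite /=; quat_ring.
have diff0 s s' :
      hcross (pdv s (om s') x) (A2 x) + hcross (om s' x) (dup (pdv s (om v) x)) = 0.
  rewrite -(pdv_lin s dup_cl (om_diff v Ox)).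
  rewrite -(pdv_bilin s (@hcross_cb R) (om_diff s' Ox) dA).
  rewrite (@near_pdv _ _ _ s _ (fun=> 0)) ?pdv_cst //.
  have : nbhs x B by exact: open_nbhs_nbhs.
  by apply: filterS => y By; exact: line0.
have sym0 s s' : hcross (om s' x) (dup (pdv s (om v) x)) =
                 hcross (om s x) (dup (pdv s' (om v) x)).
  have := diff0 s s'; rewrite (struct0 s s') => /eqP; rewrite addrC addr_eq0 => /eqP ->.
  by have := diff0 s' s => /eqP; rewrite addr_eq0 => /eqP ->; rewrite opprK.
have [c ec] := om_v Bx.
have [w ew] := hrot_tangent v Ox; rewrite ec /hrot /= in ew.
pose d s := qcross (a x) (pdv s (om v) x).1.
have k0 : c ^+ 2 - c + 1 != 0.
  rewrite gt_eqF //; have := sqr_ge0 (c - 2^-1); rewrite !expr2; lra.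
have sym1 s l m : om s x = (l *: a x, m *: a x) ->
    d s = l *: d v /\ c *: d s = m *: d v.
  move=> es; have := sym0 s v; rewrite es {1}ec /hcross /dup /=.
  by rewrite !qcrossZl => -[h1 h2]; split.
have dv : d v = 0.
  have [|e1 e2] := sym1 w c (c - 1).
    by rewrite ew; apply: pair_ext; rewrite //=; quat_ring.
  have : (c ^+ 2 - c + 1) *: d v = 0.
    transitivity (c *: (c *: d v) - (c - 1) *: d v); first by quat_ring.
    by rewrite -e1 e2 subrr.
  by move=> /eqP; rewrite scaler_eq0 (negPf k0) => /eqP.
have [l [m es]] := om_line t Bx.
by have [e _] := sym1 t l m es; rewrite -/(d t) e dv scaler0.
Qed.

Lemma a_diff x : B x -> differentiable a x.
Proof. by move=> /BO Ox; have [] := comp_clinear fst_cl (om_diff v Ox). Qed.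

(** The quotient |a x a0|^2 / |a|^2, where a0 = a x0, has derivative 0
    because da is proportional to a, and it vanishes at x0. *)
Lemma direction_constant x x0 : B x0 -> B x ->
  (forall t : R, 0 <= t <= 1 -> B (x0 + t *: (x - x0))) ->
  qcross (a x) (a x0) = 0.
Proof.
move=> B0 Bx seg.
pose z y := qcross (a y) (a x0).
pose f y := qdot (z y) (z y) / qdot (a y) (a y).
have aa y : B y -> qdot (a y) (a y) != 0.
  by move=> By; apply: contra_neq (nB By); exact: qdot_eq0.
have dz y : B y -> differentiable z y.
  move=> By; have [] := cbilinear_diff qcross_cb (a_diff By) (differentiable_cst (a x0) y).
  by [].
have dzz y : B y -> differentiable (fun y => qdot (z y) (z y) : R) y.
  by move=> By; have [] := cbilinear_diff (@qdot_cb R) (dz y By) (dz y By).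
have daa y : B y -> differentiable (fun y => qdot (a y) (a y) : R) y.
  by move=> By; have [] := cbilinear_diff (@qdot_cb R) (a_diff By) (a_diff By).
have dv y : B y -> differentiable (fun y => (qdot (a y) (a y))^-1 : R) y.
  by move=> By; apply: differentiableV; [exact: daa|exact: aa].
have df y : B y -> differentiable f y.
  by move=> By; apply: differentiableM; [exact: dzz|exact: dv].
have Df y t : B y -> 'D_t f y = 0.
  move=> By.
  have Da : pdv t a y = (pdv t (om v) y).1.
    exact: (pdv_lin t fst_cl (om_diff v (BO By))).
  have ida : (pdv t a y) 0 0 = 0.
    have cl := @HH_coord_cl R fst 0 (fun k a b => erefl).
    rewrite Da -(pdv_lin t cl (om_diff v (BO By))).
    rewrite (@near_pdv _ _ _ t _ (fun=> 0)) ?pdv_cst //.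
    have : nbhs y B by exact: open_nbhs_nbhs.
    by apply: filterS => y' By'; exact: a_imag.
  have := direction_derivative t By; rewrite -Da.
  move=> /(qcross_eq0_proportional (a_imag By) ida (nB By)).
  set rho := _ / _ => eDa.
  have Dz : pdv t z y = rho *: z y.
    rewrite (pdv_bilin t qcross_cb (a_diff By) (differentiable_cst (a x0) y)).
    by rewrite pdv_cst eDa /z; quat_ring.
  have Dzz : pdv t (fun y => qdot (z y) (z y)) y = 2 * rho * qdot (z y) (z y).
    rewrite (pdv_bilin t (@qdot_cb R) (dz y By) (dz y By)) Dz qdotZl qdotZr; ring.
  have Daa : pdv t (fun y => qdot (a y) (a y)) y = 2 * rho * qdot (a y) (a y).
    rewrite (pdv_bilin t (@qdot_cb R) (a_diff By) (a_diff By)) eDa qdotZl qdotZr; ring.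
  have Dv : pdv t (fun y => (qdot (a y) (a y))^-1) y = - (2 * rho) / qdot (a y) (a y).
    rewrite -pdvE deriveV; [|exact: aa|exact: diff_derivable (daa y By)].
    rewrite pdvE Daa -[_ *: _]/(_ * _); have := aa y By => n; field.
    exact: n.
  rewrite pdvE -[pdv t f y]/(pdv t (fun y => qdot (z y) (z y) *: (qdot (a y) (a y))^-1) y).
  rewrite (pdv_bilin t (scale_cbilinear _) (dzz y By) (dv y By)) Dzz Dv.
  rewrite -[_ *: _ ^-1]/(_ * _) -[_ *: (_ / _)]/(_ * _).
  by have := aa y By => n; field.
have := segment_cst seg df Df.
have z0 : z x0 = 0 by rewrite /z; quat_ring.
rewrite /f z0 (_ : qdot 0 0 = 0); last by rewrite qdotE !quatE; ring.
rewrite mul0r => /esym /eqP; rewrite mulf_eq0 invr_eq0 (negPf (aa x Bx)) orbF.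
by move=> /eqP /qdot_eq0.
Qed.
End Direction.

(** The isometry sends u x0 to (1,1) and the constant direction a to a
    multiple of i, so that the image stays in the unit circles of R + R i. *)
Lemma torus_piece x0 : O x0 ->
  exists B, [/\ open B, B `<=` O, B x0 & exists a b c : 'H[R],
    [/\ unit_quat a, unit_quat b, unit_quat c & exists W : set (R * R), open W /\
      (nk_isometry a b c \o u) @` B = @flat_torus R @` ([set: R * R] `&` W)]].
Proof.
move=> Ox0.
have [v v0] := om_fst_neq0 Ox0.
pose a x := (om v x).1.
have da x : O x -> differentiable a x.
  by move=> Ox; have [] := comp_clinear fst_cl (om_diff v Ox).
have naa : qdot (a x0) (a x0) != 0 by apply: contra_neq v0; exact: qdot_eq0.
have nn : \forall x \near x0, O x /\ qdot (a x) (a x) != 0.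
  apply: filterI; first exact: open_nbhs_nbhs.
  have [d _] := cbilinear_diff (@qdot_cb R) (da _ Ox0) (da _ Ox0).
  exact: cvgr_neq0 (differentiable_continuous d) naa.
have [r /= r0 rB] := (nbhs_ballP _ _).1 nn.
pose B := ball x0 r.
have oB : open B by exact: ball_open.
have BO : B `<=` O by move=> x /rB [].
have nB x : B x -> (om v x).1 != 0.
  move=> /rB [_]; apply: contra_neq => e; rewrite /a e.
  by rewrite qdotE !quatE; ring.
have B0 : B x0 by exact: ballxx.
exists B; split=> //.
have [c [k [uc ck]]] := conj_to_i (a_imag v BO B0).
have [u1 u2] := uN Ox0.
(* K is chosen such that the isometry sends u x0 to (1, 1). *)
pose K : 'HH[R] := (qmul c (qconj (u x0).1), qmul c (qconj (u x0).2)).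
have KN : S3xS3 K by split; apply: unit_qmul => //; exact: unit_qconj.
exists K.1, K.2, c; split=> //; try by case: KN.
pose Phi x := iso_lin K c (u x).
have -> : (nk_isometry K.1 K.2 c \o u) @` B = Phi @` B.
  congr (_ @` B); apply/funext => x /=; rewrite nk_isometryE //.
have uniq_line x : B x -> exists2 rho, rho != 0 & a x = rho *: a x0.
  move=> Bx; have par : qcross (a x) (a x0) = 0.
    apply: (direction_constant oB BO nB B0 Bx) => t.
    exact: ball_segment.
  have := qcross_eq0_proportional (a_imag v BO Bx) (a_imag v BO B0) (nB x Bx) par.
  set rho := _ / _ => e; have rn : rho != 0.
    by apply: contra_neq v0 => r_0; rewrite e r_0 scale0r.
  exists rho^-1; first by rewrite invr_neq0.
  by rewrite /a e scalerA mulVf // scale1r.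
have kn : k != 0.
  apply: contra_neq v0 => k0; rewrite k0 scale0r in ck.
  have e : iso_lin ((c, c) : 'HH[R]) c (a x0, a x0) = 0 by apply: pair_ext.
  have := iso_lin_inj (conj uc uc : S3xS3 ((c, c) : 'HH[R])) uc e.
  by move=> /(congr1 fst).
have conj_a x l : B x -> exists2 rho, rho != 0 &
    qmul (qmul c (l *: a x)) (qconj c) = (l * rho) *: qi.
  move=> Bx; have [rho rn ->] := uniq_line x Bx.
  exists (rho * k); first by rewrite mulf_neq0.
  by rewrite !qmulZr !qmulZl /a ck !scalerA mulrA.
have dPhi x : B x -> differentiable Phi x.
  by move=> Bx; have [] := comp_clinear (iso_lin_cl K c) (smooth_diff su (BO x Bx)).
have DPhi x t : B x -> pdv t Phi x =
    hmul (Phi x) (qmul (qmul c (om t x).1) (qconj c), qmul (qmul c (om t x).2) (qconj c)).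
  move=> Bx; rewrite (pdv_lin t (iso_lin_cl K c) (smooth_diff su (BO x Bx))).
  by rewrite (pdv_immersion _ (BO x Bx)) iso_lin_hmul.
have PhiN x : B x -> S3xS3 (Phi x).
  by move=> Bx; apply: iso_lin_unit => //; exact: uN (BO x Bx).
have conj0 : qmul (qmul c 0) (qconj c) = 0 by quat_ring.
have Phi_circle x : B x ->
   [/\ (Phi x).1 0 2 = 0, (Phi x).1 0 3 = 0, (Phi x).2 0 2 = 0 & (Phi x).2 0 3 = 0].
  move=> Bx.
  (* The quadratic form b2 measures the components along j and k; it is
     constant because right multiplication by i preserves it. *)
  pose b2 (p q : 'HH[R]) : R := p.1 0 2 * q.1 0 2 + p.1 0 3 * q.1 0 3
     + (p.2 0 2 * q.2 0 2 + p.2 0 3 * q.2 0 3).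
  have b2_cb : cbilinear b2.
    by apply: cbilinear_HH => [y|z] s p q; rewrite /b2 !HHE !quatE -[s *: _]/(s * _); ring.
  have b2D y : B y -> differentiable (fun y => b2 (Phi y) (Phi y) : R) y.
    by move=> By; have [] := cbilinear_diff b2_cb (dPhi y By) (dPhi y By).
  have b2D0 y t : B y -> 'D_t (fun y => b2 (Phi y) (Phi y) : R) y = 0.
    move=> By; rewrite pdvE (pdv_bilin t b2_cb (dPhi y By) (dPhi y By)) DPhi //.
    move: (Phi y) => F.
    have [l [m ->]] := om_line BO nB t By.
    have [rho _ e1] := conj_a y l By; have [rho' _ e2] := conj_a y m By.
    rewrite -/(a y) /= e1 e2 /b2 /hmul /=; move: (l * rho) (m * rho') => L M.
    by rewrite /qmul /qi !quatE; ring.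
  have := segment_cst (fun t => @ball_segment _ _ x0 x r t Bx) b2D b2D0.
  have cc : qmul c (qconj c) = qone by rewrite qmulqV uc scale1r.
  have -> : Phi x0 = (qone, qone).
    by apply: pair_ext; rewrite /Phi /K /iso_lin /= -(qmulA c) qmulVq ?u1 ?u2 scale1r qmulq1.
  have -> : b2 (qone, qone) (qone, qone) = 0 by rewrite /b2 /qone /= !quatE; ring.
  rewrite /b2 -!expr2.
  have := (sqr_ge0 ((Phi x).1 0 2), sqr_ge0 ((Phi x).1 0 3),
           sqr_ge0 ((Phi x).2 0 2), sqr_ge0 ((Phi x).2 0 3)).
  move=> [[[h1 h2] h3] h4] e.
  by split; apply/eqP; rewrite -sqrf_eq0; apply/eqP; lra.
apply: open_piece; first exact: flat_torus_continuous.
  move=> _ [x Bx <-].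
  move: (PhiN x Bx) (Phi_circle x Bx); move: (Phi x) => F [p1 p2] [z1 z2 z3 z4].
  rewrite /unit_quat /= qdotE ?z1 ?z2 ?z3 ?z4 in p1.
  rewrite /unit_quat /= qdotE ?z1 ?z2 ?z3 ?z4 in p2.
  have [|s [cs ss]] := @unit_angle R (F.1 0 0) (F.1 0 1).
    by move: p1; rewrite !expr2; lra.
  have [|s' [cs' ss']] := @unit_angle R (F.2 0 0) (F.2 0 1).
    by move: p2; rewrite !expr2; lra.
  exists (s, s') => //; rewrite /flat_torus /= -cs -ss -cs' -ss'.
  by apply: pair_ext; apply: quat_ext; rewrite /= !quatE // ?z1 ?z2 ?z3 ?z4.
move=> _ [x Bx <-].
have inj w : 'D_w Phi x = 0 -> w = 0.
  rewrite pdvE (pdv_lin w (iso_lin_cl K c) (smooth_diff su (BO x Bx))) -pdvE.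
  by move=> /(iso_lin_inj KN uc); exact: imm (BO x Bx) w.
have [d d0 hd] := nearest_point oB Bx dPhi inj ltr01.
exists d => // z _ /hd [y By [near0 orth]]; exists y => //.
have [[t1 [k1 [k1n e1]]] [t2 [k2 [k2n e2]]]] := om_full BO nB By.
have := orth t1; have := orth t2.
rewrite !DPhi // e1 e2.
move: (PhiN y By) (Phi_circle y By) near0 => {orth}; move: (Phi y) => F.
move=> [p1 p2] [z1 z2 z3 z4] near0; rewrite /= conj0.
have [rho1 r1 ->] := conj_a y k1 By; have [rho2 r2 ->] := conj_a y k2 By.
have := near0; rewrite /product_metric.
rewrite /flat_torus /hmul !HHE /= !qdotE /qmul /qi !quatE z1 z2 z3 z4.
rewrite /unit_quat /= qdotE ?z1 ?z2 ?z3 ?z4 in p1.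
rewrite /unit_quat /= qdotE ?z1 ?z2 ?z3 ?z4 in p2.
have := cos2Dsin2 z.1; have := cos2Dsin2 z.2.
set C1 := cos z.1; set S1 := sin z.1; set C2 := cos z.2; set S2 := sin z.2.
move=> cs2 cs1 nr o2 o1.
have w1 := mulf_neq0 k1n r1; have w2 := mulf_neq0 k2n r2.
(* Orthogonality to the two circle directions makes the angles agree
   modulo pi. *)
have g1 : F.1 0 0 * S1 = F.1 0 1 * C1.
  by apply: (mulfI w1); move: o1; lra.
have g2 : F.2 0 0 * S2 = F.2 0 1 * C2.
  by apply: (mulfI w2); move: o2; lra.
have n1 : F.1 0 0 ^+ 2 + F.1 0 1 ^+ 2 = 1 by move: p1; rewrite !expr2; lra.
have n2 : F.2 0 0 ^+ 2 + F.2 0 1 ^+ 2 = 1 by move: p2; rewrite !expr2; lra.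
have h1 := addr_ge0 (sqr_ge0 (F.1 0 0 - C1)) (sqr_ge0 (F.1 0 1 - S1)).
have h2 := addr_ge0 (sqr_ge0 (F.2 0 0 - C2)) (sqr_ge0 (F.2 0 1 - S2)).
have d1 : (F.1 0 0 - C1) ^+ 2 + (F.1 0 1 - S1) ^+ 2 < 1.
  by move: nr h2; rewrite !expr2; lra.
have d2 : (F.2 0 0 - C2) ^+ 2 + (F.2 0 1 - S2) ^+ 2 < 1.
  by move: nr h1; rewrite !expr2; lra.
have [e00 e01] := circle_close n1 cs1 g1 d1.
have [e10 e11] := circle_close n2 cs2 g2 d2.
by apply: pair_ext; apply: quat_ext; rewrite /= !quatE.
Qed.
End Flat.

(** * The equilateral case *)

Section Equilateral.
Hypothesis equi : forall x v, O x -> equilateral (om v x).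
Local Notation al := (fun t x => (om t x).1).
Local Notation be := (fun t x => (om t x).2).
Local Notation yv := (yvec u).

Lemma al_imag t x : O x -> (al t x) 0 0 = 0.
Proof. by move=> Ox; have [] := om_imag t Ox. Qed.
Lemma be_imag t x : O x -> (be t x) 0 0 = 0.
Proof. by move=> Ox; have [] := om_imag t Ox. Qed.

Lemma al_eq0 t x : O x -> al t x = 0 -> t = 0.
Proof.
move=> Ox a0; apply: (om_eq0 Ox); have [h1 h2] := equi t Ox.
apply: pair_ext => //=; apply: qdot_eq0; rewrite h2 -h1 a0.
by rewrite qdotE !quatE; ring.
Qed.

Lemma aa_neq0 x : O x -> qdot (al e0 x) (al e0 x) != 0.
Proof.
move=> Ox; have := e0_neq0; apply: contra_neq => /qdot_eq0.
exact: al_eq0.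
Qed.

Lemma equilateral_polar s t x : O x ->
  (qdot (al s x) (al t x) = qdot (al s x) (be t x) + qdot (al t x) (be s x)) /\
  (qdot (be s x) (be t x) = qdot (al s x) (be t x) + qdot (al t x) (be s x)).
Proof.
move=> Ox; have := equi (s + t) Ox; rewrite omD // /equilateral !HHE.
have [s1 s2] := equi s Ox; have [t1 t2] := equi t Ox.
rewrite !(qdotDl, qdotDr) s1 s2 t1 t2.
rewrite (qdotC (om t x).1 (om s x).1) (qdotC (om t x).2 (om s x).2).
by move=> [h1 h2]; split; lra.
Qed.

Lemma yv_imag x : (yv x) 0 0 = 0.
Proof. by rewrite yvec.unlock rVZ quatE mulr0. Qed.

(** The last two equations say that y x _ acts on the tangent plane as a
    multiple of J0, and they determine y. *)
Lemma yv_om t x : O x ->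
  [/\ qdot (yv x) (al t x) = 0, qdot (yv x) (be t x) = 0,
    qcross (yv x) (al t x) = 2 *: be t x - al t x &
    qcross (yv x) (be t x) = be t x - 2 *: al t x].
Proof.
move=> Ox; have [l [m ->]] := tangent_span Ox e0_neq0 t.
have [h1 h2] := equi e0 Ox; have ia := al_imag e0 Ox; have ib := be_imag e0 Ox.
have aan := aa_neq0 Ox.
rewrite yvec.unlock /hrot !HHE /=; move: (om e0 x) h1 h2 ia ib aan => [A C] /= h1 h2 ia ib aan.
have ya : qdot (qcross A C) A = 0 by rewrite !qdotE /qcross !quatE; ring.
have yc : qdot (qcross A C) C = 0 by rewrite !qdotE /qcross !quatE; ring.
have ca : qcross (qcross A C) A = qdot A A *: C - qdot A C *: A.
  rewrite qcrossC qcross_cross // opprB //.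
have cc : qcross (qcross A C) C = qdot A C *: C - qdot C C *: A.
  by rewrite qcrossC qcross_cross // opprB (qdotC C A).
rewrite !(qdotDr, qdotZl, qdotZr, qdotNr) ya yc.
have e1 : 2 / qdot A A * qdot A A = 2 by rewrite divfK.
have e2 : 2 / qdot A A * qdot A C = 1.
  by move: aan; rewrite h1 => n; field; move: n; rewrite mulf_eq0 negb_or => /andP[].
have e3 : 2 / qdot A A * qdot C C = 2 by rewrite h2 -h1.
split; [ring|ring| |].
- rewrite qcrossDr !qcrossZr !qcrossZl ca cc.
  rewrite !scalerBr ![(_ / _) *: (_ *: _)]scalerA e1 e2 e3.
  by quat_ring.
- rewrite qcrossDr !qcrossZr qcrossDr qcrossNr !qcrossZl ca cc.
  rewrite !scalerBr ![(_ / _) *: (_ *: _)]scalerA e1 e2 e3.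
  by quat_ring.
Qed.

Lemma yv_norm x : O x -> qdot (yv x) (yv x) = 3.
Proof.
move=> Ox; have [h1 h2] := equi e0 Ox; have aan := aa_neq0 Ox.
rewrite yvec.unlock qdotZl qdotZr cross_norm; last by split; [exact: al_imag|exact: be_imag].
rewrite h2 h1 in aan *; move: aan; rewrite mulf_eq0 negb_or => /andP[_ n].
by field.
Qed.

Lemma yv_diff x : O x -> differentiable yv x.
Proof.
move=> Ox.
have da : differentiable (fun x => al e0 x) x.
  by have [] := comp_clinear fst_cl (om_diff e0 Ox).
have db : differentiable (fun x => be e0 x) x.
  by have [] := comp_clinear snd_cl (om_diff e0 Ox).
have [dc _] := cbilinear_diff qcross_cb da db.
have [daa _] := cbilinear_diff (@qdot_cb R) da da.
have dv : differentiable (fun x => 2 * (qdot (al e0 x) (al e0 x))^-1 : R) x.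
  apply: differentiableM; first exact: differentiable_cst.
  by apply: differentiableV => //; exact: aa_neq0.
have -> : yv = fun x => (2 / qdot (al e0 x) (al e0 x)) *: qcross (al e0 x) (be e0 x).
  by apply/funext => y; rewrite yvec.unlock.
by have [] := cbilinear_diff (scale_cbilinear _) dv dc.
Qed.

(** The first component identifies the tangent plane with the plane
    orthogonal to y. *)
Lemma orth_yv x (b : 'H[R]) : O x -> b 0 0 = 0 -> qdot (yv x) b = 0 ->
  exists t, om t x = (b, 2^-1 *: (b + qcross (yv x) b)).
Proof.
move=> Ox ib yb; have [ya _ ca _] := yv_om e0 Ox.
have := orth_frame (yv_imag x) (al_imag e0 Ox) ib (yv_norm Ox) ya.
rewrite yb mulr0 scale0r add0r ca => e.
have [w ew] := hrot_tangent e0 Ox.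
have aan := aa_neq0 Ox.
have n3 : 3 * qdot (al e0 x) (al e0 x) != 0 by rewrite mulf_neq0 // pnatr_eq0.
pose N := 2 *: be e0 x - al e0 x.
pose t := (3 * qdot (al e0 x) (al e0 x))^-1 *:
   ((3 * qdot (al e0 x) b) *: e0 + qdot N b *: (2 *: w - e0)).
have et : al t x = b.
  apply: (scalerI n3).
  by rewrite e /t omZ // omD // !omZ // omB // omZ // ew /hrot
    !HHE /= scalerA divff // scale1r.
exists t; have [_ _ ct _] := yv_om t Ox.
by apply: pair_ext; rewrite //= -et ct addrC subrK scalerA mulVf ?scale1r ?pnatr_eq0.
Qed.

Lemma orth_all x (b : 'H[R]) : O x -> b 0 0 = 0 -> qdot (yv x) b = 0 ->
  (forall t, qdot b (al t x) = 0) -> b = 0.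
Proof.
move=> Ox ib yb h; have [t et] := orth_yv Ox ib yb.
by have := h t; rewrite et /= => /qdot_eq0.
Qed.

Section SphereParallel.
Hypothesis par_tan : forall t v w x, O x -> exists c v1 w1 v2 w2,
  cov t (sff v w) x = om c x + (sff v1 w1 x + sff v2 w2 x).

(** The defect in dy = 2(C - A), the equation of the model sphere. *)
Definition eps t x : 'H[R] := pdv t yv x - 2 *: (be t x - al t x).

Lemma al_diff t x : O x -> differentiable (al t) x.
Proof. by move=> Ox; have [] := comp_clinear fst_cl (om_diff t Ox). Qed.
Lemma be_diff t x : O x -> differentiable (be t) x.
Proof. by move=> Ox; have [] := comp_clinear snd_cl (om_diff t Ox). Qed.
Lemma pdv_al s t x : O x -> pdv s (al t) x = (pdv s (om t) x).1.
Proof. by move=> Ox; exact: (pdv_lin s fst_cl (om_diff t Ox)). Qed.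
Lemma pdv_be s t x : O x -> pdv s (be t) x = (pdv s (om t) x).2.
Proof. by move=> Ox; exact: (pdv_lin s snd_cl (om_diff t Ox)). Qed.

Lemma yv_cross0 (a b : 'H[R]) x : O x -> a 0 0 = 0 -> b 0 0 = 0 ->
  qdot (yv x) a = 0 -> qdot (yv x) b = 0 -> qcross (yv x) (qcross a b) = 0.
Proof.
move=> Ox ia ib ya yb; rewrite qcross_cross ?yv_imag // ya yb.
by rewrite !scale0r subr0.
Qed.

Lemma dyv_imag t x : O x -> (pdv t yv x) 0 0 = 0.
Proof.
move=> Ox; have cl : clinear (fun a : 'H[R] => a 0 0 : R).
  by apply: clinear_rV => k a b; rewrite !quatE.
rewrite -(pdv_lin t cl (yv_diff Ox)).
by rewrite (@near_pdvO _ _ (fun=> 0 : R)) ?pdv_cst // => y Oy; exact: yv_imag.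
Qed.

Lemma dyv_orth t x : O x -> qdot (yv x) (pdv t yv x) = 0.
Proof.
move=> Ox; have dy := yv_diff Ox.
have := pdv_bilin t (@qdot_cb R) dy dy.
rewrite (@near_pdvO _ _ (fun=> 3 : R)) ?pdv_cst //; last by move=> y; exact: yv_norm.
rewrite (qdotC (pdv t _ _)) => h; lra.
Qed.

(** [Gamma0] of two tangent vectors has both components on the axis y, as a
    cross product of vectors orthogonal to y. *)
Lemma Gamma0_yv s t x : O x ->
  let n := 2 * qdot (be s x) (al t x) - qdot (al s x) (al t x) in
  let k := qdot (al s x) (al t x) in
  let G := Gamma0 (om s x) (om t x) in
  [/\ qdot (yv x) G.1 = n - k, qdot (yv x) G.2 = n + k,
      qcross (yv x) G.1 = 0 & qcross (yv x) G.2 = 0].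
Proof.
move=> Ox n k G.
have [ys1 ys2 cs1 cs2] := yv_om s Ox; have [yt1 yt2 ct1 ct2] := yv_om t Ox.
have [p1 p2] := equilateral_polar s t Ox.
have is1 := al_imag s Ox; have is2 := be_imag s Ox.
have it1 := al_imag t Ox; have it2 := be_imag t Ox.
rewrite /G Gamma0.unlock /=.
rewrite !(qcrossDr, qcrossZr, qcrossNr) !yv_cross0 // !oppr0 !addr0 !scaler0 !oppr0 !addr0.
split=> //; by rewrite !(qdotDr, qdotNr, qdotZr) !qcross_triple cs1 cs2
   !(qdotDl, qdotNl, qdotZl) (qdotC (be s x) (al t x)) p2
  /n /k p1 (qdotC (be s x) (al t x)); field.
Qed.

(** From the derivatives of <y,A> = 0 and <y,C> = 0. *)
Lemma eps_om s t x : O x ->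
  qdot (eps s x) (al t x) = - qdot (yv x) (sff s t x).1 /\
  qdot (eps s x) (be t x) = - qdot (yv x) (sff s t x).2.
Proof.
move=> Ox; have [g1 g2 _ _] := Gamma0_yv s t Ox.
have [p1 p2] := equilateral_polar s t Ox.
have dy := yv_diff Ox.
have E1 := pdv_bilin s (@qdot_cb R) dy (al_diff t Ox).
have E2 := pdv_bilin s (@qdot_cb R) dy (be_diff t Ox).
rewrite (@near_pdvO _ _ (fun=> 0 : R)) ?pdv_cst // in E1; last first.
  by move=> y Oy; have [] := yv_om t Oy.
rewrite (@near_pdvO _ _ (fun=> 0 : R)) ?pdv_cst // in E2; last first.
  by move=> y Oy; have [] := yv_om t Oy.
rewrite pdv_al // in E1; rewrite pdv_be // in E2.
have D : pdv s (om t) x = nabla_om s t x - Gamma0 (om s x) (om t x) by rewrite addrK.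
have [yc1 yc2 _ _] := yv_om (chris s t x) Ox.
have lin1 (a b c : 'HH[R]) : qdot (yv x) (a + b - c).1 =
    qdot (yv x) a.1 + qdot (yv x) b.1 - qdot (yv x) c.1.
  by rewrite !HHE !(qdotDr, qdotNr).
have lin2 (a b c : 'HH[R]) : qdot (yv x) (a + b - c).2 =
    qdot (yv x) a.2 + qdot (yv x) b.2 - qdot (yv x) c.2.
  by rewrite !HHE !(qdotDr, qdotNr).
rewrite D nabla_omE lin1 yc1 g1 in E1; rewrite D nabla_omE lin2 yc2 g2 in E2.
rewrite /eps !(qdotDl, qdotNl, qdotZl).
rewrite (qdotC (be s x) (al t x)) in E1 E2 *.
split; lra.
Qed.

Lemma sff_imag s t x : O x -> himag (sff s t x).
Proof.
by move=> Ox; apply: himagB; [exact: (nabla_om_imag)|exact: (om_imag)].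
Qed.

(** Let (P,Q) be the cross product of y with a value of [sff].
    Differentiating y x A = 2C - A gives y x P = 2Q - P, so that (y x P, y x
    Q) is tangent by [orth_yv].  It is orthogonal to the value of [sff], and
    their inner product is a multiple of |P|^2 + |Q|^2 + |P - Q|^2. *)
Lemma sff_yv s t x : O x -> exists k1 k2, sff s t x = (k1 *: yv x, k2 *: yv x).
Proof.
move=> Ox; have [g1 g2 gc1 gc2] := Gamma0_yv s t Ox.
have dy := yv_diff Ox; have iy := yv_imag x; have yy := yv_norm Ox.
have E : qcross (pdv s yv x) (al t x) + qcross (yv x) (pdv s (al t) x) =
    2 *: pdv s (be t) x - pdv s (al t) x.
  rewrite -(pdv_bilin s qcross_cb dy (al_diff t Ox)).
  have Lcl : clinear (fun a : 'HH[R] => 2 *: a.2 - a.1).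
    by apply: clinear_HH => k a b; rewrite !HHE; quat_ring.
  rewrite pdv_be // pdv_al // -(pdv_lin s Lcl (om_diff t Ox)).
  by apply: near_pdvO => // y Oy; have [_ _ -> _] := yv_om t Oy.
have [ya _ _ _] := yv_om t Ox.
have {}E : qcross (yv x) (qcross (yv x) (pdv s (al t) x)) =
    qcross (yv x) (2 *: pdv s (be t) x - pdv s (al t) x).
  rewrite -E qcrossDr (qcross_cross iy (dyv_imag s Ox) (al_imag t Ox)).
  by rewrite ya dyv_orth // !scale0r subr0 add0r.
rewrite pdv_al // pdv_be // in E.
have D : pdv s (om t) x = nabla_om s t x - Gamma0 (om s x) (om t x) by rewrite addrK.
have [_ _ cc1 cc2] := yv_om (chris s t x) Ox.
have [i1 i2] := sff_imag s t Ox.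
have orth r : g0 (sff s t x) (om r x) = 0 by exact: (nproj_orth).
rewrite nabla_omE in D; move: (sff s t x) i1 i2 orth D => [n1 n2] /= i1 i2 orth D.
set P := qcross (yv x) n1; set Q := qcross (yv x) n2.
have PQ : qcross (yv x) P = 2 *: Q - P.
  move: E; rewrite D.
  have L1 (a b c : 'HH[R]) : qcross (yv x) (a + b - c).1 =
      qcross (yv x) a.1 + qcross (yv x) b.1 - qcross (yv x) c.1.
    by rewrite !HHE; quat_ring.
  have L2 (a b c : 'HH[R]) : qcross (yv x) (2 *: (a + b - c).2 - (a + b - c).1) =
      2 *: (qcross (yv x) a.2 + qcross (yv x) b.2 - qcross (yv x) c.2)
      - (qcross (yv x) a.1 + qcross (yv x) b.1 - qcross (yv x) c.1).
    by rewrite !HHE; quat_ring.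
  rewrite L1 L2 /= -/P -/Q.
  rewrite gc1 gc2 cc1 cc2 !subr0 qcrossDr qcrossDr qcrossNr qcrossZr cc1 cc2.
  move: (om _ x).1 (om _ x).2 (qcross _ P) => a b p /eqP; rewrite -subr_eq0 => /eqP e.
  apply/eqP; rewrite -subr_eq0; apply/eqP; rewrite -[RHS]e; quat_ring.
have yP : qdot (yv x) P = 0 by rewrite /P qcross_triple qcrossxx qdotE !quatE; ring.
have iP : P 0 0 = 0 by exact: qcross_re.
have iyP : (qcross (yv x) P) 0 0 = 0 by exact: qcross_re.
have yyP : qdot (yv x) (qcross (yv x) P) = 0.
  by rewrite qcross_triple qcrossxx qdotE !quatE; ring.
have [r er] := orth_yv Ox iyP yyP.
have := orth r.
have e2 : 2^-1 *: (qcross (yv x) P + qcross (yv x) (qcross (yv x) P)) = qcross (yv x) Q.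
  rewrite [in X in _ + X]PQ qcrossDr qcrossNr qcrossZr addrCA subrr addr0.
  by rewrite scalerA mulVf ?scale1r ?pnatr_eq0.
have tr (n a : 'H[R]) : qdot n (qcross (yv x) a) = - qdot (qcross (yv x) n) a.
  by rewrite qcross_triple (qcrossC n) qdotNl.
rewrite er e2 g0.unlock /= (tr n1 P) (tr n2 P) (tr n1 Q) (tr n2 Q) -/P -/Q => g.
have PQ0 : qdot P P + qdot Q Q + qdot (P - Q) (P - Q) = 0.
  rewrite !(qdotDl, qdotDr, qdotNl, qdotNr) (qdotC Q P) in g *; lra.
have := (qdot_ge0 P, qdot_ge0 Q, qdot_ge0 (P - Q)) => -[[h1 h2] h3].
have P0 : P = 0 by apply: qdot_eq0; lra.
have Q0 : Q = 0 by apply: qdot_eq0; lra.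
have yn : yv x != 0.
  by apply/eqP => y0; move: yy; rewrite y0 qdotE !quatE; lra.
exists (qdot (yv x) n1 / qdot (yv x) (yv x)),
       (qdot (yv x) n2 / qdot (yv x) (yv x)).
by apply: pair_ext; rewrite /=; apply: qcross_eq0_proportional.
Qed.

(** The cross product with y kills all values of [sff].  Applied to
    [parallel_tangent] it leaves a tangent vector, which satisfies the
    equations of [yv_om]. *)
Lemma parallel_relation t v w x k1 k2 : O x -> sff v w x = (k1 *: yv x, k2 *: yv x) ->
  (- 3 * k1) *: pdv t yv x - (2 * k2 - k1) *: qcross (yv x) (pdv t yv x)
  + (10 * k1 - 8 * k2) *: be t x - (2 * k2 + 2 * k1) *: al t x = 0.
Proof.
move=> Ox es; have dy := yv_diff Ox; have iy := yv_imag x; have yy := yv_norm Ox.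
have ds := sff_diff v w Ox.
have [ds1 _] := comp_clinear fst_cl ds; have [ds2 _] := comp_clinear snd_cl ds.
have z0 : qcross (yv x) 0 = 0 by quat_ring.
have cyy k : qcross (yv x) (k *: yv x) = 0 by rewrite qcrossZr qcrossxx scaler0.
have D1 : qcross (yv x) (pdv t (sff v w) x).1 = k1 *: qcross (yv x) (pdv t yv x).
  have B : pdv t (fun y => qcross (yv y) (sff v w y).1) x =
      qcross (pdv t yv x) (sff v w x).1 + qcross (yv x) (pdv t (sff v w) x).1.
    by rewrite -(pdv_lin t fst_cl ds); exact: (pdv_bilin t qcross_cb dy ds1).
  move: B.
  rewrite (@near_pdvO _ _ (fun=> 0 : 'H[R])) ?pdv_cst //; last first.
    by move=> y Oy; rewrite -[LHS]/(qcross (yv y) (sff v w y).1);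
      have [m1 [m2 ->]] := sff_yv v w Oy; rewrite /= qcrossZr qcrossxx scaler0.
  rewrite es /= qcrossZr (qcrossC (pdv t _ _)) scalerN => /eqP.
  by rewrite eq_sym addrC subr_eq0 => /eqP.
have D2 : qcross (yv x) (pdv t (sff v w) x).2 = k2 *: qcross (yv x) (pdv t yv x).
  have B : pdv t (fun y => qcross (yv y) (sff v w y).2) x =
      qcross (pdv t yv x) (sff v w x).2 + qcross (yv x) (pdv t (sff v w) x).2.
    by rewrite -(pdv_lin t snd_cl ds); exact: (pdv_bilin t qcross_cb dy ds2).
  move: B.
  rewrite (@near_pdvO _ _ (fun=> 0 : 'H[R])) ?pdv_cst //; last first.
    by move=> y Oy; rewrite -[LHS]/(qcross (yv y) (sff v w y).2);
      have [m1 [m2 ->]] := sff_yv v w Oy; rewrite /= qcrossZr qcrossxx scaler0.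
  rewrite es /= qcrossZr (qcrossC (pdv t _ _)) scalerN => /eqP.
  by rewrite eq_sym addrC subr_eq0 => /eqP.
have yydy : qcross (yv x) (qcross (yv x) (pdv t yv x)) = (- 3) *: pdv t yv x.
  by rewrite (qcross_cross iy iy (dyv_imag t Ox)) dyv_orth // yy scale0r sub0r scaleNr.
have [c [v1 [w1 [v2 [w2 e]]]]] := par_tan t v w Ox.
have [m1 [n1 e1]] := sff_yv v1 w1 Ox; have [m2 [n2 e2]] := sff_yv v2 w2 Ox.
have [_ _ cc1 cc2] := yv_om c Ox.
have rel : qcross (yv x) (qcross (yv x) (cov t (sff v w) x).1) =
    2 *: qcross (yv x) (cov t (sff v w) x).2 - qcross (yv x) (cov t (sff v w) x).1.
  have -> : qcross (yv x) (cov t (sff v w) x).1 = 2 *: (om c x).2 - (om c x).1.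
    by rewrite e e1 e2 !HHE /= qcrossDr qcrossDr !cyy !addr0.
  have -> : qcross (yv x) (cov t (sff v w) x).2 = (om c x).2 - 2 *: (om c x).1.
    by rewrite e e1 e2 !HHE /= qcrossDr qcrossDr !cyy !addr0.
  by rewrite qcrossDr qcrossNr qcrossZr cc1 cc2; quat_ring.
have [_ _ ca cb] := yv_om t Ox.
move: rel; rewrite /cov es Gamma0.unlock !HHE /=.
rewrite !(qcrossZr, qcrossZl) (qcrossC (al t x)) (qcrossC (be t x)) ca cb.
move: D1 D2; move: (pdv t (sff v w) x).1 (pdv t (sff v w) x).2 => p1 p2 D1 D2.
rewrite !qcrossDr D1 D2.
rewrite !(qcrossZr, qcrossNr, qcrossDr, ca, cb, yydy).
move: (al t x) (be t x) (pdv t yv x) (qcross _ _) => a b d yd /eqP.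
rewrite -subr_eq0 => /eqP rel; rewrite -[RHS]rel.
by apply: quat_ext; rewrite !quatE; field.
Qed.

(** [parallel_relation] for the directions e0 and [hrot] e0 is paired with
    tangent vectors and antisymmetrised.  By [eps_om] the derivative of y
    contributes values of [sff], which are symmetric and drop out; the
    equations that remain read k1 = 2 k2 and k2 = 0. *)
Lemma sff_eq0 v w x : O x -> sff v w x = 0.
Proof.
move=> Ox; have [k1 [k2 es]] := sff_yv v w Ox.
have rel t := parallel_relation t Ox es.
have [w' ew] := hrot_tangent e0 Ox.
have [h1 h2] := equi e0 Ox; have aan := aa_neq0 Ox.
have dyE t : pdv t yv x = eps t x + 2 *: (be t x - al t x) by rewrite subrK.
have Ya s t : qdot (qcross (yv x) (pdv t yv x)) (al s x) =
    - (2 * qdot (pdv t yv x) (be s x) - qdot (pdv t yv x) (al s x)).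
  have [_ _ ca _] := yv_om s Ox.
  rewrite (qcrossC (yv x)) qdotNl -qcross_triple ca.
  by rewrite !(qdotDr, qdotNr, qdotZr).
have Yb s t : qdot (qcross (yv x) (pdv t yv x)) (be s x) =
    - (qdot (pdv t yv x) (be s x) - 2 * qdot (pdv t yv x) (al s x)).
  have [_ _ _ cb] := yv_om s Ox.
  rewrite (qcrossC (yv x)) qdotNl -qcross_triple cb.
  by rewrite !(qdotDr, qdotNr, qdotZr).
have dota s t : qdot (pdv t yv x) (al s x) = - qdot (yv x) (sff t s x).1
    + 2 * (qdot (be t x) (al s x) - qdot (al t x) (al s x)).
  have [<- _] := eps_om t s Ox.
  by rewrite dyE !(qdotDl, qdotNl, qdotZl).
have dotb s t : qdot (pdv t yv x) (be s x) = - qdot (yv x) (sff t s x).2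
    + 2 * (qdot (be t x) (be s x) - qdot (al t x) (be s x)).
  have [_ <-] := eps_om t s Ox.
  by rewrite dyE !(qdotDl, qdotNl, qdotZl).
have qdot0 (b : 'H[R]) : qdot 0 b = 0 by rewrite qdotE !quatE; ring.
have Fa s t : (- 3 * k1) * qdot (pdv t yv x) (al s x)
   - (2 * k2 - k1) * qdot (qcross (yv x) (pdv t yv x)) (al s x)
   + (10 * k1 - 8 * k2) * qdot (be t x) (al s x)
   - (2 * k2 + 2 * k1) * qdot (al t x) (al s x) = 0.
  by rewrite -[RHS](qdot0 (al s x)) -(rel t) !(qdotDl, qdotNl, qdotZl).
have Fb s t : (- 3 * k1) * qdot (pdv t yv x) (be s x)
   - (2 * k2 - k1) * qdot (qcross (yv x) (pdv t yv x)) (be s x)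
   + (10 * k1 - 8 * k2) * qdot (be t x) (be s x)
   - (2 * k2 + 2 * k1) * qdot (al t x) (be s x) = 0.
  by rewrite -[RHS](qdot0 (be s x)) -(rel t) !(qdotDl, qdotNl, qdotZl).
have := (Fa w' e0, Fa e0 w', Fb w' e0, Fb e0 w').
rewrite !Ya !Yb !dota !dotb (sff_sym w' e0 Ox) ew /hrot /=.
rewrite !(qdotDl, qdotDr, qdotNl, qdotNr) (qdotC (be e0 x) (al e0 x)) h1 h2.
have p0 : qdot (al e0 x) (be e0 x) != 0.
  by move: aan; rewrite h1 mulf_eq0 negb_or => /andP[].
move: (qdot (al e0 x) (be e0 x)) p0 (qdot (yv x) _) (qdot (yv x) _) => p p0 s1 s2.
move=> [[[f1 f2] f3] f4].
have k12 : k1 = 2 * k2.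
  apply: (mulfI p0); move: f1 f2; lra.
have k20 : k2 = 0.
  apply: (mulfI p0); rewrite k12 in f3 f4; move: f3 f4; lra.
by rewrite es k12 k20 mulr0 scale0r.
Qed.

(** Without second fundamental form, [eps] is orthogonal to y and to all
    tangent vectors. *)
Lemma pdv_yv t x : O x -> pdv t yv x = 2 *: (be t x - al t x).
Proof.
move=> Ox; have [ya yb _ _] := yv_om t Ox.
suff : eps t x = 0 by move/eqP; rewrite subr_eq0 => /eqP.
apply: (orth_all Ox).
- have ia := al_imag t Ox; have ib := be_imag t Ox.
  by rewrite /eps !quatE ia ib dyv_imag // subrr mulr0 subrr.
- by rewrite /eps !(qdotDr, qdotNr, qdotZr) ya yb dyv_orth // subrr mulr0 subrr.
- move=> s; have [-> _] := eps_om t s Ox; rewrite sff_eq0 //.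
  by rewrite qdotE !quatE; ring.
Qed.

(** By [pdv_yv], u and Pm = ((1 - y)/2, (1 + y)/2) have the same
    Maurer-Cartan form, so u times the conjugate of Pm is a constant k. *)
Lemma sphere_piece x0 : O x0 ->
  exists B, [/\ open B, B `<=` O, B x0 & exists a b c : 'H[R],
    [/\ unit_quat a, unit_quat b, unit_quat c & exists W : set 'H[R], open W /\
      (nk_isometry a b c \o u) @` B =
      @round_sphere R @` (@imaginary_sphere R `&` W)]].
Proof.
move=> Ox0.
have nn : nbhs x0 O by exact: open_nbhs_nbhs.
have [r /= r0 rB] := (nbhs_ballP _ _).1 nn.
pose B := ball x0 r.
have oB : open B by exact: ball_open.
have BO : B `<=` O by [].
have B0 : B x0 by exact: ballxx.
exists B; split=> //.
have half2 (b : 'H[R]) : 2^-1 *: (2 *: b) = b.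
  by rewrite scalerA mulVf ?scale1r ?pnatr_eq0.
pose L (b : 'H[R]) : 'HH[R] := (- (2^-1 *: b), 2^-1 *: b).
have Lcl : clinear L.
  by apply: clinear_rV => k a b; apply: pair_ext; rewrite /= ?HHE /=; quat_ring.
pose Pm x : 'HH[R] := (2^-1 *: qone, 2^-1 *: qone) + L (yv x).
have dP x : B x -> differentiable Pm x.
  move=> Bx; apply: differentiableD; first exact: differentiable_cst.
  by have [] := comp_clinear Lcl (yv_diff (BO x Bx)).
have DP x t : B x -> pdv t Pm x = (- (be t x - al t x), be t x - al t x).
  move=> Bx; have dy := yv_diff (BO x Bx).
  have [dl _] := comp_clinear Lcl dy.
  rewrite (pdvD t (differentiable_cst _ _) dl) pdv_cst add0r.
  by rewrite (pdv_lin t Lcl dy) (pdv_yv t (BO x Bx)) /L /= !half2.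
have PN x : B x -> S3xS3 (Pm x).
  move=> Bx; have := yv_norm (BO x Bx); have := yv_imag x.
  rewrite /Pm; move: (yv x) => y iy; rewrite qdotE iy => yy.
  by split; rewrite /unit_quat /= ?HHE /L /= qdotE /qone !quatE iy; move: yy; lra.
pose kc x := hmul (u x) (hconj (Pm x)).
have dkc x : B x -> differentiable kc x.
  move=> Bx; have [dc _] := comp_clinear hconj_cl (dP x Bx).
  by have [] := cbilinear_diff hmul_cb (smooth_diff su (BO x Bx)) dc.
have Dkc x t : B x -> pdv t kc x = 0.
  move=> Bx; have Ox := BO x Bx; have [dc _] := comp_clinear hconj_cl (dP x Bx).
  rewrite (pdv_bilin t hmul_cb (smooth_diff su Ox) dc) (pdv_lin t hconj_cl (dP x Bx)).
  rewrite DP // (pdv_immersion t Ox) -hmulA -hmulDr.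
  have [ya yb ca cb] := yv_om t Ox.
  have ia := al_imag t Ox; have ib := be_imag t Ox; have iy := yv_imag x.
  have ay : qmul (al t x) (yv x) = al t x - 2 *: be t x.
    by rewrite qmul_imag // qcrossC ca qdotC ya scale0r subr0 opprB.
  have by_ : qmul (be t x) (yv x) = 2 *: al t x - be t x.
    by rewrite qmul_imag // qcrossC cb qdotC yb scale0r subr0 opprB.
  rewrite (_ : _ + _ = 0) ?hmulh0 //.
  apply: pair_ext; rewrite ?HHE /= /Pm ?HHE /=.
    have -> : qconj (2^-1 *: qone + - (2^-1 *: yv x)) = 2^-1 *: qone + 2^-1 *: yv x.
      by apply: quat_ext; rewrite /qconj /qone !quatE ?iy; ring.
    have -> : qconj (- ((om t x).2 - (om t x).1)) = (om t x).2 - (om t x).1.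
      by apply: quat_ext; rewrite /qconj !quatE ?ia ?ib; ring.
    rewrite qmulDr !qmulZr qmulq1 ay.
    by apply: quat_ext; rewrite !quatE; field.
  have -> : qconj (2^-1 *: qone + 2^-1 *: yv x) = 2^-1 *: qone - 2^-1 *: yv x.
    by apply: quat_ext; rewrite /qconj /qone !quatE ?iy; ring.
  have -> : qconj ((om t x).2 - (om t x).1) = - ((om t x).2 - (om t x).1).
    by apply: quat_ext; rewrite /qconj !quatE ?ia ?ib; ring.
  rewrite qmulDr qmulNr !qmulZr qmulq1 by_.
  by apply: quat_ext; rewrite !quatE; field.
pose k := kc x0.
have kE x : B x -> kc x = k.
  move=> Bx; symmetry; apply: (segment_cst_HH _ dkc) => [t|z t Bz]; last by rewrite pdvE Dkc.
  exact: ball_segment.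
have kN : S3xS3 k.
  have [p1 p2] := uN Ox0; have [q1 q2] := PN x0 B0.
  by split; apply: unit_qmul => //; exact: unit_qconj.
have uE x : B x -> hmul (hconj k) (u x) = Pm x.
  move=> Bx; rewrite -(kE x Bx) /kc.
  have -> : hconj (hmul (u x) (hconj (Pm x))) = hmul (Pm x) (hconj (u x)).
    by apply: pair_ext; rewrite /= qconjM qconjK.
  by rewrite -hmulA unit_hconj ?hmulh1 //; exact: uN (BO x Bx).
have u1 : unit_quat (qone : 'H[R]) by rewrite /unit_quat /= qdotE /qone !quatE; ring.
exists (qconj k.1), (qconj k.2), qone; split=> //;
  [by apply: unit_qconj; case: kN|by apply: unit_qconj; case: kN|].
have -> : (nk_isometry (qconj k.1) (qconj k.2) qone \o u) @` B = Pm @` B.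
  rewrite eqEsubset; split=> _ [x Bx <-]; exists x => //=.
    rewrite -(uE x Bx) nk_isometryE // /iso_lin.
    have -> : (qconj qone, qconj qone) = hone :> 'HH[R].
      by apply: pair_ext; rewrite /=; quat_ring.
    by rewrite hmulh1.
  rewrite -(uE x Bx) nk_isometryE // /iso_lin.
  have -> : (qconj qone, qconj qone) = hone :> 'HH[R].
    by apply: pair_ext; rewrite /=; quat_ring.
  by rewrite hmulh1.
have sn := @sqrt3_neq0 R; have s2 := @sqrt3_sq R.
have rsE (z : 'H[R]) : round_sphere z = (2^-1 *: qone, 2^-1 *: qone) + L (Num.sqrt 3 *: z).
  by apply: pair_ext; rewrite ?HHE /= -[quat 1 0 0 0]/qone scalerDr ?scalerN.
apply: open_piece; first exact: round_sphere_continuous.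
  move=> _ [x Bx <-]; exists ((Num.sqrt 3)^-1 *: yv x).
    split; first by rewrite rVZ yv_imag mulr0.
    by rewrite qdotZl qdotZr (yv_norm (BO x Bx)) mulrA -invfM -expr2 s2 mulVf ?pnatr_eq0.
  by rewrite rsE scalerA divff // scale1r.
move=> _ [x Bx <-].
have inj w : 'D_w Pm x = 0 -> w = 0.
  rewrite pdvE DP // => /(congr1 snd) /= /eqP; rewrite subr_eq0 => /eqP e.
  apply: (al_eq0 (BO x Bx)); have [h1 h2] := equi w (BO x Bx).
  by apply: qdot_eq0; move: h1; rewrite e; lra.
have [d d0 hd] := nearest_point oB Bx dP inj ltr01.
exists d => // z [iz zz] /hd [y By [near0 orth]]; exists y => //.
have Oy := BO y By; have iy := yv_imag y; have yy := yv_norm Oy.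
rewrite rsE in near0 orth *; rewrite /Pm; congr (_ + L _).
pose Z := Num.sqrt 3 *: z; rewrite -/Z in near0 orth *.
have iZ : Z 0 0 = 0 by rewrite rVZ iz mulr0.
have ZZ : qdot Z Z = 3 by rewrite qdotZl qdotZr zz mulr1 -expr2.
have dif : Pm y - ((2^-1 *: qone, 2^-1 *: qone) + L Z) = L (yv y - Z).
  by rewrite /Pm; apply: pair_ext; rewrite /L ?HHE /=; quat_ring.
rewrite dif in near0 orth.
have orth' t : qdot Z (be t y - al t y) = 0.
  have := orth t; rewrite DP // /product_metric /L /= !(qdotNl, qdotNr, qdotZl, qdotDl).
  have [ya yb _ _] := yv_om t Oy.
  rewrite opprK (qdotDr (be t y)) qdotNr ya yb; lra.
have [w ew] := hrot_tangent e0 Oy.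
have ZA : qdot Z (al e0 y) = 0.
  by have := orth' w; rewrite ew /hrot /= !(qdotDr, qdotNr); have := orth' e0;
    rewrite !(qdotDr, qdotNr); lra.
have ZC : qdot Z (be e0 y) = 0.
  by have := orth' e0; rewrite !(qdotDr, qdotNr) ZA; lra.
have [ya _ ca _] := yv_om e0 Oy.
have := orth_frame iy (al_imag e0 Oy) iZ yy ya.
rewrite ca !(qdotDl, qdotNl, qdotZl) (qdotC (al e0 y) Z) (qdotC (be e0 y) Z) ZA ZC.
rewrite !mulr0 subr0 !scale0r !addr0 => eZ.
have aan := aa_neq0 Oy.
(* Z is orthogonal to the tangent plane, hence on the axis y; being close to y
   it is not - y. *)
pose mu := qdot (yv y) Z / 3.
have Zmu : Z = mu *: yv y.
  apply: (@scalerI _ _ (3 * qdot (al e0 y) (al e0 y))); first by rewrite mulf_neq0 // pnatr_eq0.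
  by rewrite eZ scalerA /mu; congr (_ *: _); field.
have mu2 : mu * mu = 1.
  by move: ZZ; rewrite Zmu qdotZl qdotZr yy; lra.
have mu1 : 2 / 3 < mu.
  move: near0; rewrite Zmu /product_metric /L /=
    !(qdotNl, qdotNr, qdotZl, qdotZr, qdotDl, qdotDr) yy.
  by move: mu2; lra.
have mu_1 : mu = 1.
  have : (mu - 1) * (mu + 1) = 0 by rewrite mulrDr mulrBl mu2; ring.
  by move=> /eqP; rewrite mulf_eq0 => /orP[] /eqP; lra.
by rewrite Zmu mu_1 scale1r.
Qed.
End SphereParallel.
End Equilateral.
End Chart.

(** * From local to global *)

Section Near.
Context {R : realType}.

Lemma near_form_neq0 (w : 'rV[R]_2 -> 'HH[R]) (B : 'HH[R] -> 'HH[R] -> R) x :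
  cbilinear B -> differentiable w x -> B (w x) (w x) != 0 ->
  \forall y \near x, B (w y) (w y) != 0.
Proof.
move=> cB dw n; have [d _] := cbilinear_diff cB dw dw.
exact: cvgr_neq0 (differentiable_continuous d) n.
Qed.

Lemma near_not_equilateral (w : 'rV[R]_2 -> 'HH[R]) x : differentiable w x ->
  ~ equilateral (w x) -> \forall y \near x, ~ equilateral (w y).
Proof.
move=> dw.
pose B1 (a b : 'HH[R]) := qdot a.1 b.1 - 2 * qdot a.1 b.2.
pose B2 (a b : 'HH[R]) := qdot a.2 b.2 - 2 * qdot a.1 b.2.
have c1 : cbilinear B1.
  by apply: cbilinear_HH => [y|z] k a b; rewrite /B1 !HHE !(qdotDl, qdotDr, qdotZl, qdotZr)
    -[k *: _]/(k * _); ring.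
have c2 : cbilinear B2.
  by apply: cbilinear_HH => [y|z] k a b; rewrite /B2 !HHE !(qdotDl, qdotDr, qdotZl, qdotZr)
    -[k *: _]/(k * _); ring.
have eq0 a : equilateral a <-> B1 a a = 0 /\ B2 a a = 0.
  rewrite /equilateral /B1 /B2; split=> -[h1 h2]; split; lra.
move=> ne.
have [n1|n1] := eqVneq (B1 (w x) (w x)) 0; last first.
  apply: filterS (near_form_neq0 c1 dw n1) => y ny /eq0 [e _].
  by rewrite e eqxx in ny.
have [n2|n2] := eqVneq (B2 (w x) (w x)) 0; first by case: ne; apply/eq0.
apply: filterS (near_form_neq0 c2 dw n2) => y ny /eq0 [_ e].
by rewrite e eqxx in ny.
Qed.

Lemma near_not_flat (w : 'rV[R]_2 -> 'HH[R]) x : differentiable w x ->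
  ~ flat (w x) -> \forall y \near x, ~ flat (w y).
Proof.
move=> dw nf.
have [d1 _] := comp_clinear (@fst_cl R) dw.
have [d2 _] := comp_clinear snd_cl dw.
have [dc _] := cbilinear_diff (@qcross_cb R) d1 d2.
have n : qcross (w x).1 (w x).2 != 0 by apply/eqP.
have h : \forall y \near x, qcross (w y).1 (w y).2 != 0.
  exact: cvgr_neq0 (differentiable_continuous dc) n.
by apply: filterS h => y /eqP.
Qed.
End Near.

Section LocalToGlobal.
Context {R : realType} {M : topologicalType}.
Variables (A : surface_structure R M) (F : M -> 'HH[R]).
Variables (GammaN : 'HH[R] -> 'HH[R] -> 'HH[R] -> 'HH[R])
  (GammaM : chart_index A -> 'rV[R]_2 -> 'rV[R]_2 -> 'rV[R]_2 -> 'rV[R]_2).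
Hypothesis F_immersion : is_immersion A F.
Hypothesis F_almost_complex : almost_complex A F.
Hypothesis GammaN_LC : is_levi_civita_S3xS3 GammaN.
Hypothesis GammaM_LC : is_levi_civita_surface F GammaM.
Hypothesis h_parallel : parallel_second_fundamental_form F GammaN GammaM.
Implicit Types (i j : chart_index A) (m : M).
Local Notation O i := (@chart_img _ _ A i).
Local Notation u i := (@local_rep _ _ A F i).
Local Notation e0 := (delta_mx 0 0 : 'rV[R]_2).

Lemma chart_S3xS3 i x : O i x -> S3xS3 (u i x).
Proof. by have [h _ _] := F_immersion => _; exact: h. Qed.
Lemma chart_smooth i : smooth (O i) (u i).
Proof. by have [_ h _] := F_immersion; exact: h. Qed.
Lemma chart_immersed i x : O i x -> forall v, 'D_v (u i) x = 0 -> v = 0.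
Proof. by have [_ _ h] := F_immersion; exact: h. Qed.
Lemma chart_open i : open (O i). Proof. exact: chart_img_open. Qed.
Lemma chart_complex i x : O i x -> nkJ (u i x) @` tangent_plane (u i) x = tangent_plane (u i) x.
Proof. exact: F_almost_complex. Qed.

Lemma flat_all i x : O i x -> flat (om (u i) e0 x) -> forall v, flat (om (u i) v x).
Proof.
move=> Ox f v.
have [l [k ->]] := tangent_span (@chart_S3xS3 i) (@chart_smooth i)
  (@chart_immersed i) (@chart_complex i) Ox e0_neq0 v.
exact: flat_comb.
Qed.

Lemma equilateral_all i x : O i x -> equilateral (om (u i) e0 x) ->
  forall v, equilateral (om (u i) v x).
Proof.
move=> Ox f v.
have [l [k ->]] := tangent_span (@chart_S3xS3 i) (@chart_smooth i)
  (@chart_immersed i) (@chart_complex i) Ox e0_neq0 v.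
exact: equilateral_comb.
Qed.

Lemma dichotomy i x : O i x -> flat (om (u i) e0 x) \/ equilateral (om (u i) e0 x).
Proof.
move=> Ox.
have [w ew] := hrot_tangent (@chart_S3xS3 i) (@chart_smooth i) (@chart_complex i) e0 Ox.
have [c ec] := curvature_tangent (@chart_open i) (@chart_S3xS3 i)
  (@chart_smooth i) (@chart_immersed i) GammaN_LC (GammaM_LC i) (@h_parallel i) e0 w e0 Ox.
have [l [k e]] := tangent_span (@chart_S3xS3 i) (@chart_smooth i)
  (@chart_immersed i) (@chart_complex i) Ox e0_neq0 c.
rewrite ew e in ec.
exact: dichotomy_alg (om_imag (@chart_open i) (@chart_S3xS3 i) (@chart_smooth i) e0 Ox) ec.
Qed.

(** The chain rule for the change of charts: the Maurer-Cartan forms of both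
    local representations have the same values. *)
Lemma tangent_transfer i j m v : chart_dom i m -> chart_dom j m ->
  exists v', om (u j) v (chart j m) = om (u i) v' (chart i m).
Proof.
move=> im jm.
pose y := chart j m; pose phi := chart i \o param j.
have Oy : O j y by exact: chart_in.
have Ox : O i (chart i m) by exact: chart_in.
have pym : param j y = m by exact: chartK.
have phiy : phi y = chart i m by rewrite /phi /= pym.
have dphi : differentiable phi y.
  apply: (smooth_diff (@chart_transition _ _ A j i)); split=> //.
  by rewrite /= pym.
have du : differentiable (u i) (phi y) by rewrite phiy; exact: smooth_diff (@chart_smooth i) Ox.
exists (pdv v phi y).
have e : pdv v (u j) y = pdv (pdv v phi y) (u i) (chart i m).
  rewrite (@near_pdv _ _ _ v (u j) (u i \o phi)); last first.
    have n1 : \forall z \near y, O j z.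
      by apply: open_nbhs_nbhs; split=> //; exact: chart_open.
    have n2 : \forall z \near y, chart_dom i (param j z).
      apply: (@param_continuous _ _ A j y Oy); rewrite pym.
      by apply: open_nbhs_nbhs; split=> //; exact: chart_dom_open.
    by apply: filterS2 n1 n2 => z Oz iz; rewrite /local_rep /phi /= chartK.
  have dc : differentiable (u i \o phi) y by exact: differentiable_comp.
  rewrite -!pdvE deriveE // diff_comp //= deriveE // -phiy //.
  by rewrite deriveE.
rewrite !om.unlock -/y e; congr hmul.
by rewrite /local_rep /= pym chartK.
Qed.

Definition flat_set : set M :=
  [set m | exists2 i, chart_dom i m & flat (om (u i) e0 (chart i m))].
Definition equilateral_set : set M :=
  [set m | exists2 i, chart_dom i m & equilateral (om (u i) e0 (chart i m))].

Lemma flat_equilateral_disjoint m : flat_set m -> equilateral_set m -> False.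
Proof.
move=> [i im fi] [j jm ej].
have Ox : O i (chart i m) by exact: chart_in.
have Oy : O j (chart j m) by exact: chart_in.
have [v' ev] := tangent_transfer e0 im jm.
have iy := om_imag (@chart_open j) (@chart_S3xS3 j) (@chart_smooth j) e0 Oy.
have f : flat (om (u j) e0 (chart j m)) by rewrite ev; exact: flat_all.
have := om_eq0 (@chart_S3xS3 j) (@chart_immersed j) Oy (flat_equilateral iy f ej).
by move/eqP; rewrite (negPf e0_neq0).
Qed.

Lemma flat_or_equilateral m : flat_set m \/ equilateral_set m.
Proof.
have [i im] := @chart_cover _ _ A m.
have [h|h] := dichotomy (chart_in im); [left|right]; by exists i.
Qed.

Lemma near_chart i m (P : set 'rV[R]_2) : chart_dom i m ->
  (\forall x \near chart i m, P x) -> \forall m' \near m, chart_dom i m' /\ P (chart i m').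
Proof.
move=> im nP; apply: filterI.
  by apply: open_nbhs_nbhs; split=> //; exact: chart_dom_open.
exact: (@chart_continuous _ _ A i m im).
Qed.

(** The flat condition is the complement of the equilateral one, which is
    given by equations. *)
Lemma open_flat_set : open flat_set.
Proof.
rewrite openE => m fm; have [i im fi] := fm.
have Ox := chart_in im.
have ne : ~ equilateral (om (u i) e0 (chart i m)).
  by move=> e; apply: (flat_equilateral_disjoint fm); exists i.
have := near_not_equilateral (om_diff (@chart_open i) (@chart_smooth i) e0 Ox) ne.
move=> /(near_chart im); apply: filterS => m' [im' ne'].
by exists i => //; have [//|/ne'] := dichotomy (chart_in im').
Qed.

Lemma open_equilateral_set : open equilateral_set.
Proof.
rewrite openE => m em; have [i im ei] := em.
have Ox := chart_in im.
have nf : ~ flat (om (u i) e0 (chart i m)).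
  by move=> f; apply: (fun h => flat_equilateral_disjoint h em); exists i.
have := near_not_flat (om_diff (@chart_open i) (@chart_smooth i) e0 Ox) nf.
move=> /(near_chart im); apply: filterS => m' [im' nf'].
by exists i => //; have [/nf'|//] := dichotomy (chart_in im').
Qed.

Lemma piece_congruent (T : topologicalType) (D : set T) (f : T -> 'HH[R]) :
  (forall i x, O i x -> exists B, [/\ open B, B `<=` O i, B x &
     exists a b c : 'H[R], [/\ unit_quat a, unit_quat b, unit_quat c &
       exists W : set T, open W /\
         (nk_isometry a b c \o u i) @` B = f @` (D `&` W)]]) ->
  locally_congruent F D f.
Proof.
move=> h m; have [i im] := @chart_cover _ _ A m.
have [B [oB BO Bm [a [b [c [ua ub uc [W [oW e]]]]]]]] := h i _ (chart_in im).
exists [set m' | chart_dom i m' /\ B (chart i m')]; split=> //.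
  rewrite openE => m' [im' Bm']; apply: near_chart => //.
  exact: open_nbhs_nbhs.
exists a, b, c; split=> //; exists W; split=> //; rewrite -e.
apply/seteqP; split=> [_ [m' [im' Bm'] <-]|_ [x Bx <-]].
  by exists (chart i m') => //=; rewrite /local_rep /= chartK.
exists (param i x) => //=; split; first exact: param_in (BO x Bx).
by rewrite paramK //; exact: BO.
Qed.

End LocalToGlobal.

Theorem theorem4p2 (R : realType) (M : topologicalType)
  (A : surface_structure R M) (F : M -> 'HH[R])
  (GammaN : 'HH[R] -> 'HH[R] -> 'HH[R] -> 'HH[R])
  (GammaM : chart_index A -> 'rV[R]_2 -> 'rV[R]_2 -> 'rV[R]_2 -> 'rV[R]_2)
  (M_connected : connected [set: M])
  (F_immersion : is_immersion A F)
  (F_almost_complex : almost_complex A F)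
  (GammaN_LC : is_levi_civita_S3xS3 GammaN)
  (GammaM_LC : is_levi_civita_surface F GammaM)
  (h_parallel : parallel_second_fundamental_form F GammaN GammaM) :
  locally_congruent F [set: R * R] (@flat_torus R) \/
  locally_congruent F (@imaginary_sphere R) (@round_sphere R).
Proof.
have fe := flat_or_equilateral F_immersion F_almost_complex GammaN_LC GammaM_LC h_parallel.
have dj := flat_equilateral_disjoint F_immersion F_almost_complex.
have di := dichotomy F_immersion F_almost_complex GammaN_LC GammaM_LC h_parallel.
have oF := open_flat_set F_immersion F_almost_complex GammaN_LC GammaM_LC h_parallel.
have oE := open_equilateral_set F_immersion F_almost_complex GammaN_LC GammaM_LC h_parallel.
have im i x (Ox : @chart_img _ _ A i x) := param_in Ox.
have [m0|n0] := pselect (flat_set A F !=set0).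
  left.
  have allF : flat_set A F = setT.
    apply: M_connected => //.
      by exists (flat_set A F) => //; rewrite setTI.
    exists (~` equilateral_set A F); first exact: open_closedC.
    rewrite setTI; apply/seteqP; split=> m h; first by move=> /(dj _ h).
    by have [] := fe m.
  apply: (piece_congruent (A := A)) => i x0.
  apply: (torus_piece (@chart_open _ _ A i) (@chart_S3xS3 _ _ _ _ F_immersion i)
    (@chart_smooth _ _ _ _ F_immersion i) (@chart_immersed _ _ _ _ F_immersion i)
    (@chart_complex _ _ _ _ F_almost_complex i)) => x v Ox.
  apply: (flat_all F_immersion F_almost_complex Ox).
  have [//|e] := di i x Ox.
  have fm : flat_set A F (param i x) by rewrite allF.
  by case: (dj _ fm); exists i; [exact: param_in|rewrite paramK].
right; apply: (piece_congruent (A := A)) => i x0.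
apply: (sphere_piece (@chart_open _ _ A i) (@chart_S3xS3 _ _ _ _ F_immersion i)
    (@chart_smooth _ _ _ _ F_immersion i) (@chart_immersed _ _ _ _ F_immersion i)
    (@chart_complex _ _ _ _ F_almost_complex i)) => [x v Ox|t v w x Ox].
  apply: (equilateral_all F_immersion F_almost_complex Ox).
  have [f|//] := di i x Ox.
  by case: n0; exists (param i x); exists i; [exact: param_in|rewrite paramK].
exact: (parallel_tangent (@chart_open _ _ A i) (@chart_S3xS3 _ _ _ _ F_immersion i)
    (@chart_smooth _ _ _ _ F_immersion i) (@chart_immersed _ _ _ _ F_immersion i)
    GammaN_LC (GammaM_LC i) (@h_parallel i)).
Qed.
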